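(* (1) The functions $\{\widehat p^{\mathbb L}_\lambda(\mathbf y)\}_{\lambda\in\mathcal{SP}}$ are linearly independent over $\mathbb L$ and form an $\mathbb L$-basis of $\Gamma_{\mathbb L}(\mathbf y)$. (2) The functions $\{\widehat q^{\mathbb L}_\lambda(\mathbf y)\}_{\lambda\in\mathcal{SP}}$ are linearly independent over $\mathbb L$ and form an $\mathbb L$-basis of $\Gamma^+_{\mathbb L}(\mathbf y)$.
   Context: $\mathbb L$ is the Lazard ring with universal formal group law $F_{\mathbb L}(u,v)=u+v+\sum_{i,j\ge1}a_{i,j}u^iv^j$; $a+_Fb=F_{\mathbb L}(a,b)$ and $\overline a\in\mathbb L[[a]]$ is the formal inverse ($a+_F\overline a=0$). $\mathcal{SP}$ is the set of all strict partitions. For a strict partition $\lambda=(\lambda_1>\cdots>\lambda_r>0)$ and $n\ge r$, $$P^{\mathbb L}_\lambda(x_1,\ldots,x_n)=\frac1{(n-r)!}\sum_{w\in S_n}w\Big[\prod_{i=1}^rx_i^{\lambda_i}\prod_{i=1}^r\prod_{j=i+1}^n\frac{x_i+_Fx_j}{x_i+_F\overline x_j}\Big],$$ $$Q^{\mathbb L}_\lambda(x_1,\ldots,x_n)=\frac1{(n-r)!}\sum_{w\in S_n}w\Big[\prod_{i=1}^r(x_i+_Fx_i)x_i^{\lambda_i-1}\prod_{i=1}^r\prod_{j=i+1}^n\frac{x_i+_Fx_j}{x_i+_F\overline x_j}\Big]$$ ($S_n$ permuting $x_1,\ldots,x_n$; both $0$ for $n<r$), and $P^{\mathbb L}_\lambda(\mathbf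 x),Q^{\mathbb L}_\lambda(\mathbf x)$ are their inverse limits as $n\to\infty$ along $x_{n+1}=0$ (they are stable under this specialization). Let $\Lambda_{\mathbb L}(\mathbf y)=\mathbb L\otimes_{\mathbb Z}\Lambda(\mathbf y)$, the ring of symmetric functions in $\mathbf y=(y_1,y_2,\ldots)$ over $\mathbb L$. Define $\widehat q^{\mathbb L}_k(\mathbf y)$ ($k\ge0$) and $\widehat p^{\mathbb L}_k(\mathbf y)$ ($k\ge1$) in $\Lambda_{\mathbb L}(\mathbf y)$ by $$\Delta(t;\mathbf y)=\prod_{j\ge1}\frac{1-\overline ty_j}{1-ty_j}=\sum_{k\ge0}\widehat q^{\mathbb L}_k(\mathbf y)t^k=1+(t+_Ft)\sum_{k\ge1}\widehat p^{\mathbb L}_k(\mathbf y)t^{k-1}.$$ $\Gamma_{\mathbb L}(\mathbf y)$ (resp. $\Gamma^+_{\mathbb L}(\mathbf y)$) is the $\mathbb L$-subalgebra of $\Lambda_{\mathbb L}(\mathbf y)$ generated by $\widehat p^{\mathbb L}_k(\mathbf y)$ (resp. $\widehat q^{\mathbb L}_k(\mathbf y)$), $k=1,2,\ldots$. The dual universal Schur functions $\widehat p^{\mathbb L}_\lambda(\mathbf y)\in\Gamma_{\mathbb L}(\mathbf y)$ and $\widehat q^{\mathbb L}_\lambda(\mathbf y)\in\Gamma^+_{\mathbb L}(\mathbf y)$, $\lambda\in\mathcal{SP}$, are defined by the Cauchy identities $$\prod_{i,j\ge1}\frac{1-\overline x_iy_j}{1-x_iy_j}=\sum_{\lambda\in\mathcal{SP}}Q^{\mathbb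 L}_\lambda(\mathbf x)\,\widehat p^{\mathbb L}_\lambda(\mathbf y)=\sum_{\lambda\in\mathcal{SP}}P^{\mathbb L}_\lambda(\mathbf x)\,\widehat q^{\mathbb L}_\lambda(\mathbf y).$$ *)

(* Defs.v *)
From HB Require Import structures.
From mathcomp Require Import all_boot all_order all_algebra all_fingroup.
From mathcomp Require Import boolp.
From mathcomp Require Import mpoly.

Set Implicit Arguments.
Unset Strict Implicit.
Unset Printing Implicit Defensive.

Import GRing.Theory.
Local Open Scope ring_scope.

Record mseries (n : nat) (R : Type) := MSeries { mscoef :> 'X_{1..n} -> R }.

Section MSeriesRing.
Variables (n : nat) (R : comNzRingType).
Implicit Types (f g h : mseries n R) (m : 'X_{1..n}).

Lemma mseriesP f g : (forall m, f m = g m) -> f = g.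
Proof. by case: f g => [f] [g] /= /funext ->. Qed.

HB.instance Definition _ := gen_eqMixin (mseries n R).
HB.instance Definition _ := gen_choiceMixin (mseries n R).

Definition mser0 : mseries n R := MSeries (fun=> 0).
Definition mser_opp f : mseries n R := MSeries (fun m => - f m).
Definition mser_add f g : mseries n R := MSeries (fun m => f m + g m).

Fact mser_addA : associative mser_add.
Proof. by move=> f g h; apply: mseriesP => m /=; rewrite addrA. Qed.
Fact mser_addC : commutative mser_add.
Proof. by move=> f g; apply: mseriesP => m /=; rewrite addrC. Qed.
Fact mser_add0 : left_id mser0 mser_add.
Proof. by move=> f; apply: mseriesP => m /=; rewrite add0r. Qed.
Fact mser_addN : left_inverse mser0 mser_opp mser_add.
Proof. by move=> f; apply: mseriesP => m /=; rewrite addNr. Qed.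

HB.instance Definition _ :=
  GRing.isZmodule.Build (mseries n R)
    mser_addA mser_addC mser_add0 mser_addN.

Definition mserC (c : R) : mseries n R := MSeries (fun m => c *+ (m == 0%MM)).
Definition mserX (i : 'I_n) : mseries n R :=
  MSeries (fun m => (m == U_(i)%MM)%:R).

(* The Cauchy product; the bound on the degrees of the two factors of [m] only
   serves to make the index type finite. *)
Definition mser_mul f g : mseries n R :=
  MSeries (fun m => \sum_(k : 'X_{1..n < (mdeg m).+1, (mdeg m).+1}
                          | m == (k.1 + k.2)%MM) f k.1 * g k.2).

(* The ring axioms are transported from polynomials by truncation. *)
Definition mser_trunc d f : {mpoly R[n]} :=
  \sum_(m : 'X_{1..n < d}) f m *: 'X_[m].

Lemma mcoeff_trunc d f m :
  (mser_trunc d f)@_m = if (mdeg m < d)%N then f m else 0.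
Proof.
rewrite raddf_sum /=; case: ifPn => lt_md.
  rewrite (bigD1 (BMultinom lt_md)) //= mcoeffZ mcoeffX eqxx mulr1.
  rewrite big1 ?addr0 // => k; rewrite bmeqP /= => /negPf ne.
  by rewrite mcoeffZ mcoeffX ne mulr0.
rewrite big1 // => k _; rewrite mcoeffZ mcoeffX; case: eqP => [eq|_].
  by move: lt_md; rewrite -eq bmdeg.
by rewrite mulr0.
Qed.

Lemma mser_mulE d f g m : (mdeg m < d)%N ->
  mser_mul f g m = (mser_trunc d f * mser_trunc d g)@_m.
Proof.
move=> lt_md; rewrite (mcoeff_poly_mul _ _ (ltnSn (mdeg m))) /=.
have lt (k : 'X_{1..n < (mdeg m).+1}) : (mdeg k < d)%N.
  by apply: leq_trans lt_md; apply: bmdeg.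
by apply: eq_bigr => k _; rewrite !mcoeff_trunc !lt.
Qed.

Lemma eq_mcoeffM d (p q p' q' : {mpoly R[n]}) m : (mdeg m < d)%N ->
    (forall k, (mdeg k < d)%N -> p@_k = p'@_k) ->
    (forall k, (mdeg k < d)%N -> q@_k = q'@_k) ->
  (p * q)@_m = (p' * q')@_m.
Proof.
move=> lt_md Ep Eq; rewrite !(mcoeff_poly_mul _ _ lt_md).
by apply: eq_bigr => k _; rewrite Ep ?Eq ?bmdeg.
Qed.

Fact mser_mulC : commutative mser_mul.
Proof.
move=> f g; apply: mseriesP => m.
by rewrite !(mser_mulE _ _ (ltnSn _)) mulrC.
Qed.

Fact mser_mulA : associative mser_mul.
Proof.
move=> f g h; apply: mseriesP => m; have lt_m := ltnSn (mdeg m).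
rewrite !(mser_mulE _ _ lt_m); set d := (mdeg m).+1 in lt_m *.
rewrite (@eq_mcoeffM d _ _ (mser_trunc d f) (mser_trunc d g * mser_trunc d h)) //.
  rewrite mulrA; apply: (@eq_mcoeffM d) => // k lt_k.
  by rewrite mcoeff_trunc lt_k (mser_mulE _ _ lt_k).
by move=> k lt_k; rewrite mcoeff_trunc lt_k (mser_mulE _ _ lt_k).
Qed.

Fact mser_mul1 : left_id (mserC 1) mser_mul.
Proof.
move=> f; apply: mseriesP => m; have lt_m := ltnSn (mdeg m).
rewrite (mser_mulE _ _ lt_m); set d := (mdeg m).+1 in lt_m *.
rewrite (@eq_mcoeffM d _ _ 1 (mser_trunc d f)) //.
  by rewrite mul1r mcoeff_trunc lt_m.
by move=> k lt_k; rewrite mcoeff_trunc lt_k /= mcoeff1.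
Qed.

Fact mser_mulDl : left_distributive mser_mul mser_add.
Proof.
move=> f g h; apply: mseriesP => m /=; rewrite -big_split /=.
by apply: eq_bigr => k _; rewrite mulrDl.
Qed.

Fact mser1_neq0 : mserC 1 != 0.
Proof.
apply/eqP => /(congr1 (fun f : mseries n R => f 0%MM)) /= /eqP.
by rewrite eqxx oner_eq0.
Qed.

HB.instance Definition _ :=
  GRing.Zmodule_isComNzRing.Build (mseries n R)
    mser_mulA mser_mulC mser_mul1 mser_mulDl mser1_neq0.

(* [mser_comp c f] is sum_(k >= 0) c_k f^k, for [f] without constant term:
   then f^k has no monomial of degree less than k, so that the truncated sum
   computes the coefficient of [m]. *)
Definition mser_comp (c : nat -> R) f : mseries n R :=
  MSeries (fun m => \sum_(k < (mdeg m).+1) c k * (f ^+ k) m).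

(* 1 / (1 - f), for [f] without constant term; see [mser_geomP]. *)
Definition mser_geom f : mseries n R := mser_comp (fun=> 1) f.

Lemma mcoefM f g m : (f * g) m =
  \sum_(k : 'X_{1..n < (mdeg m).+1, (mdeg m).+1} | m == (k.1 + k.2)%MM)
    f k.1 * g k.2.
Proof. by []. Qed.

Lemma mcoef_sum I (r : seq I) (P : pred I) (F : I -> mseries n R) m :
  (\sum_(i <- r | P i) F i) m = \sum_(i <- r | P i) F i m.
Proof. by apply: (big_morph (fun f : mseries n R => f m)). Qed.

Lemma mcoefX_small f k m : f 0%MM = 0 -> (mdeg m < k)%N -> (f ^+ k) m = 0.
Proof.
move=> f0; elim: k m => // k IHk m lt_m; rewrite exprS mcoefM.
rewrite big1 // => -[[p lt_p] [q lt_q]] /= /eqP Em.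
have [p0|p0] := eqVneq p 0%MM; first by rewrite p0 f0 mul0r.
rewrite IHk ?mulr0 // -ltnS; apply: leq_trans lt_m.
by rewrite ltnS Em mdegD -[X in (X < _)%N]add0n ltn_add2r lt0n mdeg_eq0.
Qed.

Lemma mser_geomP f : f 0%MM = 0 -> (1 - f) * mser_geom f = 1.
Proof.
move=> f0; apply: mseriesP => m.
have -> : ((1 - f) * mser_geom f) m =
          ((1 - f) * \sum_(k < (mdeg m).+1) f ^+ k) m.
  rewrite !mcoefM; apply: eq_bigr => j _; congr (_ * _).
  rewrite mcoef_sum /=; have := bmdeg j.2; set e := mdeg _ => lt_j.
  under eq_bigr do rewrite mul1r.
  rewrite (big_ord_widen _ (fun k => (f ^+ k) j.2) lt_j) big_mkcond /=.
  apply: eq_bigr => k _; case: ltnP => // le_k.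
  by rewrite mcoefX_small.
rewrite -opprB mulNr -subrX1 opprB.
rewrite -[LHS]/(_ m - (f ^+ (mdeg m).+1) m).
by rewrite (mcoefX_small f0 (ltnSn _)) subr0.
Qed.

End MSeriesRing.

Arguments mserC n {R} c.
Arguments mserX {n} R i.

Definition mser_map (n : nat) (R S : Type) (phi : R -> S) (f : mseries n R) :
  mseries n S := MSeries (fun m => phi (f m)).

(* Convergence of a family of series, for the product topology on the
   coefficients (discrete coefficients). *)
Definition mser_sums (n : nat) (R : comNzRingType) (I : eqType)
    (F : I -> mseries n R) (f : mseries n R) : Prop :=
  forall m, exists A : seq I, forall B : seq I, uniq B -> {subset A <= B} ->
    \sum_(i <- B) F i m = f m.

(* sum_(i, j) a_ij f^i g^j, for [f] and [g] without constant term. *)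
Definition fgl_subst (R : comNzRingType) (a : nat -> nat -> R) (n : nat)
    (f g : mseries n R) : mseries n R :=
  MSeries (fun m => \sum_(i < (mdeg m).+1) \sum_(j < (mdeg m).+1)
                      a i j * (f ^+ i * g ^+ j) m).

(* F(u, v) = sum_(i, j) a_ij u^i v^j. The first two axioms, F(u, 0) = u and
   F(0, v) = v, say that F(u, v) = u + v + sum_(i, j >= 1) a_ij u^i v^j. *)
Record fgl (R : comNzRingType) := FGL {
  fgl_coef :> nat -> nat -> R;
  fgl_u0 : forall i, fgl_coef i 0%N = (i == 1%N)%:R;
  fgl_0v : forall j, fgl_coef 0%N j = (j == 1%N)%:R;
  fgl_comm : forall i j, fgl_coef i j = fgl_coef j i;
  fgl_assoc :
    let x i : mseries 3 R := mserX R (inord i) in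
    let add := fgl_subst fgl_coef in
    add 3%N (add 3%N (x 0%N) (x 1%N)) (x 2%N) =
    add 3%N (x 0%N) (add 3%N (x 1%N) (x 2%N)) }.

Definition fgl_add (R : comNzRingType) (F : fgl R) (n : nat)
  (f g : mseries n R) : mseries n R := fgl_subst F f g.

Definition is_lazard (L : comNzRingType) (F : fgl L) : Prop :=
  forall (R : comNzRingType) (G : fgl R),
    exists2 phi : {rmorphism L -> R}, (forall i j, phi (F i j) = G i j) &
      forall psi : {rmorphism L -> R},
        (forall i j, psi (F i j) = G i j) -> psi =1 phi.

(* The formal inverse is sum_(k >= 1) chi_k x^k. *)
Definition is_formal_inverse (L : comNzRingType) (F : fgl L) (chi : nat -> L) :
  Prop :=
  let x := mserX L (ord0 : 'I_1) in
  chi 0%N = 0 /\ fgl_add F x (mser_comp chi x) = 0.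

Definition is_strict (l : seq nat) : bool := sorted gtn l && (0%N \notin l).

Definition strict_partition := {l : seq nat | is_strict l}.

Section UniversalPQ.
Variables (L : comNzRingType) (F : fgl L) (chi : nat -> L).

Local Notation "f +_F g" := (fgl_add F f g) (at level 50, left associativity).
Local Notation "\bar_F f" := (mser_comp chi f) (at level 35, f at level 35).

Section Level.
Variable n : nat.
Local Notation x i := (mserX L (i : 'I_n)).

(* Let E be the fraction
     prod_(i < r) wt l_i x_i * prod_(i < r) prod_(i < j < n)
       (x_i +_F x_j) / (x_i +_F \bar_F x_j)
   with r the length of [l]. As w permutes the factors of
     D = prod_(i, j < n, i != j) (x_i +_F \bar_F x_j),
   the product D * w[E] is the series [PQ_term wt l w], and
   P = 1 / (n - r)! * sum_w w[E] amounts to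
   (n - r)! * D * P = sum_w [PQ_term wt l w]. *)
Definition PQ_den : mseries n L :=
  \prod_(i < n) \prod_(j < n | j != i) (x i +_F \bar_F (x j)).

Definition PQ_term (wt : nat -> mseries n L -> mseries n L) (l : seq nat)
    (w : 'S_n) : mseries n L :=
  let r := size l in
  (\prod_(i < n | (i < r)%N) wt (nth 0%N l i) (x (w i))) *
  (\prod_(i < n | (i < r)%N) \prod_(j < n | (i < j)%N) (x (w i) +_F x (w j))) *
  (\prod_(i < n) \prod_(j < n | (j != i) && ~~ ((i < r) && (i < j))%N)
      (x (w i) +_F \bar_F (x (w j)))).

Definition is_PQ (wt : nat -> mseries n L -> mseries n L) (l : seq nat)
    (P : mseries n L) : Prop :=
  if (n < size l)%N then P = 0
  else ((n - size l)`!)%:R * PQ_den * P = \sum_(w : 'S_n) PQ_term wt l w.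

End Level.

(* An element of the inverse limit of the L[[x_0, ..., x_(n-1)]] is given by
   its images [P l n] in each of these rings. *)
Definition is_universal_P (P : strict_partition -> forall n, mseries n L) :
  Prop :=
  forall l n, is_PQ (fun k f => f ^+ k) (val l) (P l n).

Definition is_universal_Q (Q : strict_partition -> forall n, mseries n L) :
  Prop :=
  forall l n, is_PQ (fun k f => (f +_F f) * f ^+ k.-1) (val l) (Q l n).

End UniversalPQ.

(* Sequences of polynomials f_m in R[y_0, ..., y_(m-1)], m >= 0. *)
Definition mpfamily (R : comNzRingType) := forall m, {mpoly R[m]}.

Section MPFamilyAlgebra.
Variable R : comNzRingType.
Implicit Types f g h : mpfamily R.

Lemma mpfamilyP f g : (forall m, f m = g m) -> f = g.
Proof. exact: functional_extensionality_dep. Qed.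

HB.instance Definition _ := gen_eqMixin (mpfamily R).
HB.instance Definition _ := gen_choiceMixin (mpfamily R).

Definition mpf_add f g : mpfamily R := fun m => f m + g m.
Definition mpf_mul f g : mpfamily R := fun m => f m * g m.
Definition mpf_opp f : mpfamily R := fun m => - f m.
Definition mpf_scale (c : R) f : mpfamily R := fun m => c *: f m.

Fact mpf_addA : associative mpf_add.
Proof. by move=> f g h; apply: mpfamilyP => m; apply: addrA. Qed.
Fact mpf_addC : commutative mpf_add.
Proof. by move=> f g; apply: mpfamilyP => m; apply: addrC. Qed.
Fact mpf_add0 : left_id ((fun=> 0) : mpfamily R) mpf_add.
Proof. by move=> f; apply: mpfamilyP => m; apply: add0r. Qed.
Fact mpf_addN : left_inverse ((fun=> 0) : mpfamily R) mpf_opp mpf_add.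
Proof. by move=> f; apply: mpfamilyP => m; apply: addNr. Qed.

HB.instance Definition _ :=
  GRing.isZmodule.Build (mpfamily R) mpf_addA mpf_addC mpf_add0 mpf_addN.

Fact mpf_mulA : associative mpf_mul.
Proof. by move=> f g h; apply: mpfamilyP => m; apply: mulrA. Qed.
Fact mpf_mulC : commutative mpf_mul.
Proof. by move=> f g; apply: mpfamilyP => m; apply: mulrC. Qed.
Fact mpf_mul1 : left_id ((fun=> 1) : mpfamily R) mpf_mul.
Proof. by move=> f; apply: mpfamilyP => m; apply: mul1r. Qed.
Fact mpf_mulDl : left_distributive mpf_mul mpf_add.
Proof. by move=> f g h; apply: mpfamilyP => m; apply: mulrDl. Qed.
Fact mpf_1neq0 : ((fun=> 1) : mpfamily R) != 0.
Proof.
apply/eqP => /(congr1 (fun f : mpfamily R => f 0%N)) /eqP.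
by rewrite oner_eq0.
Qed.

HB.instance Definition _ :=
  GRing.Zmodule_isComNzRing.Build (mpfamily R)
    mpf_mulA mpf_mulC mpf_mul1 mpf_mulDl mpf_1neq0.

Fact mpf_scaleA c d f : mpf_scale c (mpf_scale d f) = mpf_scale (c * d) f.
Proof. by apply: mpfamilyP => m; apply: scalerA. Qed.
Fact mpf_scale1 : left_id 1 mpf_scale.
Proof. by move=> f; apply: mpfamilyP => m; apply: scale1r. Qed.
Fact mpf_scaleDr : right_distributive mpf_scale +%R.
Proof. by move=> c f g; apply: mpfamilyP => m; apply: scalerDr. Qed.
Fact mpf_scaleDl f : {morph mpf_scale^~ f : c d / c + d}.
Proof. by move=> c d; apply: mpfamilyP => m; apply: scalerDl. Qed.

HB.instance Definition _ :=
  GRing.Zmodule_isLmodule.Build R (mpfamily R)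
    mpf_scaleA mpf_scale1 mpf_scaleDr mpf_scaleDl.

Fact mpf_scaleAl (c : R) f g : c *: (f * g) = (c *: f) * g.
Proof. by apply: mpfamilyP => m; exact: (scalerAl c (f m) (g m)). Qed.

HB.instance Definition _ :=
  GRing.Lmodule_isLalgebra.Build R (mpfamily R) mpf_scaleAl.
HB.instance Definition _ := GRing.Lalgebra_isComAlgebra.Build R (mpfamily R).

(* The specialization y_m = 0. *)
Definition mp_restrict m (p : {mpoly R[m.+1]}) : {mpoly R[m]} :=
  p \mPo [tuple if unlift ord_max i is Some j then 'X_j else 0 | i < m.+1].

Definition is_symfun f : Prop :=
  [/\ forall m, f m \is symmetric,
      forall m, mp_restrict (f m.+1) = f m &
      exists d, forall m, (msize (f m) <= d)%N].

Definition symfun_pred : {pred mpfamily R} := fun f => `[< is_symfun f >].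

Fact symfun_subalg_closed : GRing.subalg_closed symfun_pred.
Proof.
split=> [|c f g|f g].
- apply/asboolP; split=> [m|m|]; first exact: rpred1.
    exact: comp_mpoly1.
  by exists 1%N => m; rewrite msize1.
- move=> /asboolP[sf rf [d bf]] /asboolP[sg rg [e bg]]; apply/asboolP.
  split=> [m|m|]; first exact: (rpredD (rpredZ c (sf m)) (sg m)).
    by rewrite -[RHS]/(c *: f m + g m) -rf -rg [LHS]comp_mpolyD comp_mpolyZ.
  exists (maxn d e) => m; apply: leq_trans (msizeD_le _ _) _.
  by rewrite geq_max !leq_max (leq_trans (msizeZ_le _ _)) ?bf ?bg ?orbT.
- move=> /asboolP[sf rf [d bf]] /asboolP[sg rg [e bg]]; apply/asboolP.
  split=> [m|m|]; first exact: (rpredM (sf m) (sg m)).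
    by rewrite -[RHS]/(f m * g m) -rf -rg [LHS]rmorphM.
  exists (d + e).+1 => m; apply: leq_trans (msizeM_le _ _) _.
  by rewrite ltnS leq_add.
Qed.

HB.instance Definition _ :=
  GRing.isSubalgClosed.Build R (mpfamily R) symfun_pred symfun_subalg_closed.

End MPFamilyAlgebra.

(* The ring Lambda_R(y) of symmetric functions, as the inverse limit of the
   rings of symmetric polynomials in the category of graded rings. *)
Record symfun (R : comNzRingType) := SymFun {
  symfun_val : mpfamily R;
  symfun_valP : symfun_val \in @symfun_pred R }.

(* f(y_0, ..., y_(m-1), 0, 0, ...) *)
Definition symfun_eval (R : comNzRingType) (f : symfun R) (m : nat) :
  {mpoly R[m]} := symfun_val f m.
Coercion symfun_eval : symfun >-> Funclass.

Section SymFunAlgebra.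
Variable R : comNzRingType.
HB.instance Definition _ := [isSub for @symfun_val R].
HB.instance Definition _ := [Choice of symfun R by <:].
HB.instance Definition _ := [SubChoice_isSubComNzRing of symfun R by <:].
HB.instance Definition _ := [SubZmodule_isSubLmodule of symfun R by <:].
HB.instance Definition _ :=
  [SubNzRing_SubLmodule_isSubLalgebra of symfun R by <:].
HB.instance Definition _ := [SubLalgebra_isSubAlgebra of symfun R by <:].
End SymFunAlgebra.

Section Dual.
Variables (L : comNzRingType) (F : fgl L) (chi : nat -> L).

Local Notation "f +_F g" := (fgl_add F f g) (at level 50, left associativity).
Local Notation "\bar_F f" := (mser_comp chi f) (at level 35, f at level 35).

(* From L[[x_0, ..., x_(n-1)]] to L[y_0, ..., y_(m-1)][[x_0, ..., x_(n-1)]]. *)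
Definition lift_series n m (f : mseries n L) : mseries n {mpoly L[m]} :=
  mser_map (@mpolyC m L) f.

(* Delta(f; y_0, ..., y_(m-1)) =
     prod_(j < m) (1 - \bar_F f * y_j) / (1 - f * y_j). *)
Definition Delta n m (f : mseries n L) : mseries n {mpoly L[m]} :=
  \prod_(j < m) ((1 - lift_series m (\bar_F f) * mserC n 'X_j) *
                 mser_geom (lift_series m f * mserC n 'X_j)).

Definition var_t : mseries 1 L := mserX L ord0.

(* [qk k] and [pk k] are qhat_k and phat_k; [pk 0] is irrelevant. *)
Definition is_qhat (qk : nat -> symfun L) : Prop :=
  forall m, Delta m var_t =
    mser_comp (fun k => qk k m) (lift_series m var_t).

Definition is_phat (pk : nat -> symfun L) : Prop :=
  forall m, Delta m var_t =
    1 + lift_series m (var_t +_F var_t) *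
        mser_comp (fun k => pk k.+1 m) (lift_series m var_t).

(* The identity
     prod_(i, j) (1 - \bar_F x_i * y_j) / (1 - x_i * y_j) =
     sum_(l strict) S_l(x) s_l(y)
   in n variables x and m variables y, for all n and m. *)
Definition Cauchy_identity (S : strict_partition -> forall n, mseries n L)
    (s : strict_partition -> symfun L) : Prop :=
  forall n m,
    mser_sums (fun l => lift_series m (S l n) * mserC n (s l m))
              (\prod_(i < n) Delta m (mserX L i)).

End Dual.

Definition gen_subalg (R : comNzRingType) (A : lalgType R) (G : A -> Prop)
    (f : A) : Prop :=
  forall S : {pred A}, GRing.subalg_closed S -> (forall g, G g -> g \in S) ->
    f \in S.

(* Gamma_L(y) and Gamma^+_L(y) are [gen_by pk] and [gen_by qk]. *)
Definition gen_by (L : comNzRingType) (g : nat -> symfun L) :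
  symfun L -> Prop :=
  gen_subalg (fun f : symfun L => exists2 k, (0 < k)%N & f = g k).

Definition lin_indep (R : nzRingType) (V : lmodType R) (I : eqType)
    (v : I -> V) : Prop :=
  forall (s : seq I) (c : I -> R), uniq s ->
    \sum_(i <- s) c i *: v i = 0 -> forall i, i \in s -> c i = 0.

Definition lin_span (R : nzRingType) (V : lmodType R) (I : eqType)
    (v : I -> V) (f : V) : Prop :=
  exists (s : seq I) (c : I -> R), f = \sum_(i <- s) c i *: v i.

Definition is_basis_of (R : nzRingType) (V : lmodType R) (I : eqType)
    (v : I -> V) (W : V -> Prop) : Prop :=
  lin_indep v /\ forall f, W f <-> lin_span v f.

(* Main.v *)
(* Proof idea.  Order the monomials of L[[x_1, x_2, ...]] by the weight
   sum_i i * (exponent of x_i).  Multiplying the defining symmetrizations by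
   prod_(i != j) (x_i +_F \bar x_j), whose term of least weight is a single
   monomial with coefficient +-1, one reads off that P_lambda (resp. Q_lambda)
   has x^lambda as its unique term of least weight, with coefficient 1 (resp.
   2^(length lambda)).  Comparing the coefficients of x^alpha on both sides of
   the Cauchy identities gives
     prod_i qhat_(alpha_i) = sum_lambda P_lambda[x^alpha] qhat_lambda
                           = sum_lambda Q_lambda[x^alpha] phat_lambda,
   which is triangular with respect to the weight.  The first expansion settles
   qhat up to linear independence.  For phat the powers of 2 must be removed:
   modulo 2 and lower degree phat_k is the power sum p_k(y), so that the
   products prod_i phat_(lambda_i), lambda strict, are linearly independent and
   span a submodule which is 2-saturated in the symmetric functions; hence these
   products and the phat_lambda are related by a unitriangular matrix over L.

   All this uses two facts on the Lazard ring: it has no torsion and no nonzero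
   element divisible by all powers of 2.  For a prime p, associativity of F and
   the congruence 'C(a, p^t) = a %/ p^t mod p show that, up to multiples prime
   to p, L is generated by one coefficient of F in each degree; the formal group
   laws exp(log u + log v) over rings of rational polynomials map these
   generators to independent variables. *)
From HB Require Import structures.
Require Import Defs.
From mathcomp Require Import all_boot all_order all_algebra all_fingroup.
From mathcomp Require Import boolp zify ring.
From mathcomp Require Import mpoly.

Set Implicit Arguments.
Unset Strict Implicit.
Unset Printing Implicit Defensive.

(** * Binomial coefficients modulo a prime *)

(** In total degree, x_i +_F \bar x_j starts with the binomial x_i - x_j. Giving x_i the weight i
    ([i.+1] for indices from 0) breaks the tie, so that denominators are compared through single
    monomials. The rearrangement inequality then singles out, among all w in S_n, the (n - r)!
    permutations fixing the first r indices, and torsion-freeness is needed to cancel this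
    factorial.

    Removing the powers of 2 works because the same power occurs twice: Q_lambda has leading
    coefficient 2^r, and qhat_k = 2 phat_k + lower terms, as t +_F t starts with 2t. Hence 2^r
    (phat_lambda - prod_i phat_(lambda_i)) lies in the span of lower products, and saturation
    divides by 2^r. Saturation also straightens products with repeated indices, which the Cauchy
    identity reaches only up to a power of 2.

    The independence missing on the qhat side is borrowed from the phat side: prod_i qhat_(lambda_i)
    is 2^r prod_i phat_(lambda_i) plus lower terms, and 2^r is a nonzerodivisor.

    Torsion is excluded one prime at a time; divisibility by powers of 2 is tested locally at 2. *)

Lemma dvdn_bin_ppow p t i : prime p -> 0 < i < p ^ t -> p %| 'C(p ^ t, i).
Proof.
move=> p_pr /andP[i_gt0 lt_i]; apply: contraLR lt_i => ndvd; rewrite -leqNgt.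
case: i i_gt0 ndvd => // i _ ndvd; apply: dvdn_leq => //.
have cop : coprime (p ^ t) 'C(p ^ t, i.+1).
  by rewrite coprimeXl // prime_coprime.
by rewrite -(Gauss_dvdl _ cop) -mul_bin_diag dvdn_mulr.
Qed.

(** In the Vandermonde sum for 'C(p^t + b, p^t) the inner terms vanish mod p, so taking p^t off a
    lowers both sides by 1. *)
Lemma bin_ppow_mod p t a : prime p -> 'C(a, p ^ t) = a %/ p ^ t %[mod p].
Proof.
move=> p_pr; have q_gt0 : 0 < p ^ t by rewrite expn_gt0 prime_gt0.
have [k le_k] := ubnP a; elim: k a le_k => // k IHk a lt_a.
have [lt_q|le_q] := ltnP a (p ^ t); first by rewrite bin_small // divn_small.
rewrite -(subnK le_q); set b := a - p ^ t.
rewrite divnDr // divnn q_gt0 -modnDml -IHk; last by rewrite /b; lia.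
rewrite modnDml -binomial.Vandermonde big_ord_recl /= bin0 subn0 binn mul1n.
have [q' Eq] : exists q', p ^ t = q'.+1 by exists (p ^ t).-1; rewrite prednK.
rewrite Eq big_ord_recr /= /bump /= add1n subnn bin0 muln1 -addnS addn1.
set S := \sum_(i < q') _; have dvdS : p %| S.
  rewrite dvdn_sum // => i _; rewrite dvdn_mull // -Eq dvdn_bin_ppow // Eq.
  by have := ltn_ord i; lia.
by rewrite -modnDml (eqP dvdS) add0n.
Qed.

Lemma dvdn_bin_ppowE p t a : prime p -> (p %| 'C(a, p ^ t)) = (p %| a %/ p ^ t).
Proof. by move=> p_pr; rewrite /dvdn bin_ppow_mod. Qed.

(* The index of a coefficient a_(g, n - g) generating the p-local
   indecomposables of degree n of the Lazard ring. *)
Definition lazard_gen p n :=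
  let u := trunc_log p n in if n == p ^ u then p ^ u.-1 else p ^ u.

Lemma lazard_gen_bound p n : prime p -> 1 < n -> 0 < lazard_gen p n < n.
Proof.
move=> p_pr n_gt1; have p_gt1 := prime_gt1 p_pr; rewrite /lazard_gen.
have := trunc_logP p_gt1 (ltnW n_gt1); set u := trunc_log p n => le_u.
case: eqP => [En|/eqP ne]; rewrite expn_gt0 (prime_gt0 p_pr) /=.
  have u_gt0 : 0 < u by case: u En {le_u} => // En; rewrite En in n_gt1.
  by rewrite [X in _ < X]En ltn_exp2l // prednK.
by rewrite ltn_neqAle le_u eq_sym ne.
Qed.

(** * Which coefficients of a given total degree generate the others *)

Section Generation.
Variables (p n : nat) (G : nat -> Prop).
Hypotheses (p_pr : prime p) (n_gt1 : 1 < n).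
Hypothesis G_sym : forall l, 0 < l < n -> G l -> G (n - l).
Hypothesis G_bin : forall i l, 0 < i < l -> l < n -> ~~ (p %| 'C(l, i)) ->
  G i -> G l.
Hypothesis G_gen : G (lazard_gen p n).

Let p_gt1 : 1 < p := prime_gt1 p_pr.

(** [G l] will mean that a_(l, n - l) lies in a subring closed under division by integers prime to
    p; [G_sym] is then commutativity and [G_bin] associativity in degree n. The hypothesis on l says
    that its digit t in base p is nonzero, so 'C(l, p^t) is prime to p. *)
Lemma G_of_ppow t l : 0 < l < n -> ~~ (p %| l %/ p ^ t) -> G (p ^ t) -> G l.
Proof.
move=> /andP[l_gt0 lt_l] ndvd Gt.
have le_t : p ^ t <= l.
  by rewrite leqNgt; apply: contra ndvd => /divn_small->.
move: le_t; rewrite leq_eqVlt => /predU1P[<- //|lt_t].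
apply: (G_bin _ lt_l) Gt; last by rewrite dvdn_bin_ppowE.
by rewrite lt_t expn_gt0 prime_gt0.
Qed.

Lemma G_ppow_sub t s : p ^ s < n -> ~~ (p %| (n - p ^ s) %/ p ^ t) ->
  G (p ^ t) -> G (p ^ s).
Proof.
move=> lt_s ndvd Gt; have s_gt0 : 0 < p ^ s by rewrite expn_gt0 prime_gt0.
rewrite -[p ^ s](subKn (ltnW lt_s)); apply: G_sym; first by lia.
by apply: G_of_ppow ndvd Gt; lia.
Qed.

Lemma ndvd_small k : 0 < k < p -> ~~ (p %| k).
Proof. by case/andP=> k_gt0 lt_k; apply/negP => /dvdn_leq; lia. Qed.

(** By symmetry p^s is reached through n - p^s, as soon as the digit of n - p^s at the position of
    an already known power is nonzero. *)
Lemma G_ppow s : p ^ s < n -> G (p ^ s).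
Proof.
move=> lt_s; move: G_gen; rewrite /lazard_gen.
have /andP[] := trunc_log_bounds p_gt1 (ltnW n_gt1); set u := trunc_log p n.
move=> le_u lt_u; have q_gt0 t : 0 < p ^ t by rewrite expn_gt0 prime_gt0.
case: eqP => [En|/eqP ne] Gu.
  have lt_su : s < u by rewrite -(ltn_exp2l _ _ p_gt1) -En.
  have Eu : p ^ u = p * p ^ u.-1 by rewrite -expnS prednK // (leq_ltn_trans _
    lt_su).
  have [/eqP Es|ne_s] := boolP (s == u.-1); first by rewrite Es.
  apply: G_ppow_sub Gu => //; apply: ndvd_small; rewrite divn_gt0 //.
  have le1 : p ^ s * p <= p ^ u.-1 by rewrite -expnSr leq_exp2l //; lia.
  by rewrite ltn_divLR // En Eu; nia.
have {ne}lt_un : p ^ u < n by rewrite ltn_neqAle eq_sym ne.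
have [-> //|ne_s] := eqVneq s u.
have {ne_s}lt_su : s < u.
  by have := ltn_trans lt_s lt_u; rewrite ltn_exp2l //; lia.
have direct r : r < u -> p ^ u + p ^ r <= n -> G (p ^ r).
  move=> lt_r le_r; apply: G_ppow_sub Gu; first by have := q_gt0 u; lia.
  apply: ndvd_small; rewrite divn_gt0 // ltn_divLR // -expnS.
  by have := q_gt0 r; lia.
have [le_n|lt_n] := leqP (p ^ u + p ^ s) n; first exact: direct.
(* Here n - p^s < p^u, so its digit u is 0. The detour is p^v, the exact power of p dividing n: it
   is reached directly, and (n - p^s) / p^v = n / p^v - p^(s - v) is prime to p because s > v. *)
have n_gt0 := ltnW n_gt1; set v := logn p n.
have lt_vs : v < s.
  rewrite ltnNge -pfactor_dvdn //; apply/negP => dvd_n.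
  have : p ^ s %| n - p ^ u by rewrite dvdn_sub // dvdn_exp2l // ltnW.
  by move/dvdn_leq; lia.
have dvd_n : p ^ v %| n by rewrite pfactor_dvdn.
have dvd_v r : v <= r -> p ^ v %| p ^ r by move=> ?; rewrite dvdn_exp2l.
have Gv : G (p ^ v).
  apply: direct; first by lia.
  have : p ^ v %| n - p ^ u by rewrite dvdn_sub // dvd_v //; lia.
  by move/dvdn_leq; lia.
apply: G_ppow_sub Gv => //.
have Es : p ^ s = p ^ (s - v) * p ^ v by rewrite -expnD subnK // ltnW.
have En := divnK dvd_n.
rewrite -[n in n - _]En Es -mulnBl mulnK //.
apply/negP => dvd1; have dvd2 : p %| p ^ (s - v).
  by rewrite -[p in p %| _]expn1 dvdn_exp2l // subn_gt0.
have : p %| n %/ p ^ v.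
  rewrite -(@subnK (p ^ (s - v)) (n %/ p ^ v)) ?dvdn_add //.
  by rewrite leq_divRL // -Es ltnW.
rewrite -(dvdn_pmul2r (q_gt0 v)) En -expnS pfactor_dvdn //.
by rewrite ltnn.
Qed.

(** With v the p-adic valuation of l, the digit v of l is nonzero. *)
Lemma lazard_gen_generates l : 0 < l < n -> G l.
Proof.
move=> lt_l; have /andP[l_gt0 _] := lt_l; set v := logn p l.
have dvd_l : p ^ v %| l by rewrite pfactor_dvdn.
apply: (@G_of_ppow v) => //; last first.
  by apply: G_ppow; have := dvdn_leq l_gt0 dvd_l; lia.
apply/negP; rewrite -(@dvdn_pmul2r (p ^ v)) ?expn_gt0 ?prime_gt0 //.
by rewrite divnK // -expnS pfactor_dvdn // ltnn.
Qed.
End Generation.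

Import GRing.Theory.
Local Open Scope ring_scope.

Arguments mscoef : simpl never.

(** * Substitution in formal power series *)

Section Series.
Variables (n : nat) (R : comNzRingType).
Implicit Types (f g h : mseries n R) (m : 'X_{1..n}).

Lemma mcoefC (c : R) m : mserC n c m = c *+ (m == 0%MM). Proof. by []. Qed.
Lemma mcoefX (i : 'I_n) m : mserX R i m = (m == U_(i)%MM)%:R :> R. Proof. by
  []. Qed.
Lemma mcoef0 m : (0 : mseries n R) m = 0. Proof. by []. Qed.
Lemma mcoef1 m : (1 : mseries n R) m = (m == 0%MM)%:R. Proof. by []. Qed.
Lemma mcoefD f g m : (f + g) m = f m + g m. Proof. by []. Qed.
Lemma mcoefN f m : (- f) m = - f m. Proof. by []. Qed.
Lemma mcoefMn f k m : (f *+ k) m = f m *+ k.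
Proof. by elim: k => [|k IHk]; rewrite ?mulr0n // !mulrS mcoefD IHk. Qed.

Lemma mcoefM_eq0 f g m :
  (forall a b, m = (a + b)%MM -> f a * g b = 0) -> (f * g) m = 0.
Proof. by move=> H; rewrite mcoefM big1 // => k /eqP/H. Qed.

Lemma mcoefM_D1 f g a b m :
    m = (a + b)%MM ->
    (forall a' b', m = (a' + b')%MM -> a' != a -> f a' * g b' = 0) ->
  (f * g) m = f a * g b.
Proof.
move=> Em H; rewrite mcoefM.
have la : (mdeg a < (mdeg m).+1)%N by rewrite Em mdegD ltnS leq_addr.
have lb : (mdeg b < (mdeg m).+1)%N by rewrite Em mdegD ltnS leq_addl.
rewrite (bigD1 (BMultinom la, BMultinom lb)) /=; last exact/eqP.
rewrite big1 ?addr0 // => -[a' b'] /= /andP[/eqP Em' ne]; apply: H => //.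
apply: contraNneq ne => Ea; rewrite -pair_eqE /= !bmeqP /= Ea eqxx /=.
by apply/eqP/(@addmI n a); rewrite -Em -Ea.
Qed.

Fact mserC_is_zmod : zmod_morphism (@mserC n R).
Proof. by move=> a b; apply: mseriesP => m;
  rewrite mcoefD mcoefN !mcoefC -mulrnBl. Qed.
Fact mserC_is_monoid : monoid_morphism (@mserC n R).
Proof.
split=> // a b; apply: mseriesP => m.
have [->|m0] := eqVneq m 0%MM.
  rewrite (@mcoefM_D1 _ _ 0 0) ?mcoefC ?eqxx ?mulr1n ?addm0 //.
  by move=> a' b' _ /negPf ne; rewrite mcoefC ne mul0r.
rewrite mcoefC (negPf m0) mulr0n [RHS]mcoefM_eq0 // => c d Em; rewrite !mcoefC.
have [c0|] := eqVneq c 0%MM; last by rewrite mulr0n mul0r.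
have [d0|] := eqVneq d 0%MM; last by rewrite mulr0n mulr0.
by move: m0; rewrite Em c0 d0 addm0 eqxx.
Qed.
HB.instance Definition _ :=
  GRing.isZmodMorphism.Build R (mseries n R) (@mserC n R) mserC_is_zmod.
HB.instance Definition _ :=
  GRing.isMonoidMorphism.Build R (mseries n R) (@mserC n R) mserC_is_monoid.

Lemma mcoefCM c f m : (mserC n c * f) m = c * f m.
Proof.
rewrite (@mcoefM_D1 _ _ 0 m) ?mcoefC ?eqxx ?mulr1n ?add0m //.
by move=> a b _ /negPf ne; rewrite mcoefC ne mul0r.
Qed.

Lemma mcoefMC c f m : (f * mserC n c) m = f m * c.
Proof. by rewrite mulrC mcoefCM mulrC. Qed.

Definition mmon (b : 'X_{1..n}) : mseries n R := MSeries (fun m => (m == b)%:R).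

Lemma mcoef_mmon b m : mmon b m = (m == b)%:R. Proof. by []. Qed.

Lemma mcoefM_mmonD h b m : (h * mmon b) (m + b)%MM = h m.
Proof.
rewrite (@mcoefM_D1 _ _ m b) ?mcoef_mmon ?eqxx ?mulr1 // => a' b' Em ne.
rewrite mcoef_mmon; case: eqP => [Eb|_]; last by rewrite mulr0.
by case/eqP: ne; apply: (@addIm _ b); rewrite Em Eb.
Qed.

Lemma mcoefM_mmon h b m :
  (h * mmon b) m = if (b <= m)%MM then h (m - b)%MM else 0.
Proof.
case: ifPn => [le_b|nle]; first by rewrite -{1}(submK le_b) mcoefM_mmonD.
apply: mcoefM_eq0 => c d Em; rewrite mcoef_mmon.
case: eqP => [Ed|]; last by rewrite mulr0.
by case/negP: nle; rewrite Em Ed lem_addl.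
Qed.

Lemma mmonM b c : mmon b * mmon c = mmon (b + c)%MM.
Proof.
apply: mseriesP => m; rewrite mcoefM_mmon !mcoef_mmon; case: ifPn => [le_c|nle].
  by congr ((_ : bool)%:R); apply/eqP/eqP => [<-|->]; rewrite ?submK ?addmK.
case: eqP => // Em; case/negP: nle; rewrite Em; apply: lem_addl.
Qed.

Lemma mserX_mmon (i : 'I_n) k : mserX R i ^+ k = mmon (U_(i) *+ k)%MM.
Proof.
elim: k => [|k IHk]; first by rewrite expr0 mulm0n; apply: mseriesP.
by rewrite exprS IHk -[mserX R i]/(mmon U_(i)%MM) mmonM -mulmS.
Qed.

Lemma mserX0 (i : 'I_n) : mserX R i 0%MM = 0.
Proof. by rewrite mcoefX eq_sym mnm1_eq0. Qed.

Lemma mcoef_prodX (a m : 'X_{1..n}) :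
  (\prod_i mserX R i ^+ a i) m = (m == a)%:R.
Proof.
rewrite (eq_bigr _ (fun i _ => mserX_mmon i (a i))).
rewrite -(big_morph mmon (fun b c => esym (mmonM b c)) (erefl (mmon 0%MM))).
by rewrite -multinomUE_id.
Qed.

Definition eqdeg K f g := forall m, (mdeg m < K)%N -> f m = g m.

Lemma eqdeg_sym K f g : eqdeg K f g -> eqdeg K g f.
Proof. by move=> E m /E. Qed.
Lemma eqdeg_trans K g f h : eqdeg K f g -> eqdeg K g h -> eqdeg K f h.
Proof. by move=> E1 E2 m ltm; rewrite E1 ?E2. Qed.
Lemma eqdegD K f g f' g' :
  eqdeg K f f' -> eqdeg K g g' -> eqdeg K (f + g) (f' + g').
Proof. by move=> E1 E2 m ltm; rewrite !mcoefD E1 ?E2. Qed.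
Lemma eqdegM K f g f' g' :
  eqdeg K f f' -> eqdeg K g g' -> eqdeg K (f * g) (f' * g').
Proof.
move=> E1 E2 m ltm; rewrite !mcoefM; apply: eq_bigr => -[[a la] [b lb]] /= _.
by rewrite E1 ?E2 // (leq_trans _ ltm).
Qed.
Lemma eqdegX K k f f' : eqdeg K f f' -> eqdeg K (f ^+ k) (f' ^+ k).
Proof. by move=> E; elim: k => // k IHk; rewrite !exprS; apply: eqdegM. Qed.

Lemma eqdegP f g : (forall K, eqdeg K f g) -> f = g.
Proof. by move=> E; apply: mseriesP => m; apply: (E (mdeg m).+1). Qed.

Lemma mcoef_ordM f g p q m : eqdeg p f 0 -> eqdeg q g 0 ->
  (mdeg m < p + q)%N -> (f * g) m = 0.
Proof.
move=> f0 g0 lt_m; apply: mcoefM_eq0 => a b Em.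
have [lt_a|le_a] := ltnP (mdeg a) p; first by rewrite f0 // mul0r.
rewrite (g0 b) ?mulr0 //; move: lt_m; rewrite Em mdegD => lt_m.
by rewrite -(ltn_add2l p); apply: leq_ltn_trans lt_m; rewrite leq_add2r.
Qed.

End Series.

Lemma mcoef_map (n : nat) (R S : Type) (phi : R -> S) (f : mseries n R) m :
  mser_map phi f m = phi (f m).
Proof. by []. Qed.

Lemma mcoef_comp (n : nat) (R : comNzRingType) (c : nat -> R) (f : mseries n R)
  m :
  mser_comp c f m = \sum_(k < (mdeg m).+1) c k * (f ^+ k) m.
Proof. by []. Qed.

Lemma mcoef_fgl_subst n (R : comNzRingType) a (f g : mseries n R) m :
  fgl_subst a f g m = \sum_(i < (mdeg m).+1) \sum_(j < (mdeg m).+1)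
                        a i j * (f ^+ i * g ^+ j) m.
Proof. by []. Qed.

Section Substitution.
Variables (k n : nat) (R : comNzRingType) (f_ : 'I_k -> mseries n R).

(* Removing the constant terms of the [f_ i] makes substitution a total ring
   morphism. *)
Definition center (h : mseries n R) : mseries n R := h - mserC n (h 0%MM).
Let f i : mseries n R := center (f_ i).

Fact center0 (h : mseries n R) : center h 0%MM = 0.
Proof. by rewrite /center mcoefD mcoefN mcoefC eqxx mulr1n subrr. Qed.
Fact center_id (h : mseries n R) : h 0%MM = 0 -> center h = h.
Proof. by rewrite /center => ->; rewrite rmorph0 subr0. Qed.

Implicit Types (g h : mseries k R) (p : {mpoly R[k]}).

Definition pows (a : 'X_{1..k}) : mseries n R := \prod_i f i ^+ a i.

Lemma pows_ord a : eqdeg (mdeg a) (pows a) 0.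
Proof.
rewrite mdegE /pows; elim/big_ind2: _ => [|d1 f1 d2 f2 H1 H2 m lt_m|i _ m lt_m]
  //.
  by rewrite (mcoef_ordM H1 H2 lt_m).
by apply: mcoefX_small => //; apply: center0.
Qed.

Local Notation ev := (mmap (@mserC n R) f).

Lemma mmap_small K p : (forall a, (mdeg a < K)%N -> p@_a = 0) ->
  eqdeg K (ev p) 0.
Proof.
move=> p0 m lt_m; rewrite /mmap mcoef_sum mcoef0 big1 // => a _.
rewrite mcoefCM; have [/p0->|le_a] := ltnP (mdeg a) K; first by rewrite mul0r.
by rewrite [X in _ * X](@pows_ord a) ?mulr0 // (leq_trans lt_m).
Qed.

Lemma mmap_monom c a : ev (c *: 'X_[a]) = mserC n c * pows a.
Proof.
rewrite -mul_mpolyC [LHS]rmorphM.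
by congr (_ * _); [apply: mmapC | apply: mmapX].
Qed.

(* sum_a h_a f^a *)
Definition msubst (h : mseries k R) : mseries n R :=
  MSeries (fun m => ev (mser_trunc (mdeg m).+1 h) m).

Lemma mcoef_msubst h m : msubst h m = ev (mser_trunc (mdeg m).+1 h) m.
Proof. by []. Qed.

(** Below any given degree, substitution is evaluation of a polynomial; the ring morphism laws and
    the composition rule are transported from [mmap] through this. *)
Lemma eqdeg_msubst K h p :
  (forall a, (mdeg a < K)%N -> p@_a = h a) -> eqdeg K (msubst h) (ev p).
Proof.
move=> Ep m lt_m; rewrite mcoef_msubst; apply/eqP;
  rewrite -subr_eq0 -mcoefN -mcoefD; apply/eqP.
rewrite -rmorphB /= (@mmap_small (mdeg m).+1) // => a lt_a.
by rewrite mcoeffB mcoeff_trunc lt_a Ep ?subrr // (leq_trans _ lt_m).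
Qed.

Lemma eqdeg_msubst_trunc K h : eqdeg K (msubst h) (ev (mser_trunc K h)).
Proof. by apply: eqdeg_msubst => a lt_a; rewrite mcoeff_trunc lt_a. Qed.

Fact msubst_is_zmod : zmod_morphism msubst.
Proof.
move=> g h; apply: eqdegP => K; apply: eqdeg_trans.
  apply: (@eqdeg_msubst _ _ (mser_trunc K g - mser_trunc K h)) => a lt_a.
  by rewrite mcoeffB !mcoeff_trunc lt_a.
rewrite rmorphB; apply: eqdegD; first exact/eqdeg_sym/eqdeg_msubst_trunc.
by move=> m lt_m; rewrite !mcoefN (eqdeg_msubst_trunc _ lt_m).
Qed.
Fact msubst_is_monoid : monoid_morphism msubst.
Proof.
split=> [|g h]; apply: eqdegP => K.
  by rewrite -(rmorph1 ev); apply: eqdeg_msubst => a _; rewrite mcoeff1.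
apply: eqdeg_trans.
  apply: (@eqdeg_msubst _ _ (mser_trunc K g * mser_trunc K h)) => a lt_a.
  by rewrite -mser_mulE.
by rewrite rmorphM; apply/eqdegM; apply/eqdeg_sym/eqdeg_msubst_trunc.
Qed.
HB.instance Definition _ :=
  GRing.isZmodMorphism.Build (mseries k R) (mseries n R) msubst msubst_is_zmod.
HB.instance Definition _ :=
  GRing.isMonoidMorphism.Build (mseries k R) (mseries n R) msubst
    msubst_is_monoid.

Lemma msubstD g h : msubst (g + h) = msubst g + msubst h.
Proof. exact: rmorphD. Qed.

Lemma msubstM g h : msubst (g * h) = msubst g * msubst h.
Proof. exact: rmorphM. Qed.

Lemma msubst1B g : msubst (1 - g) = 1 - msubst g.
Proof. by rewrite rmorphB rmorph1. Qed.

Lemma msubstC c : msubst (mserC k c) = mserC n c.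
Proof.
apply: eqdegP => K; rewrite -(mmapC f (@mserC n R)); apply: eqdeg_msubst => a _.
by rewrite mcoeffC mcoefC mulr_natr eq_sym.
Qed.

Lemma msubstX i : f_ i 0%MM = 0 -> msubst (mserX R i) = f_ i.
Proof.
move=> fi0; rewrite -[RHS](center_id fi0) -/(f i).
apply: eqdegP => K; rewrite -[f i](mmap1U f) -(mmapX f (@mserC n R)).
by apply: eqdeg_msubst => a _; rewrite mcoeffX mcoefX eq_sym.
Qed.

Lemma msubst_eqdeg K g h : eqdeg K g h -> eqdeg K (msubst g) (msubst h).
Proof.
move=> E; apply: (eqdeg_trans (@eqdeg_msubst_trunc K g)).
apply/eqdeg_sym/eqdeg_msubst => a lt_a.
by rewrite mcoeff_trunc lt_a E.
Qed.

Lemma msubst_const h : msubst h 0%MM = h 0%MM.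
Proof.
have /msubst_eqdeg : eqdeg 1 h (mserC k (h 0%MM)).
  by move=> m; rewrite ltnS leqn0 mdeg_eq0 => /eqP ->; rewrite mcoefC eqxx.
by move=> /(_ 0%MM); rewrite mdeg0 msubstC mcoefC eqxx => ->.
Qed.
End Substitution.

Lemma msubst_mmap k n (R : comNzRingType) (f : 'I_k -> mseries n R)
    l (g : 'I_l -> mseries k R) p :
  msubst f (mmap (@mserC k R) g p) = mmap (@mserC n R) (fun i => msubst f (g
    i)) p.
Proof.
rewrite /mmap rmorph_sum /=; apply: eq_bigr => a _.
rewrite rmorphM /= msubstC rmorph_prod; congr (_ * _).
by apply: eq_bigr => i _; rewrite rmorphXn.
Qed.

(** When the [g i] have no constant term, neither have their images, so no centering interferes. *)
Lemma msubst_msubst k n (R : comNzRingType) (f : 'I_k -> mseries n R)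
    l (g : 'I_l -> mseries k R) h : (forall i, g i 0%MM = 0) ->
  msubst f (msubst g h) = msubst (fun i => msubst f (g i)) h.
Proof.
move=> g0; apply: eqdegP => K.
apply: (eqdeg_trans (msubst_eqdeg f (@eqdeg_msubst_trunc _ _ _ g K h))).
apply/eqdeg_sym/(eqdeg_trans (eqdeg_msubst_trunc _ h)).
rewrite msubst_mmap; set p := mser_trunc K h.
suff -> : (fun i => center (msubst f (g i))) = (fun i => msubst f (center (g
  i))) by [].
by apply/funext => i; rewrite !center_id // msubst_const.
Qed.

Lemma eq_msubst k n (R : comNzRingType) (f g : 'I_k -> mseries n R) h :
  f =1 g -> msubst f h = msubst g h.
Proof. by move=> E; congr (msubst _ h); apply/funext. Qed.

Lemma msubst_id n (R : comNzRingType) (h : mseries n R) :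
  msubst (fun i => mserX R i) h = h.
Proof.
apply: eqdegP => K; apply: (eqdeg_trans (eqdeg_msubst_trunc _ h)) => m lt_m.
have -> : (fun i => center (mserX R i)) = (fun i : 'I_n => mserX R i).
  by apply/funext => i; rewrite center_id // mserX0.
rewrite /mmap mcoef_sum.
have E a : mmap1 (fun i => mserX R i) a m = (m == a)%:R by exact: mcoef_prodX.
under eq_bigr do rewrite mcoefCM E.
rewrite -[RHS](_ : (mser_trunc K h)@_m = h m);
  last by rewrite mcoeff_trunc lt_m.
have [m_in|m_out] := boolP (m \in msupp (mser_trunc K h)).
  rewrite (bigD1_seq m) //= eqxx mulr1 big1 ?addr0 // => a.
  by rewrite eq_sym => /negPf ->; rewrite mulr0.
rewrite memN_msupp_eq0 // big_seq big1 // => a a_in.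
by case: eqP => [Ea|_]; [rewrite Ea a_in in m_out | rewrite mulr0].
Qed.

(** One-variable series are encoded over ['I_1], so that [mser_comp] becomes an instance of the ring
    morphism [msubst]; [biseries] does the same for [fgl_subst]. *)
Definition useries (R : comNzRingType) (c : nat -> R) : mseries 1 R :=
  MSeries (fun m => c (mdeg m)).

Lemma mnm_ord1 (a : 'X_{1..1}) : a = (U_(ord0) *+ mdeg a)%MM.
Proof.
apply/mnmP => i; rewrite ord1 mulmnE mnm1E eqxx mul1n.
by rewrite mdegE big_ord1.
Qed.

Lemma mnm_ord2 (m : 'X_{1..2}) : m = (U_(ord0) *+ m ord0 + U_(ord_max) *+ m
  ord_max)%MM.
Proof.
apply/mnmP => i; rewrite mnmDE !mulmnE !mnm1E.
by case: i => [[|[|//]] lti]; rewrite -!val_eqE /= ?mul1n ?mul0n ?addn0 ?add0n;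
  congr (m _); apply: val_inj.
Qed.

Lemma mser_compE n (R : comNzRingType) (c : nat -> R) (f : mseries n R) :
  f 0%MM = 0 -> mser_comp c f = msubst (fun=> f) (useries c).
Proof.
move=> f0; apply: mseriesP => m; have lt_m := ltnSn (mdeg m).
rewrite mcoef_comp; pose p : {mpoly R[1]} := \sum_(k < (mdeg m).+1) c k *:
  'X_[U_(ord0) *+ k].
rewrite (@eqdeg_msubst _ _ _ _ (mdeg m).+1 (useries c) p) //.
  rewrite rmorph_sum mcoef_sum /=; apply: eq_bigr => k _.
  rewrite mmap_monom mcoefCM /pows big_ord1 center_id //.
  by rewrite mulmnE mnm1E eqxx mul1n.
move=> a lt_a; rewrite raddf_sum /= (bigD1 (Ordinal lt_a)) //= mcoeffZ.
rewrite mcoeffX -mnm_ord1 eqxx mulr1 big1 ?addr0 // => k ne.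
rewrite mcoeffZ mcoeffX; case: eqP => [Ek|]; last by rewrite mulr0.
case/eqP: ne; apply: val_inj => /=.
by rewrite -Ek mdegMn mdeg1 mul1n.
Qed.

Lemma mser_comp0 n (R : comNzRingType) (c : nat -> R) (f : mseries n R) :
  mser_comp c f 0%MM = c 0%N.
Proof. by rewrite mcoef_comp mdeg0 big_ord1 expr0 mcoef1 eqxx mulr1. Qed.

Definition biseries (R : comNzRingType) (a : nat -> nat -> R) : mseries 2 R :=
  MSeries (fun m => a (m ord0) (m ord_max)).

Definition pair_fun T (x y : T) (i : 'I_2) := if i == ord0 then x else y.

Lemma fgl_substE n (R : comNzRingType) a (f g : mseries n R) :
    f 0%MM = 0 -> g 0%MM = 0 ->
  fgl_subst a f g = msubst (pair_fun f g) (biseries a).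
Proof.
move=> f0 g0; apply: mseriesP => m; have lt_m := ltnSn (mdeg m).
rewrite mcoef_fgl_subst.
pose mon i j : 'X_{1..2} := (U_(ord0) *+ i + U_(ord_max) *+ j)%MM.
have mon0 i j : mon i j ord0 = i.
  by rewrite mnmDE !mulmnE !mnm1E eqxx mul1n mul0n addn0.
have mon1 i j : mon i j ord_max = j.
  by rewrite mnmDE !mulmnE !mnm1E eqxx mul1n mul0n.
have ord2 (i : 'I_2) : i = ord0 \/ i = ord_max.
  by case: i => [[|[|//]] ?]; [left | right]; apply: val_inj.
pose p : {mpoly R[2]} := \sum_(i < (mdeg m).+1) \sum_(j < (mdeg m).+1)
  a i j *: 'X_[mon i j].
rewrite (@eqdeg_msubst _ _ _ _ (mdeg m).+1 (biseries a) p) //.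
  rewrite rmorph_sum mcoef_sum /=; apply: eq_bigr => i _.
  rewrite rmorph_sum mcoef_sum /=; apply: eq_bigr => j _.
  rewrite mmap_monom mcoefCM /pows big_ord_recr big_ord1 /=.
  rewrite (_ : widen_ord _ _ = ord0); last exact: val_inj.
  by rewrite mon0 mon1 !center_id.
have E b i j : ('X_[mon i j] : {mpoly R[2]})@_b =
    ((b ord0 == i) && (b ord_max == j))%:R.
  rewrite mcoeffX; congr ((_ : bool)%:R).
  apply/eqP/andP => [<-|[/eqP <- /eqP <-]]; first by rewrite mon0 mon1.
  by apply/mnmP => k; case: (ord2 k) => ->; rewrite (mon0, mon1).
have deg2 (b : 'X_{1..2}) : mdeg b = (b ord0 + b ord_max)%N.
  by rewrite mdegE big_ord_recr big_ord1 /=; congr (b _ + _)%N; apply: val_inj.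
move=> b; rewrite deg2 => lt_b; rewrite raddf_sum /=.
have lt0 : (b ord0 < (mdeg m).+1)%N by apply: leq_ltn_trans lt_b;
  apply: leq_addr.
have lt1 : (b ord_max < (mdeg m).+1)%N.
  by apply: leq_ltn_trans lt_b; apply: leq_addl.
rewrite (bigD1 (Ordinal lt0)) //= raddf_sum (bigD1 (Ordinal lt1)) //=.
rewrite mcoeffZ E !eqxx mulr1 big1 => [|j ne]; last first.
  by rewrite mcoeffZ E eqxx -[_ == j :> nat]/(Ordinal lt1 == j) eq_sym (negPf
    ne) mulr0.
rewrite addr0 big1 ?addr0 // => i ne; rewrite raddf_sum big1 //= => j _.
by rewrite mcoeffZ E -[_ == i :> nat]/(Ordinal lt0 == i) eq_sym (negPf ne)
  mulr0.
Qed.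

Lemma fgl_subst0 n (R : comNzRingType) a (f g : mseries n R) :
  fgl_subst a f g 0%MM = a 0%N 0%N.
Proof. by rewrite mcoef_fgl_subst mdeg0 !big_ord1 !expr0 mulr1 mcoef1 eqxx
  mulr1. Qed.

Section Monomials.
Variables (n : nat) (R : comNzRingType).
Implicit Types (f g h : mseries n R) (m : 'X_{1..n}).

Lemma fgl_substC (F : fgl R) f g : fgl_subst F f g = fgl_subst F g f.
Proof.
apply: mseriesP => m; rewrite !mcoef_fgl_subst exchange_big.
by apply: eq_bigr => i _; apply: eq_bigr => j _;
  rewrite fgl_comm mulrC [in RHS]mulrC (mulrC (f ^+ _)).
Qed.

(** In f^(k+2) - g^(k+2) = (f - g) f^(k+1) + g (f^(k+1) - g^(k+1)) every further factor f or g gains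
    one degree. *)
Lemma eqdegX_shift K f g k : f 0%MM = 0 -> g 0%MM = 0 -> eqdeg K f g ->
  eqdeg (K + k) (f ^+ k.+1) (g ^+ k.+1).
Proof.
move=> f0 g0 E.
have ordX h p : h 0%MM = 0 -> eqdeg p (h ^+ p) 0.
  by move=> h0 m; apply: mcoefX_small.
elim: k => [|k IHk]; first by rewrite addn0 !expr1.
move=> m lt_m; apply/eqP; rewrite -subr_eq0 -mcoefN -mcoefD.
have -> : f ^+ k.+2 - g ^+ k.+2 = (f - g) * f ^+ k.+1 + g * (f ^+ k.+1 - g ^+
  k.+1).
  by rewrite mulrBl mulrBr [f ^+ k.+2]exprS [g ^+ k.+2]exprS addrA subrK.
rewrite mcoefD (@mcoef_ordM _ _ _ _ K k.+1) //; last exact: ordX.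
  rewrite add0r (@mcoef_ordM _ _ _ _ 1 (K + k)) //.
  - by rewrite -{1}(expr1 g); apply: ordX.
  - by move=> d lt_d; rewrite mcoefD mcoefN IHk // subrr.
  - by rewrite add1n -addnS.
by move=> d lt_d; rewrite mcoefD mcoefN E // subrr.
Qed.

Lemma eqdegX_lead f g p : f 0%MM = 0 -> eqdeg 2 f g ->
  eqdeg p.+1 (f ^+ p) (g ^+ p).
Proof.
move=> f0 E; have g0 : g 0%MM = 0 by rewrite -E // mdeg0.
by case: p => // p; rewrite -add2n; apply: eqdegX_shift.
Qed.

Variables a b : 'I_n.
Hypothesis ab : a != b.
Local Notation mon p q := (U_(a) *+ p + U_(b) *+ q)%MM.

Lemma mon2_l p q : mon p q a = p.
Proof. by rewrite mnmDE !mulmnE !mnm1E eqxx eq_sym (negPf ab) mul1n mul0n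
  addn0. Qed.
Lemma mon2_r p q : mon p q b = q.
Proof. by rewrite mnmDE !mulmnE !mnm1E eqxx (negPf ab) mul1n mul0n. Qed.
Lemma mdeg_mon2 p q : mdeg (mon p q) = (p + q)%N.
Proof. by rewrite mdegD !mdegMn !mdeg1 !mul1n. Qed.

(** In degree p + q only the linear part of f contributes to f^(p+q). *)
Lemma mcoefX_binom f p q : f 0%MM = 0 -> eqdeg 2 f (mserX R a + mserX R b) ->
  (f ^+ (p + q)) (mon p q) = 'C(p + q, p)%:R.
Proof.
move=> f0 E2; rewrite (@eqdegX_lead _ _ (p + q) f0 E2);
  last by rewrite mdeg_mon2.
rewrite addrC exprDn mcoef_sum.
have lt_p : (p < (p + q).+1)%N by rewrite ltnS leq_addr.
rewrite (bigD1 (Ordinal lt_p)) //= big1 ?addr0 => [|i ne].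
  by rewrite mcoefMn !mserX_mmon mmonM [(U_(b) *+ _ + _)%MM]addmC addKn
    mcoef_mmon eqxx.
rewrite mcoefMn !mserX_mmon mmonM [(U_(b) *+ _ + _)%MM]addmC mcoef_mmon.
case: eqP => [Em|_]; last by rewrite mul0rn.
case/eqP: ne; apply: val_inj => /=.
have := congr1 (fun m : 'X_{1..n} => m a) Em.
by rewrite !mon2_l.
Qed.

End Monomials.

(** * The Lazard ring *)

Section BaseChange.
Variables (n : nat) (R S : comNzRingType) (phi : {rmorphism R -> S}).
Implicit Types (f g : mseries n R).

Fact mser_map_is_zmod : zmod_morphism (@mser_map n R S phi).
Proof. by move=> f g; apply: mseriesP => m;
  rewrite mcoef_map mcoefD mcoefN rmorphB. Qed.
Fact mser_map_is_monoid : monoid_morphism (@mser_map n R S phi).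
Proof.
split=> [|f g]; apply: mseriesP => m;
  first by rewrite mcoef_map !mcoef1 rmorph_nat.
rewrite [RHS]mcoefM mcoef_map mcoefM rmorph_sum; apply: eq_bigr => k _.
by rewrite rmorphM.
Qed.
HB.instance Definition _ := GRing.isZmodMorphism.Build _ _
  (@mser_map n R S phi) mser_map_is_zmod.
HB.instance Definition _ := GRing.isMonoidMorphism.Build _ _
  (@mser_map n R S phi) mser_map_is_monoid.

Lemma mser_mapX i : mser_map phi (mserX R i) = mserX S i :> mseries n S.
Proof. by apply: mseriesP => m; rewrite mcoef_map !mcoefX rmorph_nat. Qed.

Lemma mser_map_fgl a f g :
  mser_map phi (fgl_subst a f g) =
  fgl_subst (fun i j => phi (a i j)) (mser_map phi f) (mser_map phi g).
Proof.
apply: mseriesP => m; rewrite mcoef_fgl_subst mcoef_map mcoef_fgl_subst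
  rmorph_sum.
apply: eq_bigr => i _; rewrite rmorph_sum; apply: eq_bigr => j _.
have -> : mser_map phi f ^+ i * mser_map phi g ^+ j =
    mser_map phi (f ^+ i * g ^+ j) by rewrite rmorphM !rmorphXn.
by rewrite rmorphM.
Qed.
End BaseChange.

(** * Generation of the Lazard ring by the coefficients of its law *)

Section Generated.
Variables (L : comNzRingType) (F : fgl L).
Hypothesis hL : is_lazard F.
Variable S : {pred L}.
Hypothesis S_closed : GRing.subring_closed S.
Hypothesis S_F : forall i j, F i j \in S.

HB.instance Definition _ := GRing.isSubringClosed.Build L S S_closed.
Record subS := SubS { valS : L; valSP : valS \in S }.
HB.instance Definition _ := [isSub for valS].
HB.instance Definition _ := [Choice of subS by <:].
HB.instance Definition _ := [SubChoice_isSubComNzRing of subS by <:].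

Let FS i j : subS := SubS (S_F i j).

Lemma subS_assoc :
    let x i : mseries 3 subS := mserX subS (inord i) in
    let add := fgl_subst FS in
    add 3%N (add 3%N (x 0%N) (x 1%N)) (x 2%N) =
    add 3%N (x 0%N) (add 3%N (x 1%N) (x 2%N)).
Proof.
move=> x add; pose v : {rmorphism subS -> L} := val.
have inj_v : injective (@mser_map 3 subS L v).
  move=> f g E; apply: mseriesP => m.
  by apply: val_inj; apply: (congr1 (fun h => mscoef h m) E).
apply: inj_v; rewrite /add !mser_map_fgl /x !mser_mapX; exact: (fgl_assoc F).
Qed.

(** The law restricts to the subring S, so universality gives a morphism from L to S. Composed with
    the inclusion it fixes every [F i j], hence is the identity by uniqueness. *)
Lemma fgl_in_subring z : z \in S.
Proof.
have h0 i : FS i 0%N = (i == 1%N)%:R.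
  by apply: val_inj; rewrite rmorph_nat /= fgl_u0.
have h1 j : FS 0%N j = (j == 1%N)%:R.
  by apply: val_inj; rewrite rmorph_nat /= fgl_0v.
have h2 i j : FS i j = FS j i by apply: val_inj; rewrite /= fgl_comm.
have [phi phiF _] := hL (FGL h0 h1 h2 subS_assoc).
pose v : {rmorphism subS -> L} := val.
have [psi _ uni] := hL F.
have -> : z = v (phi z); last exact: valSP.
rewrite -[LHS]/(idfun z) (uni idfun) // -(uni (v \o phi)) //= => i j.
by rewrite phiF.
Qed.
End Generated.

Section CoefIn.
Variables (R : comNzRingType) (S : {pred R}).
Hypothesis S_closed : GRing.subring_closed S.

HB.instance Definition _ := GRing.isSubringClosed.Build R S S_closed.

Lemma mcoef_inX n K (f : mseries n R) p :
  (forall m, (mdeg m < K)%N -> f m \in S) ->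
  forall m, (mdeg m < K)%N -> (f ^+ p) m \in S.
Proof.
move=> fS; elim: p => [|p IHp] m lt_m; first by rewrite expr0 mcoef1 rpred_nat.
rewrite exprS mcoefM rpred_sum // => -[[a la] [b lb]] /= _.
by rewrite rpredM ?fS ?IHp // (leq_trans _ lt_m).
Qed.

Variables (F : fgl R) (N : nat).
Hypothesis S_F : forall i j, (i + j < N)%N -> F i j \in S.

Variables (n : nat) (a b c : 'I_n).
Hypotheses (ab : a != b) (ac : a != c) (bc : b != c).

Implicit Types m : 'X_{1..n}.
Local Notation A := (fgl_subst F (mserX R a) (mserX R b)).

Let A0 : A 0%MM = 0.
Proof. by rewrite fgl_subst0 fgl_u0. Qed.

Let AE m : A m = \sum_(p < (mdeg m).+1) \sum_(q < (mdeg m).+1)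
   F p q * (m == U_(a) *+ p + U_(b) *+ q)%MM%:R.
Proof.
rewrite mcoef_fgl_subst; apply: eq_bigr => p _; apply: eq_bigr => q _.
by rewrite !mserX_mmon mmonM.
Qed.

Let mon_c p q : (U_(a) *+ p + U_(b) *+ q)%MM c = 0%N.
Proof. by rewrite mnmDE !mulmnE !mnm1E (negPf ac) (negPf bc) !mul0n. Qed.
Let A_c m : (m c != 0)%N -> A m = 0.
Proof.
move=> mc; rewrite AE big1 // => p _; rewrite big1 // => q _.
by case: eqP => [Em|_]; [rewrite Em mon_c in mc | rewrite mulr0].
Qed.

Let AX_c p m : (m c != 0)%N -> (A ^+ p) m = 0.
Proof.
elim: p m => [|p IHp] m mc.
  by rewrite expr0 mcoef1; have [m0|//] := eqVneq m 0%MM;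
    rewrite m0 mnm0E in mc.
rewrite exprS; apply: mcoefM_eq0 => d e Em.
have [dc|dc] := eqVneq (d c) 0%N; last by rewrite A_c // mul0r.
by rewrite IHp ?mulr0 //; rewrite Em mnmDE dc in mc.
Qed.

Let A_in m : (mdeg m < N)%N -> A m \in S.
Proof.
move=> lt_m; rewrite AE rpred_sum // => p _; rewrite rpred_sum // => q _.
case: eqP => [Em|_]; last by rewrite mulr0 rpred0.
by rewrite mulr1 S_F // -(mdeg_mon2 a b) -Em.
Qed.

Let A_lead p q : (A ^+ (p + q)) (U_(a) *+ p + U_(b) *+ q)%MM = 'C(p + q, p)%:R.
Proof.
have E2 : eqdeg 2 A (mserX R a + mserX R b).
  move=> m; rewrite mcoefD AE !ltnS leq_eqVlt => /orP[/eqP m1|]; last first.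
    rewrite ltnS leqn0 mdeg_eq0 => /eqP->.
    by rewrite mdeg0 !big_ord1 fgl_u0 mul0r !mserX0 addr0.
  rewrite m1 !big_ord_recr !big_ord0 /= !add0r !mulm0n !mulm1n !addm0 !add0m.
  rewrite ?fgl_u0 ?fgl_0v !mul1r mul0r add0r.
  case: (_ =P (U_(a) + U_(b))%MM) => [Em|_]; last by rewrite mulr0 addr0 addrC.
  by move: m1; rewrite Em mdegD !mdeg1.
exact: (mcoefX_binom ab p q A0 E2).
Qed.

(** The coefficient is a sum over p of [F p k] times a coefficient of A^p in degree i + j. For p < i
    + j only coefficients of F of total index below N occur, for p > i + j the power A^p starts too
    late, and p = i + j leaves the binomial. Positivity of k gives i + j < N. *)
Lemma fgl_subst_lead i j k : (i + j + k = N)%N -> (0 < k)%N ->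
  fgl_subst F A (mserX R c) (U_(a) *+ i + U_(b) *+ j + U_(c) *+ k)%MM
    - 'C(i + j, i)%:R * F (i + j)%N k \in S.
Proof.
move=> EN k_gt0; set m := (_ + U_(c) *+ k)%MM.
have dm : mdeg m = N by rewrite mdegD mdeg_mon2 mdegMn mdeg1 mul1n.
have mc : m c = k by rewrite mnmDE mon_c mulmnE mnm1E eqxx mul1n.
have E p q : (A ^+ p * mserX R c ^+ q) m =
    if q == k then (A ^+ p) (U_(a) *+ i + U_(b) *+ j)%MM else 0.
  rewrite mserX_mmon; case: eqP => [->|/eqP ne]; first by rewrite mcoefM_mmonD.
  rewrite mcoefM_mmon; case: ifP => // le_q; apply: AX_c.
  move/mnm_lepP/(_ c): le_q; rewrite mnmBE mulmnE mnm1E eqxx mul1n mc.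
  by move: ne; lia.
have lt_k : (k < (mdeg m).+1)%N by rewrite dm; lia.
have lt_ij : (i + j < (mdeg m).+1)%N by rewrite dm; lia.
rewrite mcoef_fgl_subst exchange_big (bigD1 (Ordinal lt_k)) //=.
rewrite [X in _ + X - _]big1 ?addr0 => [|q ne]; last first.
  by rewrite big1 // => p _; rewrite E -[_ == k]/(q == Ordinal lt_k) (negPf ne)
    mulr0.
rewrite (bigD1 (Ordinal lt_ij)) //= E eqxx A_lead.
rewrite [X in X + _ - _]mulrC [X in X - _]addrC addrK rpred_sum // => p ne.
rewrite E eqxx; have [lt_p|ge_p] := ltnP p (i + j).
  apply: rpredM; first by apply: S_F; lia.
  by apply: (mcoef_inX p A_in); rewrite mdeg_mon2; lia.
have ne' : (p : nat) != (i + j)%N by [].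
by rewrite mcoefX_small ?mulr0 ?rpred0 ?mdeg_mon2 //; lia.
Qed.
End CoefIn.

(** Associativity in degree N, read modulo S. Commutativity turns F(x, F(y, z)) into F(F(y, z), x),
    so that [fgl_subst_lead] covers both sides, with the variables rotated. *)
Lemma fgl_cocycle (R : comNzRingType) (F : fgl R) (S : {pred R}) N i j k :
    GRing.subring_closed S ->
    (forall i j, (i + j < N)%N -> F i j \in S) ->
    (i + j + k = N)%N -> (0 < i)%N -> (0 < k)%N ->
  'C(i + j, i)%:R * F (i + j)%N k - 'C(j + k, j)%:R * F i (j + k)%N \in S.
Proof.
move=> S_closed S_F EN i_gt0 k_gt0.
pose x t : 'I_3 := inord t.
have x01 : x 0%N != x 1%N by rewrite -val_eqE /= !inordK.
have x02 : x 0%N != x 2%N by rewrite -val_eqE /= !inordK.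
have x12 : x 1%N != x 2%N by rewrite -val_eqE /= !inordK.
have x10 : x 1%N != x 0%N by rewrite eq_sym.
have x20 : x 2%N != x 0%N by rewrite eq_sym.
have EN' : (j + k + i = N)%N by rewrite -EN; lia.
have H1 := fgl_subst_lead S_closed S_F x01 x02 x12 EN k_gt0.
have H2 := fgl_subst_lead S_closed S_F x12 x10 x20 EN' i_gt0.
have /(congr1 (fun f => mscoef f (U_(x 0%N) *+ i + U_(x 1%N) *+ j + U_(x 2%N)
  *+ k)%MM))
  := fgl_assoc F.
rewrite -/(x 0%N) -/(x 1%N) -/(x 2%N) [X in _ = mscoef X _]fgl_substC => E.
rewrite [F i _]fgl_comm.
rewrite (_ : _ - _ = (fgl_subst F (fgl_subst F (mserX R (x 1%N)) (mserX R (x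
  2%N)))
 (mserX R (x 0%N)) (U_(x 1%N) *+ j + U_(x 2%N) *+ k + U_(x 0%N) *+ i)%MM
    - 'C(j + k, j)%:R * F (j + k)%N i) - 
  (fgl_subst F (fgl_subst F (mserX R (x 0%N)) (mserX R (x 1%N)))
 (mserX R (x 2%N)) (U_(x 0%N) *+ i + U_(x 1%N) *+ j + U_(x 2%N) *+ k)%MM
    - 'C(i + j, i)%:R * F (i + j)%N k)).
  by case: S_closed => _ SB _; apply: SB.
rewrite E (_ : (U_(x 1%N) *+ j + U_(x 2%N) *+ k + U_(x 0%N) *+ i)%MM =
  (U_(x 0%N) *+ i + U_(x 1%N) *+ j + U_(x 2%N) *+ k)%MM);
    last by rewrite addmC addmA.
by rewrite opprB [RHS]addrC addrA subrK.
Qed.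

Lemma rmorph_mmap n (R A B : comNzRingType) (psi : {rmorphism A -> B})
    (f : R -> A) (h : 'I_n -> A) (p : {mpoly R[n]}) :
  psi (mmap f h p) = mmap (fun a => psi (f a)) (fun i => psi (h i)) p.
Proof.
rewrite /mmap rmorph_sum; apply: eq_bigr => m _; rewrite rmorphM rmorph_prod.
by congr (_ * _); apply: eq_bigr => i _; rewrite rmorphXn.
Qed.

(** * Generators of the Lazard ring locally at a prime *)

Section LocalGeneration.
Variables (L : comNzRingType) (F : fgl L) (p : nat).
Hypotheses (hL : is_lazard F) (p_pr : prime p).

(** The shift starts the numbering at the least total index i + j = 2 where a coefficient is not
    fixed by [fgl_u0] and [fgl_0v]. *)
Definition lazard_x n : L := F (lazard_gen p n.+2) (n.+2 - lazard_gen p n.+2)%N.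

Definition lazard_poly N : {rmorphism {mpoly int[N]} -> L} :=
  mmap intr (fun i : 'I_N => lazard_x i).

Lemma lazard_polyE N f : lazard_poly N f = mmap intr (fun i => lazard_x i) f.
Proof. by []. Qed.

Lemma lazard_poly_widen N M (f : {mpoly int[N]}) : (N <= M)%N ->
  exists g : {mpoly int[M]}, lazard_poly M g = lazard_poly N f.
Proof.
move=> le_NM; exists (mmap (@mpolyC M _) (fun i => 'X_(widen_ord le_NM i)) f).
rewrite !lazard_polyE rmorph_mmap.
congr (mmap _ _ f); apply/funext => i; first exact: mmapC.
by rewrite /= mmapX mmap1U.
Qed.

(** The elements whose image in the localization at p is a p-local polynomial in the generators,
    phrased with an explicit multiplier s. *)
Definition lazard_local : {pred L} := fun z =>
  `[< exists N (f : {mpoly int[N]}) (s : nat),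
      coprime p s /\ z *+ s = lazard_poly N f >].

Lemma lazard_localP N (f : {mpoly int[N]}) z s :
  coprime p s -> z *+ s = lazard_poly N f -> z \in lazard_local.
Proof. by move=> cop E; apply/asboolP; exists N, f, s. Qed.

Lemma lazard_local_closed : GRing.subring_closed lazard_local.
Proof.
split=> [|y z|y z].
- by apply: (@lazard_localP 0 1 _ 1); rewrite ?coprimen1 // mulr1n rmorph1.
- move=> /asboolP[N [f [s [cs Ef]]]] /asboolP[M [g [t [ct Eg]]]].
  have [f' Ef'] := lazard_poly_widen f (leq_maxl N M).
  have [g' Eg'] := lazard_poly_widen g (leq_maxr N M).
  apply: (@lazard_localP _ (f' *+ t - g' *+ s) _ (s * t)).
    by rewrite coprimeMr cs.
  rewrite rmorphB !rmorphMn Ef' Eg' -Ef -Eg.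
  by rewrite mulrnBl -!mulrnA [(t * s)%N]mulnC.
- move=> /asboolP[N [f [s [cs Ef]]]] /asboolP[M [g [t [ct Eg]]]].
  have [f' Ef'] := lazard_poly_widen f (leq_maxl N M).
  have [g' Eg'] := lazard_poly_widen g (leq_maxr N M).
  apply: (@lazard_localP _ (f' * g') _ (s * t)).
    by rewrite coprimeMr cs.
  rewrite rmorphM Ef' Eg' -Ef -Eg.
  by rewrite mulrnAr mulrnAl mulrnA.
Qed.

Lemma lazard_local_sat z s : coprime p s -> z *+ s \in lazard_local ->
  z \in lazard_local.
Proof.
move=> cs /asboolP[N [f [t [ct E]]]].
by apply: (@lazard_localP N f _ (s * t)); rewrite ?coprimeMr ?cs // mulrnA.
Qed.

(** Strong induction on i + j. The cocycle relation puts a binomial multiple of the wanted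
    coefficient into the subring, and [lazard_local_sat] divides by this binomial when it is prime
    to p. *)
Lemma lazard_local_F i j : F i j \in lazard_local.
Proof.
have [S1 SB SM] := lazard_local_closed.
have S0 : 0 \in lazard_local by rewrite -(subrr 1) SB.
have SD x y : x \in lazard_local -> y \in lazard_local -> x + y \in
  lazard_local.
  by move=> Sx Sy; rewrite -[y]opprK SB // -[- y]add0r SB.
have Sb (b : bool) : b%:R \in lazard_local by case: b.
have Snat n x : x \in lazard_local -> n%:R * x \in lazard_local.
  move=> Sx; rewrite mulr_natl.
  by elim: n => [|n IHn]; rewrite ?mulr0n // mulrS SD.
have [n] := ubnP (i + j)%N; elim: n i j => // n IHn i j lt_n.
have S_F i' j' : (i' + j' < i + j)%N -> F i' j' \in lazard_local.
  by move=> lt'; apply: IHn; apply: leq_trans lt' _.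
have [->|i_gt0] := posnP i; first by rewrite fgl_0v.
have [->|j_gt0] := posnP j; first by rewrite fgl_u0.
have N_gt1 : (1 < i + j)%N by lia.
set N := (i + j)%N in S_F N_gt1.
suff: forall l, (0 < l < N)%N -> F l (N - l)%N \in lazard_local.
  by move=> /(_ i); rewrite {1 2}/N addKn; apply; lia.
apply: (@lazard_gen_generates p N (fun l => F l (N - l)%N \in lazard_local)) =>
  //.
- by move=> l lt_l; rewrite fgl_comm subKn //; lia.
- move=> i' l /andP[i'_gt0 lt_i'] lt_l ndvd SF.
  have EN : (i' + (l - i') + (N - l) = N)%N by lia.
  have lt_Nl : (0 < N - l)%N by lia.
  have := fgl_cocycle lazard_local_closed S_F EN i'_gt0 lt_Nl.
  rewrite subnKC; last by lia.
  rewrite (_ : l - i' + (N - l) = N - i')%N; last by lia.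
  move=> /SD/(_ (Snat 'C(N - i', l - i') _ SF)); rewrite subrK mulr_natl.
  by apply: lazard_local_sat; rewrite prime_coprime.
- case: N N_gt1 {S_F} => [|[|N]] // _.
  apply: (@lazard_localP N.+1 'X_ord_max _ 1); first exact: coprimen1.
  by rewrite lazard_polyE mmapX mmap1U mulr1n.
Qed.

Lemma lazard_localT (z : L) : exists N (f : {mpoly int[N]}) (s : nat),
  coprime p s /\ z *+ s = lazard_poly N f.
Proof.
apply/asboolP; exact: (fgl_in_subring hL lazard_local_closed lazard_local_F).
Qed.
End LocalGeneration.

Lemma strong_rec T (x0 : T) (Phi : nat -> (nat -> T) -> T) :
  exists l : nat -> T, forall n, l n = Phi n (fun k => if (k < n)%N then l k
    else x0).
Proof.
pose fix pre n := if n is n'.+1 then rcons (pre n') (Phi n' (nth x0 (pre n')))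
  else [::].
have sz n : size (pre n) = n by elim: n => //= n IHn; rewrite size_rcons IHn.
pose l n := Phi n (nth x0 (pre n)).
have nthE n k : (k < n)%N -> nth x0 (pre n) k = l k.
  elim: n => // n IHn; rewrite ltnS leq_eqVlt => /predU1P[->|lt_k] /=.
    by rewrite nth_rcons sz ltnn eqxx.
  by rewrite nth_rcons sz lt_k IHn.
exists l => n; rewrite {1}/l; congr Phi; apply/funext => k.
by case: ltnP => [/nthE //|le_k]; rewrite nth_default ?sz.
Qed.

Section MonomialCoef.
Variables (n : nat) (R : comNzRingType) (a b : 'I_n) (c : nat -> nat -> R).
Hypothesis ab : a != b.

Lemma mcoef_fgl_substX i j :
  fgl_subst c (mserX R a) (mserX R b) (U_(a) *+ i + U_(b) *+ j)%MM = c i j.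
Proof.
set m := (_ + _)%MM; have dm : mdeg m = (i + j)%N by rewrite mdeg_mon2.
have E p q : (mserX R a ^+ p * mserX R b ^+ q) m = ((p == i) && (q == j))%:R.
  rewrite !mserX_mmon mmonM mcoef_mmon; congr ((_ : bool)%:R).
  apply/eqP/andP => [Em|[/eqP-> /eqP->] //].
  have := congr1 (fun m : 'X_{1..n} => m a) Em; rewrite !mon2_l // => ->.
  by have := congr1 (fun m : 'X_{1..n} => m b) Em; rewrite !mon2_r // => ->.
have lt_i : (i < (mdeg m).+1)%N by rewrite dm ltnS leq_addr.
have lt_j : (j < (mdeg m).+1)%N by rewrite dm ltnS leq_addl.
rewrite mcoef_fgl_subst (bigD1 (Ordinal lt_i)) //= [X in _ + X]big1 => [|p ne].
  rewrite addr0 (bigD1 (Ordinal lt_j)) //= E !eqxx mulr1 big1 ?addr0 // => q ne.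
  by rewrite E -[X in _ && X]/(q == Ordinal lt_j) (negPf ne) andbF mulr0.
by rewrite big1 // => q _; rewrite E -[_ == i]/(p == Ordinal lt_i) (negPf ne)
  mulr0.
Qed.
End MonomialCoef.

(** * Formal group laws given by a logarithm *)

Section ExpLog.
Variable R : comNzRingType.
Implicit Types (e l : nat -> R).

Definition unipotent e := e 0%N = 0 /\ e 1%N = 1.

Local Notation t := (mserX R (ord0 : 'I_1)).
Local Notation mon k := (U_(ord0 : 'I_1) *+ k)%MM.

(** The equation l(e(t)) = t in degree n, solved for l_n: for unipotent e the coefficient of t^n in
    e^n is 1. *)
Definition is_log e l := forall n, l n = (n == 1%N)%:R -
  \sum_(k < n) l k * (useries e ^+ k) (mon n).

Lemma log_exists e : exists l, is_log e l.
Proof.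
have [l lE] := strong_rec 0 (fun n l => (n == 1%N)%:R -
  \sum_(k < n) l k * (useries e ^+ k) (mon n)).
by exists l => n; rewrite lE; congr (_ - _); apply: eq_bigr => k _;
  rewrite ltn_ord.
Qed.

Lemma useriesE e k : useries e (mon k) = e k.
Proof. by rewrite /useries /= /mscoef mdegMn mdeg1 mul1n. Qed.

Lemma useries_const e : useries e 0%MM = e 0%N.
Proof. by rewrite -(useriesE e) mulm0n. Qed.

Lemma useries_lead e k : unipotent e -> (useries e ^+ k) (mon k) = 1.
Proof.
move=> [e0 e1]; rewrite (@eqdegX_lead _ _ _ t k) ?useries_const //.
- by rewrite mserX_mmon mcoef_mmon eqxx.
- move=> m; rewrite [m]mnm_ord1; move: (mdeg m) => d;
  rewrite mdegMn mdeg1 mul1n.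
  rewrite useriesE mcoefX; case: d => [|[|//]] _.
    by rewrite e0 mulm0n eq_sym mnm1_eq0.
  by rewrite e1 mulm1n eqxx.
- by rewrite mdegMn mdeg1 mul1n.
Qed.

Lemma log_unipotent e l : is_log e l -> unipotent l.
Proof.
move=> lE; have l0 : l 0%N = 0 by rewrite lE big_ord0 subr0.
by split=> //; rewrite lE big_ord1 l0 mul0r subr0.
Qed.

Lemma log_exp e l : unipotent e -> is_log e l ->
  msubst (fun=> useries e) (useries l) = t.
Proof.
move=> uni lE; have [e0 _] := uni.
rewrite -mser_compE ?useries_const //; apply: mseriesP => m.
rewrite [m]mnm_ord1; move: (mdeg m) => d.
rewrite mcoef_comp mdegMn mdeg1 mul1n big_ord_recr /= useries_lead // mulr1.
rewrite lE addrC subrK mcoefX; congr ((_ : bool)%:R).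
apply/eqP/eqP => [->|/(congr1 mdeg)]; first by rewrite mulm1n.
by rewrite mdegMn mdeg1 mul1n.
Qed.

(** A left inverse is two-sided: l is unipotent too and has its own left inverse l', and e =
    l'(l(e)) = l'. *)
Lemma exp_log e l : unipotent e -> is_log e l ->
  msubst (fun=> useries l) (useries e) = t.
Proof.
move=> uni lE; have unil := log_unipotent lE.
have [l' l'E] := log_exists l.
have idl := log_exp uni lE; have idl' := log_exp unil l'E.
suff -> : useries e = useries l' by [].
have X0 : t 0%MM = 0 by rewrite mserX0.
have {1}-> : useries e = msubst (fun=> useries e) t.
  by rewrite msubstX // useries_const; case: uni.
rewrite -idl' msubst_msubst => [|_]; last by rewrite useries_const; case: unil.
rewrite (eq_msubst (g := fun i => mserX R i)) ?msubst_id // => i.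
by rewrite idl; congr (mserX _ _); rewrite [i]ord1; apply: val_inj.
Qed.
End ExpLog.

Section ExpLaw.
Variables (R : comNzRingType) (e l : nat -> R).
Hypotheses (uni : unipotent e) (lE : is_log e l).

Let l0 : l 0%N = 0. Proof. by case: (log_unipotent lE). Qed.
Let e0 : e 0%N = 0. Proof. by case: uni. Qed.

Definition log_sum n (f g : mseries n R) :=
  msubst (fun=> f) (useries l) + msubst (fun=> g) (useries l).
Local Notation x2 := (mserX R (ord0 : 'I_2)).
Local Notation y2 := (mserX R (ord_max : 'I_2)).
Local Notation mon2 i j := (U_(ord0 : 'I_2) *+ i + U_(ord_max : 'I_2) *+ j)%MM.

Definition exp_law_coef i j : R :=
  msubst (fun=> log_sum x2 y2) (useries e) (mon2 i j).

Let logf0 n (f : mseries n R) : msubst (fun=> f) (useries l) 0%MM = 0.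
Proof. by rewrite msubst_const useries_const. Qed.

Lemma log_sum0 n (f g : mseries n R) : log_sum f g 0%MM = 0.
Proof. by rewrite mcoefD (logf0 f) (logf0 g) addr0. Qed.

Lemma exp_lawE n (f g : mseries n R) : f 0%MM = 0 -> g 0%MM = 0 ->
  fgl_subst exp_law_coef f g = msubst (fun=> log_sum f g) (useries e).
Proof.
move=> f0 g0; rewrite fgl_substE //.
have -> : biseries exp_law_coef = msubst (fun=> log_sum x2 y2) (useries e).
  by apply: mseriesP => m; rewrite {2}[m]mnm_ord2.
rewrite msubst_msubst => [|i]; last exact: log_sum0.
apply: eq_msubst => i; rewrite msubstD.
rewrite (msubst_msubst _ _ (fun=> mserX0 _ _)) (msubst_msubst _ _ (fun=> mserX0
  _ _)).
have Ex : msubst (pair_fun f g) x2 = f by rewrite msubstX.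
have Ey : msubst (pair_fun f g) y2 = g by rewrite msubstX.
by rewrite Ex Ey.
Qed.

Lemma exp_log_sub n (f : mseries n R) : f 0%MM = 0 ->
  msubst (fun=> msubst (fun=> f) (useries l)) (useries e) = f.
Proof.
move=> f0; rewrite -msubst_msubst; last by rewrite useries_const.
by rewrite (exp_log uni lE) msubstX.
Qed.

Lemma log_exp_sub n (f : mseries n R) : f 0%MM = 0 ->
  msubst (fun=> msubst (fun=> f) (useries e)) (useries l) = f.
Proof.
move=> f0; rewrite -msubst_msubst; last by rewrite useries_const.
by rewrite (log_exp uni lE) msubstX.
Qed.

Lemma exp_law_comm i j : exp_law_coef i j = exp_law_coef j i.
Proof.
have ne : (ord_max : 'I_2) != ord0 by [].
rewrite -[RHS](mcoef_fgl_substX exp_law_coef ne) exp_lawE ?mserX0 //.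
have -> : log_sum y2 x2 = log_sum x2 y2 by apply: addrC.
by rewrite /exp_law_coef [in RHS]addmC.
Qed.

Lemma exp_law_u0 i : exp_law_coef i 0%N = (i == 1%N)%:R.
Proof.
pose t := mserX R (ord0 : 'I_1).
have H : fgl_subst exp_law_coef t 0 = t.
  rewrite exp_lawE ?mserX0 // /log_sum.
  have -> : msubst (fun=> 0 : mseries 1 R) (useries l) = 0.
    rewrite -mser_compE //; apply: mseriesP => m; rewrite mcoef_comp.
    rewrite big_ord_recl l0 mul0r add0r big1 // => k _.
    by rewrite expr0n mulr0.
  by rewrite addr0 exp_log_sub ?mserX0.
have := congr1 (fun h : mseries 1 R => h (U_(ord0) *+ i)%MM) H.
rewrite /= mcoef_fgl_subst mdegMn mdeg1 mul1n big_ord_recr /= [X in X + _]big1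
  => [|p _].
  rewrite add0r big_ord_recl big1 => [|q _].
    rewrite addr0 expr0 mulr1 mserX_mmon mcoef_mmon eqxx mulr1 => ->.
    rewrite mcoefX; congr ((_ : bool)%:R).
    apply/eqP/eqP => [/(congr1 mdeg)|->]; last by rewrite mulm1n.
    by rewrite mdegMn mdeg1 mul1n.
  by rewrite expr0n /= mulr0 mulr0.
rewrite big_ord_recl big1 => [|q _]; last by rewrite expr0n /= mulr0 mulr0.
rewrite expr0 mulr1 addr0 mserX_mmon mcoef_mmon;
  case: eqP => [/(congr1 mdeg)|_].
  by rewrite !mdegMn mdeg1 !mul1n => Ei; have := ltn_ord p; lia.
by rewrite mulr0.
Qed.

Lemma exp_law_0v j : exp_law_coef 0%N j = (j == 1%N)%:R.
Proof. by rewrite exp_law_comm exp_law_u0. Qed.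

(** Both sides are exp(log x + log y + log z), as log turns the law into addition. *)
Lemma exp_law_assoc :
    let x i : mseries 3 R := mserX R (inord i) in
    let add := fgl_subst exp_law_coef in
    add 3%N (add 3%N (x 0%N) (x 1%N)) (x 2%N) =
    add 3%N (x 0%N) (add 3%N (x 1%N) (x 2%N)).
Proof.
move=> x add; have x0 i : x i 0%MM = 0 by rewrite mserX0.
have add0 f g : add 3%N f g 0%MM = 0 by rewrite fgl_subst0 exp_law_u0.
have addE (f g : mseries 3 R) : f 0%MM = 0 -> g 0%MM = 0 ->
    add 3%N f g = msubst (fun=> log_sum f g) (useries e) by exact: exp_lawE.
have logE (f g : mseries 3 R) : f 0%MM = 0 -> g 0%MM = 0 ->
    msubst (fun=> add 3%N f g) (useries l) = log_sum f g.
  by move=> f0 g0; rewrite addE //; apply/log_exp_sub/log_sum0.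
rewrite (addE _ _ (add0 _ _) (x0 _)) (addE _ _ (x0 _) (add0 _ _)).
have -> // : log_sum (add 3%N (x 0%N) (x 1%N)) (x 2%N) =
  log_sum (x 0%N) (add 3%N (x 1%N) (x 2%N)).
rewrite {1}/log_sum (logE _ _ (x0 _) (x0 _)) [in RHS]/log_sum.
by rewrite (logE _ _ (x0 _) (x0 _)) /log_sum addrA.
Qed.

Definition exp_law : fgl R :=
  FGL exp_law_u0 exp_law_0v exp_law_comm exp_law_assoc.
End ExpLaw.

Section Prescribe.
Variable R : comNzRingType.
Implicit Types (e l : nat -> R).

Lemma eqdeg_useries n e e' : (forall k, (k < n)%N -> e k = e' k) ->
  eqdeg n (useries e) (useries e').
Proof. by move=> E m; apply: E. Qed.

Lemma log_agree n e e' l l' : is_log e l -> is_log e' l' ->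
  (forall k, (k < n)%N -> e k = e' k) -> forall k, (k < n)%N -> l k = l' k.
Proof.
move=> lE lE' Ee k; have [d lt_d] := ubnP k;
  elim: d k lt_d => // d IHd k lt_k lt_n.
rewrite lE lE'; congr (_ - _); apply: eq_bigr => i _; have lti := ltn_ord i.
have -> : l i = l' i.
  by apply: IHd; [exact: leq_trans lti lt_k | exact: ltn_trans lti lt_n].
congr (_ * _); by apply: (eqdegX i (eqdeg_useries Ee));
  rewrite mdegMn mdeg1 mul1n.
Qed.

(** The log sums s and s' agree below degree n and have no mixed monomials. Hence s^k and s'^k have
    the same coefficient at the given mixed monomial of degree n for all k < n, and only the terms k
    = n differ, where s^n and s'^n both contribute the binomial. *)
Lemma exp_law_agree n e e' l l' i j :
    unipotent e -> unipotent e' -> is_log e l -> is_log e' l' ->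
    (forall k, (k < n)%N -> e k = e' k) ->
    (0 < i)%N -> (0 < j)%N -> (i + j = n)%N ->
  exp_law_coef e l i j - exp_law_coef e' l' i j = (e n - e' n) *+ 'C(n, i).
Proof.
move=> uni uni' lE lE' Ee i_gt0 j_gt0 En;
  have ne : (ord0 : 'I_2) != ord_max by [].
have s0 c c' : is_log c c' ->
    log_sum c' (mserX R (ord0 : 'I_2)) (mserX R ord_max) 0%MM = 0.
  by move=> H; apply: (log_sum0 H).
have s2 c c' : is_log c c' -> eqdeg 2
    (log_sum c' (mserX R (ord0 : 'I_2)) (mserX R ord_max))
    (mserX R ord0 + mserX R ord_max).
  move=> /log_unipotent[c0 c1]; have : eqdeg 2 (useries c') (mserX R ord0).
    move=> m; rewrite [m]mnm_ord1; move: (mdeg m) => d;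
      rewrite mdegMn mdeg1 mul1n.
    rewrite useriesE mcoefX; case: d => [|[|//]] _.
      by rewrite c0 mulm0n eq_sym mnm1_eq0.
    by rewrite c1 mulm1n eqxx.
  by move=> E; apply: eqdegD; (apply: eqdeg_trans; first exact: msubst_eqdeg E);
    rewrite msubstX ?mserX0.
have s1 c c' : is_log c c' ->
    log_sum c' (mserX R (ord0 : 'I_2)) (mserX R ord_max)
      (U_(ord0) *+ i + U_(ord_max) *+ j)%MM = 0.
  have mne k a : (0 < i)%N -> (0 < j)%N ->
      (U_(ord0 : 'I_2) *+ i + U_(ord_max) *+ j)%MM != (U_(a) *+ k)%MM.
    move=> ip jp; apply/eqP => Em.
    have := congr1 (fun m : 'X_{1..2} => (m ord0, m ord_max)) Em.
    rewrite mon2_l // mon2_r // !mulmnE !mnm1E.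
    have [->|->] : a = ord0 \/ a = ord_max.
      by case: a {Em} => [[|[|//]] lta]; [left | right]; apply: val_inj.
    by rewrite eqxx mul1n mul0n => -[_ j0]; rewrite j0 in jp.
    by rewrite eqxx mul1n mul0n => -[i0 _]; rewrite i0 in ip.
  move=> /log_unipotent[c0 c1]; rewrite mcoefD -!mser_compE ?mserX0 //.
  rewrite !mcoef_comp !big1 ?addr0 // => k _;
    by rewrite mserX_mmon mcoef_mmon (negPf (mne _ _ _ _)) ?mulr0.
rewrite /exp_law_coef -!mser_compE; [|exact: s0 lE'|exact: s0 lE].
set s := log_sum l _ _; set s' := log_sum l' _ _; set m := (_ + _)%MM.
have Cs : (s ^+ n) m = 'C(n, i)%:R.
  by rewrite -En; apply: mcoefX_binom => //; [apply: s0 lE | apply: s2 lE].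
have Cs' : (s' ^+ n) m = 'C(n, i)%:R.
  by rewrite -En; apply: mcoefX_binom => //; [apply: s0 lE' | apply: s2 lE'].
have dm : mdeg m = n by rewrite mdeg_mon2.
have splitE c (z : mseries 2 R) : mser_comp c z m =
    \sum_(k < n) c k * (z ^+ k) m + c n * (z ^+ n) m.
  by rewrite mcoef_comp dm big_ord_recr.
rewrite [X in X - _]splitE [X in _ - X]splitE Cs Cs'.
rewrite [X in X + _ - _](_ : _ = \sum_(k < n) e' k * (s' ^+ k) m).
  by rewrite opprD addrACA subrr add0r -mulrBl mulr_natr.
have sm : s m = 0 by apply: s1 lE.
have sm' : s' m = 0 by apply: s1 lE'.
have Ess : eqdeg n s s'.
  by apply: eqdegD; apply: msubst_eqdeg;
    apply/eqdeg_useries/(log_agree lE lE' Ee).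
apply: eq_bigr => k _; rewrite (Ee k (ltn_ord k)); congr (_ * _).
case: (k : nat) => [|[|p]]; [by rewrite !expr0 | by rewrite !expr1 sm sm' |].
apply: (eqdegX_shift (s0 _ _ lE) (s0 _ _ lE') Ess).
by rewrite dm addnS ltnS leq_addr.
Qed.

Definition log_of e : nat -> R := projT1 (cid (log_exists e)).
Lemma log_ofP e : is_log e (log_of e).
Proof. exact: projT2 (cid (log_exists e)). Qed.

(* Changing e_n alters the coefficient of u^i v^j, i + j = n, of the law
   exp(log u + log v) by a nonzero integer multiple of the change. *)
Lemma prescribe (inv : nat -> R) (g : nat -> nat) (xi : nat -> R) :
    (forall k, (0 < k)%N -> (inv k) *+ k = 1) ->
    (forall n, (1 < n)%N -> (0 < g n < n)%N) ->
  exists2 e, unipotent e &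
    forall n, (1 < n)%N -> exp_law_coef e (log_of e) (g n) (n - g n) = xi n.
Proof.
move=> invP g_bound.
(* The recursion sees e cut off below n, with value 0 at n; e_n is the defect of the resulting law
   divided by the binomial of [exp_law_agree]. The values [n%:R] at n = 0, 1 make e unipotent. *)
have [e eE] := strong_rec 0 (fun n c => if n is n'.+2 then
  inv 'C(n, g n) * (xi n - exp_law_coef c (log_of c) (g n) (n - g n)) else
    n%:R).
have uni : unipotent e by split; rewrite eE.
pose c n k := if (k < n)%N then e k else 0.
have eE2 n : (1 < n)%N -> e n = inv 'C(n, g n) *
    (xi n - exp_law_coef (c n) (log_of (c n)) (g n) (n - g n)).
  by case: n => [|[|n]] // _; rewrite eE.
exists e => // n n_gt1; have /andP[g_gt0 lt_g] := g_bound n n_gt1.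
have unic : unipotent (c n) by case: uni;
  rewrite /unipotent /c n_gt1 (ltnW n_gt1).
have Ec k : (k < n)%N -> e k = c n k by rewrite /c => ->.
have lt_gn : (0 < n - g n)%N by rewrite subn_gt0.
have gn : (g n + (n - g n) = n)%N by rewrite subnKC // ltnW.
have H := exp_law_agree uni unic (log_ofP e) (log_ofP (c n)) Ec g_gt0 lt_gn gn.
rewrite -[LHS](subrK (exp_law_coef (c n) (log_of (c n)) (g n) (n - g n))) H.
have cn0 : c n n = 0 by rewrite /c ltnn.
rewrite cn0 subr0 (eE2 n n_gt1) -mulrnAl invP ?bin_gt0 ?(ltnW lt_g) //.
by rewrite mul1r subrK.
Qed.
End Prescribe.

(** * Torsion and divisibility by powers of 2 in the Lazard ring *)

Section LazardHom.
Variables (L : comNzRingType) (F : fgl L) (p : nat).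
Hypotheses (hL : is_lazard F) (p_pr : prime p).

(** [inv] makes R an algebra over the rationals, where [prescribe] gives a law with the wanted
    values of the generators; universality turns the law into a morphism. *)
Lemma lazard_hom (R : comNzRingType) (inv : nat -> R) (xi : nat -> R) :
    (forall k, (0 < k)%N -> (inv k) *+ k = 1) ->
  exists phi : {rmorphism L -> R}, forall n, phi (lazard_x F p n) = xi n.
Proof.
move=> invP.
have [e uni eE] := prescribe (fun n => xi n.-2) invP
  (fun n n_gt1 => lazard_gen_bound p_pr n_gt1).
have [phi phiE _] := hL (exp_law uni (log_ofP e)).
by exists phi => n; rewrite phiE; apply: (eE n.+2).
Qed.

Definition ratV {N} (k : nat) : {mpoly rat[N]} := ((k%:R : rat)^-1)%:MP.

Lemma ratVP N k : (0 < k)%N -> (ratV k : {mpoly rat[N]}) *+ k = 1.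
Proof.
move=> k_gt0; have k0 : (k%:R : rat) != 0 by rewrite Num.Theory.pnatr_eq0 -lt0n.
by rewrite /ratV -mpolyCMn -[X in X%:MP](mulr_natr (k%:R^-1)) mulVf.
Qed.

(** The generators below N go to the variables, all others to 0. The second clause keeps images
    integral, so that divisibility can be tested on integer coefficients. *)
Lemma lazard_poly_hom N : exists2 phi : {rmorphism L -> {mpoly rat[N]}},
    (forall f, phi (lazard_poly F p N f) = map_mpoly intr f) &
    forall M (g : {mpoly int[M]}), exists g' : {mpoly int[N]},
      phi (lazard_poly F p M g) = map_mpoly intr g'.
Proof.
pose xi k : {mpoly int[N]} := if insub k is Some i then 'X_i else 0.
have [phi phiE] := lazard_hom (fun k => map_mpoly intr (xi k)) (@ratVP N).
have phi_poly M (g : {mpoly int[M]}) : phi (lazard_poly F p M g) =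
    map_mpoly intr (mmap (@mpolyC N _) (fun i : 'I_M => xi i) g).
  rewrite lazard_polyE !rmorph_mmap; congr (mmap _ _ g).
    by apply/funext => z; rewrite rmorph_int /= map_mpolyC /= [RHS]rmorph_int.
  by apply/funext => i.
exists phi => [f|M g]; last by rewrite phi_poly; eexists.
rewrite phi_poly; congr map_mpoly; rewrite -[RHS](comp_mpoly_id f).
rewrite /comp_mpoly; congr (mmap _ _ f); apply/funext => i.
by rewrite tnth_mktuple /xi valK.
Qed.
End LazardHom.

Section Torsion.
Variables (L : comNzRingType) (F : fgl L).
Hypothesis hL : is_lazard F.

Lemma map_intr_inj N : injective (map_mpoly intr : {mpoly int[N]} -> {mpoly
  rat[N]}).
Proof.
move=> f g E; apply/mpolyP => m; apply: (@intr_inj rat).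
by rewrite -!mcoeff_map_mpoly E.
Qed.

(** The image of c in rational polynomials vanishes, hence so does the integral polynomial f
    representing a multiple of c by some s prime to p. So c is killed by s and by p. *)
Lemma lazard_ptorsion p (c : L) : prime p -> c *+ p = 0 -> c = 0.
Proof.
move=> p_pr pc; have [N [f [s [cs Ef]]]] := lazard_localT hL p_pr c.
have [phi phiE _] := lazard_poly_hom hL p_pr N.
have phic : phi c = 0.
  have : phi c *+ p == 0 by rewrite -rmorphMn pc rmorph0.
  rewrite -mulr_natr mulf_eq0 => /orP[/eqP //|].
  rewrite -mpolyC_nat mpolyC_eq0 Num.Theory.pnatr_eq0 => /eqP p0.
  by rewrite p0 in p_pr.
have f0 : f = 0.
  apply: map_intr_inj; rewrite rmorph0 /= -phiE -Ef rmorphMn phic.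
  by rewrite mul0rn.
have sc : c *+ s = 0 by rewrite Ef f0 rmorph0.
case: (egcdnP s (prime_gt0 p_pr)) => u v E _.
have cop : gcdn p s = 1%N by apply/eqP.
rewrite cop in E; have := congr1 (fun n => c *+ n) E.
by rewrite mulnC mulrnA pc mul0rn mulrnDr mulnC mulrnA sc mul0rn add0r mulr1n.
Qed.

Lemma lazard_torsion_free k (c : L) : (0 < k)%N -> c *+ k = 0 -> c = 0.
Proof.
move=> k_gt0; have [n] := ubnP k;
  elim: n k k_gt0 c => // n IHn k k_gt0 c lt_k kc.
have [k1|k_gt1] := leqP k 1.
  by have k1' : k = 1%N by [lia]; rewrite k1' mulr1n in kc.
have p_pr := pdiv_prime k_gt1; have dvd := pdiv_dvd k.
apply: (IHn (k %/ pdiv k)%N); first by rewrite divn_gt0 ?pdiv_gt0 // dvdn_leq.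
  by apply: leq_trans (_ : k <= n)%N; rewrite ?ltn_Pdiv ?prime_gt1.
by apply: (lazard_ptorsion p_pr); rewrite -mulrnA divnK.
Qed.

(** Locally at 2, c is an integral polynomial f over an odd integer. Divisibility of c by 2^k passes
    to the coefficients of f, odd multipliers being harmless, so f = 0. *)
Lemma lazard_separated (c : L) : (forall k, exists d, c = d *+ 2 ^ k) -> c = 0.
Proof.
move=> cP; have [N [f [s [cs Ef]]]] := lazard_localT hL (isT : prime 2) c.
have s_gt0 : (0 < s)%N by case: s cs {Ef} => //.
apply: (lazard_torsion_free s_gt0); rewrite Ef.
have [phi phiE phiZ] := lazard_poly_hom hL (isT : prime 2) N.
suff -> : f = 0 by rewrite rmorph0.
apply/mpolyP => m; rewrite mcoeff0; apply/eqP; rewrite -absz_eq0.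
set a := absz _.
have dvd k : (2 ^ k %| a)%N.
  have [d Ed] := cP k.
  have [M [g [t [ct Eg]]]] := lazard_localT hL (isT : prime 2) d.
  have [g' Eg'] := phiZ M g.
  have E : f *+ t = g' *+ (2 ^ k * s)%N.
    apply: map_intr_inj; rewrite !rmorphMn /= -Eg' -phiE -Eg -Ef Ed.
    by rewrite !rmorphMn -!mulrnA; congr (_ *+ _);
      rewrite [(t * _)%N]mulnC ?mulnA.
  have Em : f@_m *+ t = g'@_m *+ (2 ^ k * s)%N by rewrite -!mcoeffMn E.
  have Ea : (a * t = `|g'@_m| * (2 ^ k * s))%N.
    have := congr1 absz Em; rewrite -[in LHS]mulr_natr -[in RHS]mulr_natr.
    by rewrite !abszM !natz !absz_nat.
  have cop : coprime (2 ^ k)%N t by rewrite coprimeXl.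
  by rewrite -(Gauss_dvdl _ cop) Ea mulnCA dvdn_mulr.
apply: contraT; rewrite -lt0n => a_gt0.
have := dvdn_leq a_gt0 (dvd a).
by rewrite leqNgt ltn_expl.
Qed.
End Torsion.

(** * Terms of least weight *)

Section Weight.
Variable n : nat.
Implicit Types m : 'X_{1..n}.

Definition weight m : nat := (\sum_(i < n) i.+1 * m i)%N.

Lemma weight0 : weight 0%MM = 0%N.
Proof. by rewrite /weight big1 // => i _; rewrite mnm0E muln0. Qed.

Lemma weightD a b : weight (a + b)%MM = (weight a + weight b)%N.
Proof. by rewrite /weight -big_split; apply: eq_bigr => i _;
  rewrite mnmDE mulnDr. Qed.

Lemma weightMn a k : weight (a *+ k)%MM = (weight a * k)%N.
Proof. by rewrite /weight big_distrl; apply: eq_bigr => i _;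
  rewrite mulmnE mulnA. Qed.

Lemma weightU i : weight U_(i)%MM = i.+1.
Proof.
rewrite /weight (bigD1 i) //= mnm1E eqxx muln1 big1 ?addn0 // => j ne.
by rewrite mnm1E eq_sym (negPf ne) muln0.
Qed.

Lemma weight_sum I (r : seq I) (P : pred I) (f : I -> 'X_{1..n}) :
  weight (\sum_(i <- r | P i) f i)%MM = (\sum_(i <- r | P i) weight (f i))%N.
Proof. by apply: (big_morph weight); [exact: weightD | exact: weight0]. Qed.
End Weight.

Section Lead.
Variables (n : nat) (R : comNzRingType).
Implicit Types (f g : mseries n R) (m : 'X_{1..n}).

Definition lead f m (c : R) :=
  f m = c /\ forall m', m' != m -> (weight m' <= weight m)%N -> f m' = 0.

Definition ordw f w := forall m, (weight m < w)%N -> f m = 0.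

Lemma leadM f g m m' c c' : lead f m c -> lead g m' c' ->
  lead (f * g) (m + m')%MM (c * c').
Proof.
move=> [<- f0] [<- g0]; split=> [|k ne le_k].
  apply: mcoefM_D1 => // a b E ne.
  have [le_a|lt_a] := leqP (weight a) (weight m); first by rewrite f0 ?mul0r.
  rewrite (g0 b) ?mulr0 //.
    by apply: contra_neq ne => Eb; apply: (@addIm _ m'); rewrite E Eb.
  by have := congr1 (@weight n) E; rewrite !weightD; lia.
apply: mcoefM_eq0 => a b E.
have [Ea|ne_a] := eqVneq a m; last first.
  have [le_a|lt_a] := leqP (weight a) (weight m); first by rewrite f0 ?mul0r.
  rewrite (g0 b) ?mulr0 //; last by move: le_k; rewrite E !weightD; lia.
  by apply/eqP => Eb; move: le_k; rewrite E Eb !weightD; lia.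
rewrite (g0 b) ?mulr0 //; last by move: le_k; rewrite E !weightD Ea leq_add2l.
by apply: contra_neq ne => Eb; rewrite E Ea Eb.
Qed.

Lemma lead1 : lead 1 0%MM 1.
Proof. by split=> [|m ne _]; rewrite mcoef1 ?eqxx // (negPf ne). Qed.

Lemma lead_prod (I : finType) (P : pred I) (f : I -> mseries n R)
    (m : I -> 'X_{1..n}) (c : I -> R) :
    (forall i, P i -> lead (f i) (m i) (c i)) ->
  lead (\prod_(i | P i) f i) (\sum_(i | P i) m i)%MM (\prod_(i | P i) c i).
Proof.
move=> H; elim/big_ind3: _ => //; first exact: lead1.
by move=> *; apply: leadM.
Qed.

Lemma leadX f m c k : lead f m c -> lead (f ^+ k) (m *+ k)%MM (c ^+ k).
Proof.
move=> H; elim: k => [|k IHk]; first by rewrite mulm0n; apply: lead1.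
by rewrite !exprS mulmS; apply: leadM.
Qed.

Lemma leadU (i : 'I_n) : lead (mserX R i) U_(i)%MM 1.
Proof. by split=> [|m ne _]; rewrite mcoefX ?eqxx // (negPf ne). Qed.

Lemma lead_ordw f m c : lead f m c -> ordw f (weight m).
Proof.
move=> [_ f0] m' lt_m; apply: f0 (ltnW lt_m).
by apply: contraTneq lt_m => ->; rewrite ltnn.
Qed.

Lemma ordwM f g v w : ordw f v -> ordw g w -> ordw (f * g) (v + w).
Proof.
move=> f0 g0 m lt_m; apply: mcoefM_eq0 => a b E.
have [lt_a|le_a] := ltnP (weight a) v; first by rewrite f0 ?mul0r.
by rewrite (g0 b) ?mulr0 //; move: lt_m; rewrite E weightD; lia.
Qed.

Lemma ordwX f v k : ordw f v -> ordw (f ^+ k.+1) v.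
Proof.
move=> f0; elim: k => [|k IHk] //; rewrite exprS -[v]add0n.
exact: ordwM.
Qed.

(** Every mixed term a_pq f^p g^q with p, q >= 1 has weight at least v + w. *)
Lemma fgl_ordw (F : fgl R) f g v w m : f 0%MM = 0 -> g 0%MM = 0 ->
    ordw f v -> ordw g w -> (weight m < v + w)%N ->
  fgl_add F f g m = f m + g m.
Proof.
move=> f0 g0 fv gw lt_m; rewrite /fgl_add mcoef_fgl_subst.
have deltaE (h : mseries n R) : h 0%MM = 0 ->
    \sum_(q < (mdeg m).+1) (q == 1%N :> nat)%:R * (h ^+ q) m = h m.
  move=> h0; have [/eqP|m_gt0] := posnP (mdeg m).
    by rewrite mdeg_eq0 => /eqP->; rewrite mdeg0 big_ord1 mul0r h0.
  rewrite (bigD1 (Ordinal (m_gt0 : 1 < (mdeg m).+1)%N)) //= mul1r expr1.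
  rewrite big1 ?addr0 // => q ne.
  by rewrite -[_ == 1%N]/(q == Ordinal (m_gt0 : 1 < (mdeg m).+1)%N) (negPf ne)
    mul0r.
have E p q : F p q * (f ^+ p * g ^+ q) m =
    (q == 0%N)%:R * ((p == 1%N)%:R * (f ^+ p) m) +
    (p == 0%N)%:R * ((q == 1%N)%:R * (g ^+ q) m).
  case: p q => [|p] [|q].
  - by rewrite fgl_u0 !mul0r !mulr0 addr0.
  - by rewrite fgl_0v expr0 mul1r !mul0r mul1r add0r.
  - by rewrite fgl_u0 expr0 mulr1 mul1r !mul0r addr0.
  - by rewrite (ordwM (ordwX p fv) (ordwX q gw)) // !mul0r mulr0 addr0.
under eq_bigr do under eq_bigr do rewrite E.
under eq_bigr do rewrite big_split /= -mulr_suml -mulr_sumr.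
have sum0 : \sum_(q < (mdeg m).+1) (q == 0%N :> nat)%:R = 1 :> R.
  by rewrite big_ord_recl big1 ?addr0.
by rewrite big_split /= -mulr_sumr -mulr_suml sum0 !mul1r !deltaE.
Qed.

End Lead.

(** * The rearrangement inequality and its equality case *)

Section Rearrangement.
Local Open Scope nat_scope.

(** By injectivity w i is at least the number of j with w j < w i. Summed over i, this counts each
    unordered pair of indices once, which gives 'C(k, 2). *)
Lemma sum_inj_ge (w : nat -> nat) k : {in gtn k &, injective w} ->
  \sum_(0 <= i < k) i <= \sum_(0 <= i < k) w i.
Proof.
move=> inj_w.
have le_w c : \sum_(0 <= j < k | w j < c) 1 <= c.
  rewrite sum1_count -size_filter -(size_map w) -[X in _ <= X](size_iota 0).
  apply: uniq_leq_size => [|b /mapP[j]]; last first.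
    by rewrite mem_filter => /andP[lt_j _] ->; rewrite mem_iota.
  rewrite map_inj_in_uniq ?filter_uniq ?iota_uniq // => a b.
  rewrite !mem_filter /index_iota !mem_iota !subn0 !add0n /=.
  by move=> /andP[_ lt_a] /andP[_ lt_b]; apply: inj_w.
have {}le_w c : \sum_(0 <= j < k) (w j < c : nat) <= c.
  by apply: leq_trans (le_w c); rewrite [leqRHS]big_mkcond leq_sum // => j _;
    case: ifP.
apply: leq_trans (_ : \sum_(0 <= i < k) \sum_(0 <= j < k) (w j < w i : nat) <=
  _);
  last by apply: leq_sum => i _.
rewrite -leq_double -!addnn [X in _ <= _ + X]exchange_big_nat -[X in _ <=
  X]big_split /=.
have E i : 0 <= i < k -> \sum_(0 <= j < k) (w j < w i : nat) +
    \sum_(0 <= j < k) (w i < w j : nat) = k.-1.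
  move=> lt_i; rewrite -big_split /=; rewrite leq0n in lt_i.
  have -> : \sum_(0 <= j < k) ((w j < w i) + (w i < w j)) =
            \sum_(0 <= j < k) (j != i : nat).
    apply: eq_big_nat => j /andP[_ lt_j].
    have [->|ne] := eqVneq j i; first by rewrite ltnn.
    by case: ltngtP => // /inj_w-/(_ lt_j lt_i) Ej; rewrite Ej eqxx in ne.
  have : \sum_(0 <= j < k) (j != i : nat) + \sum_(0 <= j < k) (j == i : nat) =
    k.
    rewrite -big_split /= -[RHS]subn0 -[RHS]muln1 -sum_nat_const_nat.
    by apply: eq_bigr => j _; case: eqP.
  rewrite [X in _ + X = _](bigD1_seq i) ?mem_index_iota ?iota_uniq //= eqxx [X
    in _ + (1 + X)]big1.
    by rewrite addn0 addn1 => /(congr1 predn).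
  by move=> j /negPf->.
rewrite (eq_big_nat _ _ E) sum_nat_const_nat subn0 bin2_sum addnn -mul2n.
by rewrite -mul_bin_diag bin1.
Qed.

(** Abel summation: subtracting the least part from all parts leaves a shorter instance plus that
    part times the inequality [sum_inj_ge]. As all differences are positive, equality overall forces
    equality at each stage. *)
Lemma rearrangement n (w l : nat -> nat) r : r <= n ->
    {in gtn n &, injective w} ->
    (forall i j, i < j < r -> l j < l i) -> (forall i, i < r -> 0 < l i) ->
  \sum_(0 <= i < r) l i * i <= \sum_(0 <= i < r) l i * w i /\
  (\sum_(0 <= i < r) l i * i = \sum_(0 <= i < r) l i * w i ->
   forall i, i < r -> w i = i).
Proof.
move=> le_rn inj_w; elim: r l le_rn => [|r IHr] l le_rn l_dec l_pos.
  by rewrite !big_geq.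
pose l' i := l i - l r.
have l'E i : i < r -> l i = l' i + l r.
  by move=> lt_i; rewrite subnK // ltnW // l_dec // lt_i /=.
have Esum v : \sum_(0 <= i < r.+1) l i * v i =
    \sum_(0 <= i < r) l' i * v i + l r * \sum_(0 <= i < r.+1) v i.
  rewrite !big_nat_recr //= mulnDr addnA; congr (_ + _).
  rewrite big_distrr -big_split /=; apply: eq_big_nat => i /andP[_ lt_i].
  by rewrite (l'E i) // mulnDl.
have [] := IHr l' (ltnW le_rn).
- move=> i j /andP[lt_ij lt_j]; rewrite /l' ltn_sub2r //.
    by apply: l_dec; rewrite (ltn_trans lt_ij) //=.
  by apply: l_dec; rewrite lt_ij ltnW.
- by move=> i lt_i; rewrite subn_gt0 l_dec // lt_i /=.
move=> le' eq'.
have le_w : \sum_(0 <= i < r.+1) i <= \sum_(0 <= i < r.+1) w i.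
  by apply: sum_inj_ge => i j lt_i lt_j; apply: inj_w; apply: leq_trans le_rn.
have lr_gt0 := l_pos r (ltnSn r).
rewrite (Esum id) (Esum w); split=> [|E];
  first by rewrite leq_add // leq_mul2l le_w orbT.
have leM : l r * \sum_(0 <= i < r.+1) i <= l r * \sum_(0 <= i < r.+1) w i.
  by rewrite leq_mul2l le_w orbT.
have E1 : \sum_(0 <= i < r) l' i * i = \sum_(0 <= i < r) l' i * w i by lia.
have /eqP : l r * \sum_(0 <= i < r.+1) i = l r * \sum_(0 <= i < r.+1) w i by
  lia.
rewrite eqn_pmul2l // !big_nat_recr //= => /eqP E2 i.
have wE := eq' E1; rewrite ltnS leq_eqVlt => /predU1P[->|/wE //].
have E3 : \sum_(0 <= i < r) w i = \sum_(0 <= i < r) i.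
  by apply: eq_big_nat => j /andP[_ /wE].
by move: E2; rewrite E3 => /addnI.
Qed.
End Rearrangement.

(** * Leading terms of the universal P- and Q-functions *)

Section Leads.
Variables (L : comNzRingType) (F : fgl L) (chi : nat -> L).
Hypothesis hchi : is_formal_inverse F chi.

Lemma formal_inverse0 : chi 0%N = 0. Proof. by case: hchi. Qed.

Lemma mser_comp_X n c (i : 'I_n) m :
  mser_comp c (mserX L i) m = if m == (U_(i) *+ m i)%MM then c (m i) else 0.
Proof.
have E k : (mserX L i ^+ k) m = (m == (U_(i) *+ k)%MM)%:R.
  by rewrite mserX_mmon mcoef_mmon.
rewrite mcoef_comp; under eq_bigr do rewrite E.
case: eqP => [Em|ne].
  have lt_m : (m i < (mdeg m).+1)%N by rewrite {2}Em mdegMn mdeg1 mul1n.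
  rewrite (bigD1 (Ordinal lt_m)) //= -Em eqxx mulr1 big1 ?addr0 // => k nek.
  case: eqP => [Ek|]; last by rewrite mulr0.
  case/eqP: nek; apply: val_inj => /=.
  by have := congr1 (fun m : 'X_{1..n} => m i) Ek;
    rewrite mulmnE mnm1E eqxx mul1n.
rewrite big1 // => k _; case: eqP => [Ek|]; last by rewrite mulr0.
case: ne; rewrite {1}Ek; have := congr1 (fun m : 'X_{1..n} => m i) Ek.
by rewrite mulmnE mnm1E eqxx mul1n => ->.
Qed.

Lemma formal_inverse1 : chi 1%N = -1.
Proof.
have [_ /(congr1 (fun f => mscoef f U_(ord0)%MM))] := hchi.
rewrite (@fgl_ordw _ _ _ _ _ 1 1) ?mser_comp0 ?formal_inverse0 ?mserX0 //;
  first last.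
- by rewrite weightU.
- move=> m; rewrite ltnS leqn0 => /eqP w0; rewrite mser_comp_X.
  case: eqP => // Em; suff -> : m ord0 = 0%N by rewrite formal_inverse0.
  by move: w0; rewrite {1}Em weightMn weightU mul1n.
- by move=> m lt_m; rewrite mcoefX; case: eqP lt_m => // ->; rewrite weightU.
rewrite mcoefX eqxx mser_comp_X mnm1E eqxx mulm1n eqxx mcoef0.
by move/eqP; rewrite addrC addr_eq0 => /eqP.
Qed.

Section Level.
Variable n : nat.
Local Notation x i := (mserX L (i : 'I_n)).
Local Notation bar f := (mser_comp chi f).

Lemma lead_bar (i : 'I_n) : lead (bar (x i)) U_(i)%MM (-1).
Proof.
split=> [|m ne le_m]; first by rewrite mser_comp_X mnm1E eqxx mulm1n eqxx
  formal_inverse1.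
rewrite mser_comp_X; case: eqP => // Em; case E: (m i) => [|[|k]].
- exact: formal_inverse0.
- by rewrite E mulm1n in Em; rewrite Em eqxx in ne.
- by move: le_m; rewrite Em E weightMn !weightU; lia.
Qed.

Lemma lead_add_lt f g (i j : 'I_n) c d : (i < j)%N ->
  lead f U_(i)%MM c -> lead g U_(j)%MM d -> lead (fgl_add F f g) U_(i)%MM c.
Proof.
move=> lt_ij Lf Lg; have := lead_ordw Lf; have := lead_ordw Lg.
rewrite !weightU => og of'.
have f0 : f 0%MM = 0 by apply: of'; rewrite weight0.
have g0 : g 0%MM = 0 by apply: og; rewrite weight0.
have E m : (weight m <= i.+1)%N -> fgl_add F f g m = f m.
  move=> le_m; rewrite (fgl_ordw F f0 g0 of' og) ?[g m]og ?addr0 //.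
    by rewrite ltnS (leq_trans le_m).
  by apply: leq_ltn_trans le_m _; lia.
case: Lf => fU fm; split=> [|m ne le_m]; first by rewrite E ?weightU.
by rewrite weightU in le_m; rewrite E // fm // weightU.
Qed.

Lemma lead_add f g (i j : 'I_n) c d : i != j ->
    lead f U_(i)%MM c -> lead g U_(j)%MM d ->
  lead (fgl_add F f g) U_(if (i < j)%N then i else j)%MM (if (i < j)%N then c
    else d).
Proof.
move=> ne Lf Lg; case: ltnP => [lt_ij|le_ji]; first exact: lead_add_lt Lg.
rewrite /fgl_add fgl_substC; apply: lead_add_lt Lf => //.
by rewrite ltn_neqAle le_ji andbT eq_sym.
Qed.

(** The two equal leading terms add up; this 2 becomes the leading coefficient 2^r of Q. *)
Lemma lead_double (i : 'I_n) : lead (fgl_add F (x i) (x i)) U_(i)%MM 2%:R.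
Proof.
have oi := lead_ordw (leadU L i); rewrite weightU in oi.
have E m : (weight m <= i.+1)%N -> fgl_add F (x i) (x i) m = x i m + x i m.
  by move=> le_m; rewrite (fgl_ordw F _ _ oi oi) ?mserX0 //; lia.
split=> [|m ne le_m]; first by rewrite E ?weightU // !mcoefX eqxx.
by rewrite weightU in le_m; rewrite E // !mcoefX (negPf ne) addr0.
Qed.

Definition exps (l : seq nat) : 'X_{1..n} := [multinom nth 0%N l i | i < n].

(** The leading exponent of [PQ_den]: each factor contributes its variable of smaller index. The
    sign, in [sgn], is -1 when that variable is the inverted one. *)
Definition den_exp : 'X_{1..n} :=
  (\sum_(i < n) \sum_(j < n | j != i) U_(if (i < j)%N then i else j))%MM.
Definition sgn (i j : 'I_n) : L := if (i < j)%N then 1 else -1.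
Definition den_sgn : L := \prod_(i < n) \prod_(j < n | j != i) sgn i j.

Lemma den_sgn2 : den_sgn * den_sgn = 1.
Proof.
rewrite /den_sgn -big_split big1 // => i _ /=;
  rewrite -big_split big1 // => j _.
by rewrite /= /sgn; case: ifP; rewrite ?mulr1 // mulrNN mulr1.
Qed.

Lemma den_reindex (w : 'S_n) :
  (\sum_(i < n) \sum_(j < n | j != i) U_(if (w i < w j)%N then w i else w
    j))%MM = den_exp /\
  \prod_(i < n) \prod_(j < n | j != i) sgn (w i) (w j) = den_sgn.
Proof.
split.
  rewrite /den_exp [RHS](reindex_perm w); apply: eq_bigr => i _.
  rewrite [RHS](reindex_perm w); apply: eq_bigl => j.
  by rewrite (inj_eq perm_inj).
rewrite /den_sgn [RHS](reindex_perm w); apply: eq_bigr => i _.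
rewrite [RHS](reindex_perm w); apply: eq_bigl => j.
by rewrite (inj_eq perm_inj).
Qed.

Lemma lead_den : lead (PQ_den F chi n) den_exp den_sgn.
Proof.
apply: lead_prod => i _; apply: lead_prod => j ne.
by apply: lead_add; [rewrite eq_sym | apply: leadU | apply: lead_bar].
Qed.

Section Term.
Variables (wt : nat -> mseries n L -> mseries n L) (kappa : L) (l : seq nat).
Hypothesis lead_wt : forall k i, (0 < k)%N ->
  lead (wt k (x i)) (U_(i) *+ k)%MM kappa.
Hypotheses (l_strict : is_strict l) (le_ln : (size l <= n)%N).
Let r := size l.

Definition perm_exp (w : 'S_n) : 'X_{1..n} :=
  (\sum_(i < n | (i < r)%N) U_(w i) *+ nth 0%N l i)%MM.

Lemma nth_strict_gt0 i : (i < r)%N -> (0 < nth 0%N l i)%N.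
Proof.
move=> lt_i; have /andP[_ n0] := l_strict; rewrite lt0n.
by apply: contraNneq n0 => <-; apply: mem_nth.
Qed.

Lemma nth_strict_dec i j : (i < j < r)%N -> (nth 0%N l j < nth 0%N l i)%N.
Proof.
move=> /andP[lt_ij lt_j]; have /andP[srt _] := l_strict.
have tr : transitive gtn by move=> a b c; rewrite /gtn /= => H1 H2;
  apply: ltn_trans H2 H1.
by apply: (sorted_ltn_nth tr 0%N srt); rewrite ?inE // (ltn_trans lt_ij).
Qed.

(** x_i +_F x_j and x_i +_F \bar x_j have the same leading monomial and differ at most in sign.
    Exchanging some of these factors thus preserves the exponent of [PQ_den], whose factors w merely
    permutes. *)
Lemma lead_term (w : 'S_n) : lead (PQ_term F chi wt l w)
  (perm_exp w + den_exp)%MM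
  (kappa ^+ r * \prod_(i < n) \prod_(j < n | j != i)
      if (i < r)%N && (i < j)%N then 1 else sgn (w i) (w j)).
Proof.
have [<- _] := den_reindex w; rewrite /PQ_term -/r.
have ne_w (i j : 'I_n) : i != j -> w i != w j by rewrite (inj_eq perm_inj).
pose mn (i j : 'I_n) := if (w i < w j)%N then w i else w j.
have -> : (\sum_(i < n) \sum_(j < n | j != i) U_(mn i j) =
    \sum_(i < n | (i < r)%N) \sum_(j < n | (i < j)%N) U_(mn i j) +
    \sum_(i < n) \sum_(j < n | (j != i) && ~~ ((i < r) && (i < j))%N) U_(mn i
      j))%MM.
  rewrite [X in (X + _)%MM]big_mkcond -big_split; apply: eq_bigr => i _ /=.
  rewrite (bigID (fun j : 'I_n => (i < r) && (i < j))%N) /=; congr (_ + _)%MM.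
  case: ifP => ir; last by rewrite big_pred0 // => j; rewrite andbF.
  apply: eq_bigl => j; rewrite andTb; case: ltnP; rewrite ?andbF // => lt_ij.
  by rewrite andbT; apply: contraTneq lt_ij => ->; rewrite ltnn.
have -> : kappa ^+ r * (\prod_(i < n) \prod_(j < n | j != i)
      if (i < r)%N && (i < j)%N then 1 else sgn (w i) (w j)) =
  (\prod_(i < n | (i < r)%N) kappa) *
  (\prod_(i < n | (i < r)%N) \prod_(j < n | (i < j)%N) 1) *
  \prod_(i < n) \prod_(j < n | (j != i) && ~~ ((i < r) && (i < j))%N) sgn (w i)
    (w j).
  congr (_ * _).
    rewrite [X in _ * X]big1 ?mulr1 => [|i _]; last by rewrite big1.
    by rewrite -(big_ord_widen n (fun=> kappa) le_ln) prodr_const card_ord.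
  apply: eq_bigr => i _; rewrite [RHS]big_mkcondr; apply: eq_bigr => j _ /=.
  by case: ifP.
rewrite addmA; apply: leadM; [apply: leadM|].
- apply: lead_prod => i lt_i; apply: lead_wt.
  exact: nth_strict_gt0.
- apply: lead_prod => i lt_i; apply: lead_prod => j lt_j.
  have ne : w i != w j by apply: ne_w; apply: contraTneq lt_j => ->;
    rewrite ltnn.
  by have := lead_add ne (leadU L _) (leadU L _); rewrite if_same.
- apply: lead_prod => i _; apply: lead_prod => j /andP[ne _].
  by apply: lead_add; [apply: ne_w;
    rewrite eq_sym|apply: leadU|apply: lead_bar].
Qed.
End Term.
End Level.
End Leads.

Section PermExp.
Variables (n : nat) (l : seq nat).
Hypotheses (l_strict : is_strict l) (le_ln : (size l <= n)%N).
Let r := size l.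

Lemma weight_sum_nat (v : nat -> nat) :
  (\sum_(i < n | (i < r)%N) (v i).+1 * nth 0%N l i =
   \sum_(0 <= i < r) nth 0%N l i * v i + \sum_(0 <= i < r) nth 0%N l i)%N.
Proof.
rewrite -(big_ord_widen n (fun i => (v i).+1 * nth 0%N l i)%N le_ln) -big_split.
by rewrite big_mkord; apply: eq_bigr => i _; rewrite mulSn mulnC addnC.
Qed.

Lemma weight_exps : weight (exps n l) =
  (\sum_(0 <= i < r) nth 0%N l i * i + \sum_(0 <= i < r) nth 0%N l i)%N.
Proof.
rewrite -(weight_sum_nat id) /weight [RHS]big_mkcond; apply: eq_bigr => i _.
rewrite mnmE; case: ltnP => // ge_i.
by rewrite nth_default ?muln0.
Qed.

Definition fixes (w : 'S_n) := [forall i : 'I_n, (i < r)%N ==> (w i == i)].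

Lemma perm_exp_fix w : fixes w -> perm_exp l w = exps n l.
Proof.
move=> /forallP fix_w; rewrite [exps n l]multinomUE_id /perm_exp big_mkcond.
apply: eq_bigr => i _; rewrite mnmE; have := fix_w i.
case: ltnP => [_ /eqP-> //|ge_i _].
by rewrite nth_default // mulm0n.
Qed.

(** The weight of [perm_exp l w] is the sum of the (w i + 1) l_i, counting indices from 0, so the
    equality case of [rearrangement] applies. *)
Lemma perm_exp_lt w : ~~ fixes w ->
  (weight (exps n l) < weight (perm_exp l w))%N.
Proof.
move=> nfix; pose v k := if insub k is Some i then w i : nat else k.
have vE (i : 'I_n) : v i = w i by rewrite /v valK.
have v_inj : {in gtn n &, injective v}.
  move=> i j lt_i lt_j; rewrite -[i]/(val (Ordinal lt_i)) -[j]/(val (Ordinal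
    lt_j)).
  by rewrite !vE => /val_inj/perm_inj->.
have [le_v eq_v] := rearrangement le_ln v_inj (nth_strict_dec l_strict)
  (nth_strict_gt0 l_strict).
have -> : weight (perm_exp l w) =
    (\sum_(i < n | (i < r)%N) (v i).+1 * nth 0%N l i)%N.
  by rewrite weight_sum; apply: eq_bigr => i _; rewrite weightMn weightU vE.
rewrite weight_exps weight_sum_nat ltn_add2r ltn_neqAle le_v andbT.
apply: contraNneq nfix => /eq_v fix_v; apply/forallP => i; apply/implyP => lt_i.
by rewrite -val_eqE /= -vE fix_v.
Qed.

(** This number matches the factorial in the definition of P and Q. *)
Lemma card_fixes : #|fixes| = ((n - r)`!)%N.
Proof.
pose A := [set i : 'I_n | (r <= i)%N].
have <- : #|A| = (n - r)%N.
  have <- : #|~: A| = r -> (n - #|~: A|)%N = (n - r)%N by move->.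
    by rewrite -[n in (n - _)%N]card_ord -(cardsC A) addnK.
  have -> : ~: A = [set widen_ord le_ln i | i : 'I_r].
    apply/setP => i; rewrite !inE -ltnNge; apply/idP/imsetP => [lt_i|[j _ ->]].
      by exists (Ordinal lt_i) => //; apply: val_inj.
    by rewrite /= -/r ltn_ord.
  rewrite card_imset ?card_ord // => i j /(congr1 val) /= E; exact: val_inj.
rewrite -card_perm; apply: eq_card => w; rewrite unfold_in.
apply/forallP/subsetP => fix_w i.
  rewrite !inE leqNgt; have := fix_w i.
  by case: (i < r)%N => //= ->.
apply/implyP => lt_i; apply/contraT => ne.
by have := fix_w i; rewrite !inE leqNgt lt_i => /(_ ne).
Qed.
End PermExp.

Section LeadPQ.
Variables (L : comNzRingType) (F : fgl L) (chi : nat -> L).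
Hypothesis hchi : is_formal_inverse F chi.
Hypothesis tf : forall k (c : L), (0 < k)%N -> c *+ k = 0 -> c = 0.
Variables (n : nat) (wt : nat -> mseries n L -> mseries n L) (kappa : L).
Variable l : seq nat.
Hypothesis lead_wt : forall k i, (0 < k)%N ->
  lead (wt k (mserX L i)) (U_(i) *+ k)%MM kappa.
Hypotheses (l_strict : is_strict l) (le_ln : (size l <= n)%N).
Let r := size l.

Lemma lead_sum_term : lead (\sum_w PQ_term F chi wt l w)
  (exps n l + den_exp n)%MM ((kappa ^+ r * den_sgn L n) *+ (n - r)`!).
Proof.
have Lw w := lead_term hchi lead_wt l_strict le_ln w.
have small w m : ~~ fixes l w -> (weight m <= weight (exps n l + den_exp
  n)%MM)%N ->
    PQ_term F chi wt l w m = 0.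
  move=> nfix le_m; have lt := perm_exp_lt l_strict le_ln nfix.
  have lt_m : (weight m < weight (perm_exp l w + den_exp n)%MM)%N.
    by move: le_m; rewrite !weightD; lia.
  have [_ ->] := Lw w; rewrite ?(ltnW lt_m) //.
  by apply: contraTneq lt_m => ->; rewrite ltnn.
split=> [|m ne le_m].
  rewrite mcoef_sum (bigID (fixes l)) /= [X in _ + X]big1 ?addr0 => [|w nfix];
    last first.
    exact: small.
  rewrite -(card_fixes le_ln) -sumr_const.
  apply: eq_bigr => w fix_w; have [+ _] := Lw w.
  rewrite perm_exp_fix // => ->; congr (_ * _).
  (* If w fixes the first r indices, then i < r and i < j imply w i < w j: the signs replaced by 1
     were already 1, and each such w contributes the full sign of the denominator. *)
  have [_ <-] := den_reindex L w.
  apply: eq_bigr => i _; apply: eq_bigr => j ne;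
    case: ifP => // /andP[lt_i lt_ij].
  have fixE (k : 'I_n) : (k < r)%N -> w k = k.
    by move=> lt_k; have /forallP/(_ k)/implyP/(_ lt_k)/eqP := fix_w.
  rewrite /sgn fixE //; case: ltnP => // le_ji.
  have lt_wj : (w j < r)%N by apply: leq_ltn_trans le_ji _.
  have := fixE _ lt_wj; move/perm_inj => Ej.
  by move: le_ji; rewrite Ej leqNgt lt_ij.
rewrite mcoef_sum big1 // => w _; have [fix_w|nfix] := boolP (fixes l w).
  by have [_ T0] := Lw w; rewrite perm_exp_fix // in T0; apply: T0.
exact: small.
Qed.

(** Division of series by ascending weight: once P is known to vanish in smaller weights, its
    product with [PQ_den] has the coefficient den_sgn P_k at k + [den_exp]. Torsion-freeness cancels
    the factorial, and the sign squares to 1. *)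
Lemma lead_PQ P : is_PQ F chi wt l P -> lead P (exps n l) (kappa ^+ r).
Proof.
rewrite /is_PQ ltnNge le_ln /= -/r => E.
have [Ds D0] := lead_den hchi n; have [Ts T0] := lead_sum_term.
set N := ((n - r)`!)%N in E Ts T0; have N_gt0 : (0 < N)%N by apply: fact_gt0.
have PE k : (forall k', k' != exps n l -> (weight k' < weight k)%N -> P k' = 0)
  ->
    (weight k <= weight (exps n l))%N ->
    (\sum_w PQ_term F chi wt l w) (k + den_exp n)%MM = (den_sgn L n * P k) *+ N.
  move=> P0 le_k; rewrite -E -mulrA mulr_natl mcoefMn; congr (_ *+ _).
  rewrite addmC (@mcoefM_D1 _ _ _ _ (den_exp n) k) ?Ds // => a b Eab ne.
  have [le_a|lt_a] := leqP (weight a) (weight (den_exp n)).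
    by rewrite D0 // mul0r.
  have lt_b : (weight b < weight k)%N.
    by have := congr1 (@weight n) Eab; rewrite !weightD; lia.
  rewrite P0 ?mulr0 //; apply: contraTneq lt_b => ->.
  by rewrite -leqNgt.
have cancel c d : (den_sgn L n * c) *+ N = (den_sgn L n * d) *+ N -> c = d.
  move=> Ecd; apply/eqP; rewrite -subr_eq0 -[_ - _]mul1r -(den_sgn2 L n) -mulrA.
  rewrite (@tf N (den_sgn L n * (c - d))) ?mulr0 //.
  by rewrite mulrBr mulrnBl Ecd subrr.
have P0 k : k != exps n l -> (weight k <= weight (exps n l))%N -> P k = 0.
  have [d] := ubnP (weight k); elim: d k => // d IHd k lt_d ne le_k.
  apply: cancel; rewrite mulr0 mul0rn -PE //.
    apply: T0; last by rewrite !weightD leq_add2r.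
    by apply: contra_neq ne => /addIm.
  move=> k' ne' lt_k; apply: IHd => //; first exact: leq_trans lt_k _.
  exact: leq_trans (ltnW lt_k) _.
split=> //; apply: cancel; rewrite -PE // => [|k' ne' lt_k].
  by rewrite Ts mulrC.
by apply: P0 => //; apply: ltnW.
Qed.
End LeadPQ.

Section LeadUniversal.
Variables (L : comNzRingType) (F : fgl L) (chi : nat -> L).
Hypothesis hchi : is_formal_inverse F chi.
Hypothesis tf : forall k (c : L), (0 < k)%N -> c *+ k = 0 -> c = 0.

Lemma lead_P P (l : strict_partition) n : is_universal_P F chi P ->
  (size (val l) <= n)%N -> lead (P l n) (exps n (val l)) 1.
Proof.
move=> hP le_ln; rewrite -(expr1n _ (size (val l))).
apply: (lead_PQ hchi tf _ (valP l) le_ln (hP l n)) => k i k_gt0.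
by rewrite -(expr1n _ k); apply/leadX/leadU.
Qed.

Lemma lead_Q Q (l : strict_partition) n : is_universal_Q F chi Q ->
  (size (val l) <= n)%N -> lead (Q l n) (exps n (val l)) (2%:R ^+ size (val l)).
Proof.
move=> hQ le_ln; apply: (lead_PQ hchi tf _ (valP l) le_ln (hQ l n)) => k i
  k_gt0.
rewrite -[X in (_ *+ X)%MM](prednK k_gt0) mulmS.
rewrite -[2%:R]mulr1; apply: leadM; first exact: lead_double.
by rewrite -{1}(expr1n _ k.-1); apply/leadX/leadU.
Qed.
End LeadUniversal.

(** * Coefficients of the Cauchy identities *)

Local Notation mon1 k := (U_(ord0 : 'I_1) *+ k)%MM.

Lemma msubst_comp k n (R : comNzRingType) (g : 'I_k -> mseries n R) c
    (f : mseries k R) :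
  f 0%MM = 0 -> msubst g (mser_comp c f) = mser_comp c (msubst g f).
Proof.
by move=> f0; rewrite !mser_compE ?msubst_const // msubst_msubst.
Qed.

Section Univariate.
Variables (n : nat) (R : comNzRingType).

Lemma mcoef_msubstX (i : 'I_n) (h : mseries 1 R) m :
  msubst (fun=> mserX R i) h m = if m == (U_(i) *+ m i)%MM then h (mon1 (m i))
    else 0.
Proof.
have -> : h = useries (fun k => h (mon1 k)).
  by apply: mseriesP => d; rewrite {1}[d]mnm_ord1.
rewrite -mser_compE ?mserX0 // mser_comp_X; case: eqP => // _.
by rewrite /useries {2}/mscoef mdegMn mdeg1 mul1n.
Qed.

(** Induction over a list of variables, the partial product being supported on monomials in these
    variables. *)
Lemma mcoef_prod_msubstX (h : 'I_n -> mseries 1 R) m :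
  (\prod_i msubst (fun=> mserX R i) (h i)) m = \prod_i h i (mon1 (m i)).
Proof.
have H (r : seq 'I_n) : uniq r -> forall m : 'X_{1..n},
    (\prod_(i <- r) msubst (fun=> mserX R i) (h i)) m =
    if [forall i, (i \notin r) ==> (m i == 0%N)]
    then \prod_(i <- r) h i (mon1 (m i)) else 0.
  elim: r => [_|i r IHr /= /andP[i_r u_r]] {}m.
    rewrite !big_nil mcoef1.
    suff -> : [forall i, (i \notin [::]) ==> (m i == 0%N)] = (m == 0%MM).
      by case: eqP.
    apply/forallP/eqP => [m0|-> j]; last by rewrite mnm0E.
    by apply/mnmP => j; rewrite mnm0E; apply/eqP/(implyP (m0 j)).
  rewrite !big_cons; set a := (U_(i) *+ m i)%MM.
  have le_a : (a <= m)%MM.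
    by apply/mnm_lepP => j; rewrite mulmnE mnm1E; case: eqP => [<-|];
      rewrite ?mul1n.
  have ai : a i = m i by rewrite mulmnE mnm1E eqxx mul1n.
  rewrite (@mcoefM_D1 _ _ _ _ a (m - a)%MM); first last.
  - move=> a' b' Em ne; rewrite mcoef_msubstX; case: eqP => [Ea'|];
    last by rewrite mul0r.
    rewrite (IHr u_r b'); case: ifP => [/forallP/(_ i)|]; last by rewrite mulr0.
    rewrite i_r /= => /eqP b'0; case/eqP: ne; rewrite Ea' /a Em mnmDE b'0 addn0.
    by rewrite {1}Ea' mulmnE mnm1E eqxx mul1n.
  - by rewrite addmC submK.
  rewrite mcoef_msubstX ai eqxx (IHr u_r) -/a.
  have mE j : j != i -> (m - a)%MM j = m j.
    by move=> ne; rewrite mnmBE mulmnE mnm1E eq_sym (negPf ne) mul0n subn0.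
  have -> : [forall j, (j \notin i :: r) ==> (m j == 0%N)] =
            [forall j, (j \notin r) ==> ((m - a)%MM j == 0%N)].
    apply/eq_forallb => j; rewrite inE; have [->|ne] := eqVneq j i.
      by rewrite i_r /= mnmBE ai subnn.
    by rewrite mE.
  case: ifP => _; last by rewrite mulr0.
  congr (_ * _); rewrite [LHS]big_seq [RHS]big_seq; apply: eq_bigr => j j_r.
  by rewrite mE //; apply: contraNneq i_r => <-.
rewrite H ?index_enum_uniq //; case: ifP => // /negP[].
by apply/forallP => i; rewrite mem_index_enum.
Qed.
End Univariate.

Section DeltaCoef.
Variables (L : comNzRingType) (chi : nat -> L).

Lemma lift_comp n m c (f : mseries n L) :
  lift_series m (mser_comp c f) =
  mser_comp (fun k => (c k)%:MP) (lift_series m f).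
Proof.
apply: mseriesP => d; rewrite mcoef_map !mcoef_comp rmorph_sum.
apply: eq_bigr => k _; rewrite rmorphM.
have -> // : lift_series m f ^+ k = lift_series m (f ^+ k).
by rewrite /lift_series rmorphXn.
Qed.

Lemma lift_X n m (i : 'I_n) : lift_series m (mserX L i) = mserX {mpoly L[m]} i.
Proof. by apply: mseriesP => d; rewrite mcoef_map !mcoefX rmorph_nat. Qed.

Lemma Delta_msubstX n m (i : 'I_n) :
  Delta chi m (mserX L i) =
  msubst (fun=> mserX _ i) (Delta chi m (var_t L)).
Proof.
rewrite /Delta rmorph_prod; apply: eq_bigr => j _.
set s := fun=> _; have sx : msubst s (lift_series m (var_t L)) = mserX _ i.
  by rewrite /var_t lift_X msubstX ?mserX0.
have t0 : lift_series m (var_t L) 0%MM = 0 by rewrite /var_t lift_X mserX0.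
rewrite [RHS]msubstM msubst1B msubstM msubstC [X in _ = _ * X]msubst_comp;
  last first.
  by rewrite mcoefMC t0 mul0r.
rewrite msubstM msubstC sx !lift_comp lift_X; congr ((1 - _ * _) * _).
by rewrite (msubst_comp s _ t0) sx.
Qed.

Definition Delta_coef m k : {mpoly L[m]} := Delta chi m (var_t L) (mon1 k).

Lemma mcoef_prod_Delta n m (a : 'X_{1..n}) :
  (\prod_(i < n) Delta chi m (mserX L i)) a = \prod_i Delta_coef m (a i).
Proof.
rewrite (eq_bigr _ (fun i _ => Delta_msubstX m i)).
by rewrite (@mcoef_prod_msubstX _ _ (fun=> _)).
Qed.

End DeltaCoef.

Section SymfunEval.
Variable R : comNzRingType.
Implicit Types f g : symfun R.

Lemma symfunP f g : (forall m, f m = g m) -> f = g.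
Proof. by move=> E; apply: val_inj; apply: mpfamilyP. Qed.

Definition symfun_ev m f : {mpoly R[m]} := f m.

Fact symfun_ev_is_zmod m : zmod_morphism (symfun_ev m).
Proof. by []. Qed.
Fact symfun_ev_is_monoid m : monoid_morphism (symfun_ev m).
Proof. by []. Qed.
HB.instance Definition _ m := GRing.isZmodMorphism.Build _ _ (symfun_ev m)
  (symfun_ev_is_zmod m).
HB.instance Definition _ m := GRing.isMonoidMorphism.Build _ _ (symfun_ev m)
  (symfun_ev_is_monoid m).

Lemma symfun_evZ m c f : symfun_ev m (c *: f) = c *: symfun_ev m f.
Proof. by []. Qed.
Lemma symfun_evE m f : f m = symfun_ev m f. Proof. by []. Qed.
End SymfunEval.
Arguments symfun_ev : simpl never.

Definition spart_weight (l : strict_partition) := weight (exps (size (val l))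
  (val l)).

Lemma weight_exps_spart n (l : strict_partition) : (size (val l) <= n)%N ->
  weight (exps n (val l)) = spart_weight l.
Proof. by move=> le_n; rewrite /spart_weight !weight_exps. Qed.

Lemma spart_weight_bound (l : strict_partition) :
  (size (val l) <= spart_weight l)%N /\ (forall x, x \in val l -> (x <=
    spart_weight l)%N).
Proof.
have Eq : spart_weight l = (\sum_(i < size (val l)) i.+1 * nth 0%N (val l) i)%N.
  by apply: eq_bigr => i _; rewrite mnmE.
rewrite Eq; split=> [|x /(nthP 0%N)[i lt_i <-]].
  rewrite -[X in (X <= _)%N]card_ord -sum1_card leq_sum // => i _.
  by rewrite muln_gt0 /= (nth_strict_gt0 (valP l)).
rewrite (bigD1 (Ordinal lt_i)) //= (leq_trans _ (leq_addr _ _)) //.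
by rewrite leq_pmull.
Qed.

(** Only a finite superset of the partitions of weight at most N is needed: the others carry zero
    coefficients in the expansions below. *)
Definition spart_enum N : seq strict_partition :=
  undup (pmap insub (flatten [seq [seq map val (val t) | t : k.-tuple 'I_N.+1]
                           | k <- iota 0 N.+1])).

Lemma mem_spart_enum N (l : strict_partition) : (spart_weight l <= N)%N -> l
  \in spart_enum N.
Proof.
move=> le_N; have [sz le] := spart_weight_bound l.
rewrite mem_undup mem_pmap; apply/mapP; exists (val l); last by rewrite valK.
apply/flatten_mapP; exists (size (val l)).
  by rewrite mem_iota /= add0n ltnS (leq_trans sz).
pose t := [tuple of map (@inord N) (in_tuple (val l))].
apply/imageP; exists t => //=; rewrite -map_comp -[LHS]map_id.
apply/eq_in_map => x x_l /=; rewrite inordK // ltnS (leq_trans (le x x_l)) //.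
Qed.

Section CauchyCoef.
Variables (L : comNzRingType) (chi : nat -> L).
Variables (S : strict_partition -> forall n, mseries n L).
Variables (s : strict_partition -> symfun L).
Hypothesis hS : Cauchy_identity chi S s.
Variable q : nat -> symfun L.
Hypothesis hq : forall m k, q k m = Delta_coef chi m k.

(** The finite set beyond which the Cauchy sum is stationary depends on the number m of variables y.
    The vanishing hypothesis replaces it by a list independent of m, which gives an identity between
    symmetric functions. *)
Lemma Cauchy_coef N n (a : 'X_{1..n}) :
    (forall l, (N < spart_weight l)%N -> S l n a = 0) ->
  \prod_i q (a i) = \sum_(l <- spart_enum N) S l n a *: s l.
Proof.
move=> S0; apply: symfunP => m; rewrite !symfun_evE rmorph_prod rmorph_sum /=.
have Hnm := hS; rewrite /Cauchy_identity in Hnm.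
have [A HA] := Hnm n m a.
have := HA (undup (A ++ spart_enum N)) (undup_uniq _).
rewrite mcoef_prod_Delta (eq_bigr (fun i => Delta_coef chi m (a i))) => [<-|i
  _]; last first.
  by rewrite -hq.
  by move=> i iA; rewrite mem_undup mem_cat iA.
set B := undup _.
have E l : (lift_series m (S l n) * mserC n (s l m)) a = symfun_ev m (S l n a
  *: s l).
  by rewrite mcoefMC mcoef_map symfun_evZ mul_mpolyC.
rewrite (eq_bigr (fun l => symfun_ev m (S l n a *: s l)) (fun l _ => E l)).
rewrite (bigID (mem (spart_enum N))) /= [X in _ + X]big1 ?addr0 => [|l nl];
  last first.
  rewrite S0 ?scale0r ?raddf0 // ltnNge; apply: contra nl;
    exact: mem_spart_enum.
rewrite -big_filter; apply: perm_big; apply: uniq_perm.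
- by rewrite filter_uniq ?undup_uniq.
- exact: undup_uniq.
by move=> l; rewrite mem_filter [l \in B]mem_undup mem_cat orbC;
  case: (l \in spart_enum N).
Qed.
End CauchyCoef.

Section Triangular.
Variables (L : comNzRingType).
Variables (S : strict_partition -> forall n, mseries n L) (kappa : nat -> L).
Hypothesis S_big : forall (l : strict_partition) n, (n < size (val l))%N -> S l
  n = 0.
Hypothesis S_lead : forall (l : strict_partition) n, (size (val l) <= n)%N ->
  lead (S l n) (exps n (val l)) (kappa (size (val l))).

Lemma expansion_small l n a : (weight a < spart_weight l)%N -> S l n a = 0.
Proof.
move=> lt_a; have [/S_big-> //|le_n] := ltnP n (size (val l)).
by apply: (lead_ordw (S_lead le_n)); rewrite weight_exps_spart.
Qed.

(** In as many variables as l has parts, a longer l' gives the zero series. Otherwise the leading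
    monomial of S_l' differs from x^l, whose exponents are all positive, and does not have smaller
    weight. *)
Lemma expansion_exps (l l' : strict_partition) : l' != l -> (spart_weight l <=
  spart_weight l')%N ->
  S l' (size (val l)) (exps _ (val l)) = 0.
Proof.
move=> ne le_l; have [/S_big-> //|le_n] := ltnP (size (val l)) (size (val l')).
case: (S_lead le_n) => _; apply; last by rewrite !weight_exps_spart.
apply: contra_neq ne => E; apply/val_inj.
have E' i : nth 0%N (val l') i = nth 0%N (val l) i.
  have [lt_i|le_i] := ltnP i (size (val l)).
    have := congr1 (fun m : 'X_{1..size (val l)} => m (Ordinal lt_i)) E.
    by rewrite !mnmE.
  by rewrite !nth_default // (leq_trans le_n).
apply: (@eq_from_nth _ 0%N) => // .
apply/eqP; rewrite eqn_leq le_n leqNgt; apply/negP => lt_l.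
have := nth_strict_gt0 (valP l) lt_l.
by rewrite -E' nth_default.
Qed.
End Triangular.

(** * Reduction modulo 2 *)

Section Even.
Variable R : comNzRingType.
Implicit Types a b : R.

Definition even a := exists b, a = b *+ 2.

Lemma even0 : even 0. Proof. by exists 0; rewrite mul0rn. Qed.
Lemma evenD a b : even a -> even b -> even (a + b).
Proof. by move=> [x ->] [y ->]; exists (x + y); rewrite mulrnDl. Qed.
Lemma evenN a : even a -> even (- a).
Proof. by move=> [x ->]; exists (- x); rewrite mulNrn. Qed.
Lemma evenMl a b : even a -> even (a * b).
Proof. by move=> [x ->]; exists (x * b); rewrite mulrnAl. Qed.
Lemma evenMr a b : even b -> even (a * b).
Proof. by rewrite mulrC; apply: evenMl. Qed.
Lemma even_sum I (r : seq I) (P : pred I) (f : I -> R) :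
  (forall i, P i -> even (f i)) -> even (\sum_(i <- r | P i) f i).
Proof. by move=> H; elim/big_ind: _ => //; [apply: even0 | apply: evenD]. Qed.

Variable m : nat.
Implicit Types f g : {mpoly R[m]}.

(** The degree of f modulo 2 is less than d, without forming the quotient ring. *)
Definition ltdeg2 d f := forall v, (d <= mdeg v)%N -> even f@_v.

Lemma ltdeg2W d e f : (d <= e)%N -> ltdeg2 d f -> ltdeg2 e f.
Proof. by move=> le H v le_v; apply: H; apply: leq_trans le_v. Qed.
Lemma ltdeg20 d : ltdeg2 d 0.
Proof. by move=> v _; rewrite mcoeff0; apply: even0. Qed.
Lemma ltdeg2D d f g : ltdeg2 d f -> ltdeg2 d g -> ltdeg2 d (f + g).
Proof. by move=> Hf Hg v le; rewrite mcoeffD; apply: evenD;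
  [apply: Hf|apply: Hg]. Qed.
Lemma ltdeg2_sum d I (r : seq I) (P : pred I) (f : I -> {mpoly R[m]}) :
  (forall i, P i -> ltdeg2 d (f i)) -> ltdeg2 d (\sum_(i <- r | P i) f i).
Proof. by move=> H; elim/big_ind: _ => //;
  [apply: ltdeg20 | apply: ltdeg2D]. Qed.

Lemma ltdeg2M d e f g : ltdeg2 d f -> ltdeg2 e.+1 g -> ltdeg2 (d + e) (f * g).
Proof.
move=> Hf Hg v le_v; rewrite (mcoeff_poly_mul _ _ (ltnSn (mdeg v))).
apply: even_sum => -[[a la] [b lb]] /= /eqP Ev.
have [le_a|lt_a] := leqP d (mdeg a); first by apply/evenMl/Hf.
by apply/evenMr/Hg; move: le_v; rewrite Ev mdegD; lia.
Qed.

Lemma ltdeg2X (j : 'I_m) k : ltdeg2 k.+1 ('X_j ^+ k).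
Proof.
move=> v lt_v; rewrite mpolyXn mcoeffX; case: eqP => [Ev|_]; last exact: even0.
by move: lt_v; rewrite -Ev mdegMn mdeg1 mul1n ltnn.
Qed.

Lemma ltdeg2C c : ltdeg2 1 c%:MP.
Proof.
by move=> v; rewrite lt0n mdeg_eq0 mcoeffC => /negPf; rewrite eq_sym => ->;
  rewrite mulr0; apply: even0.
Qed.

Lemma ltdeg2_mul2 f d : ltdeg2 d (f *+ 2).
Proof. by move=> v _; rewrite mcoeffMn; exists f@_v. Qed.

Lemma mcoefM_ltdeg2 (f g : mseries 1 {mpoly R[m]}) d k :
    (forall a b : nat, (a + b)%N = k -> ltdeg2 d (f (mon1 a) * g (mon1 b))) ->
  ltdeg2 d ((f * g) (mon1 k)).
Proof.
move=> H; rewrite mcoefM; apply: ltdeg2_sum => -[[a la] [b lb]] /= /eqP E.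
rewrite [a]mnm_ord1 [b]mnm_ord1; apply: H.
by rewrite -mdegD -E mdegMn mdeg1 mul1n.
Qed.
End Even.

(** * The series [2](t) = t +_F t and phat modulo 2 *)

Section Formal.
Variables (L : comNzRingType) (F : fgl L).

Lemma msubst_fgl k n (T : 'I_k -> mseries n L) (f g : mseries k L) :
  f 0%MM = 0 -> g 0%MM = 0 ->
  msubst T (fgl_subst F f g) = fgl_subst F (msubst T f) (msubst T g).
Proof.
move=> f0 g0; have p0 i : pair_fun f g i 0%MM = 0 by rewrite /pair_fun;
  case: ifP.
rewrite !fgl_substE ?msubst_const // msubst_msubst //; apply: eq_msubst => i.
by rewrite /pair_fun; case: ifP.
Qed.

Lemma fgl_subst_assoc n (f g h : mseries n L) :
    f 0%MM = 0 -> g 0%MM = 0 -> h 0%MM = 0 ->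
  fgl_subst F (fgl_subst F f g) h = fgl_subst F f (fgl_subst F g h).
Proof.
move=> f0 g0 h0.
have F0 k (a b : mseries k L) : fgl_subst F a b 0%MM = 0 by rewrite fgl_subst0
  fgl_u0.
pose T (i : 'I_3) := if val i == 0%N then f else if val i == 1%N then g else h.
have T0 i : T i 0%MM = 0 by rewrite /T; case: ifP => // _; case: ifP.
pose X i : mseries 3 L := mserX L (inord i).
have X0 i : X i 0%MM = 0 by apply: mserX0.
have E : fgl_subst F (fgl_subst F (X 0%N) (X 1%N)) (X 2%N) =
    fgl_subst F (X 0%N) (fgl_subst F (X 1%N) (X 2%N)) := fgl_assoc F.
have TX i : msubst T (X i) = T (inord i) by apply: msubstX.
have := congr1 (msubst T) E.
rewrite (msubst_fgl T (F0 _ _ _) (X0 2%N)) (msubst_fgl T (X0 0%N) (X0 1%N)).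
rewrite (msubst_fgl T (X0 0%N) (F0 _ _ _)) (msubst_fgl T (X0 1%N) (X0 2%N)).
rewrite (TX 0%N) (TX 1%N) (TX 2%N).
by rewrite /T /= !inordK.
Qed.

Lemma fgl_subst_u0 n (f : mseries n L) : f 0%MM = 0 -> fgl_subst F f 0 = f.
Proof.
move=> f0; apply: mseriesP => m.
by rewrite [LHS](@fgl_ordw _ _ _ _ _ 0 (weight m).+1) // addr0.
Qed.

(** F(u, v) - v is divisible by u, and the quotient has constant term a_10 = 1. *)
Lemma fgl_factor n (f g : mseries n L) : f 0%MM = 0 -> g 0%MM = 0 ->
  exists2 u : mseries n L, u 0%MM = 1 & fgl_subst F f g = g + f * u.
Proof.
move=> f0 g0; pose G := biseries (fun i j => F i.+1 j).
exists (msubst (pair_fun f g) G).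
  by rewrite msubst_const /G /mscoef /= !mnm0E fgl_u0.
have E : biseries F = mserX L ord_max + mserX L ord0 * G.
  apply: mseriesP => m; rewrite mcoefD mulrC -[mserX L ord0]expr1 mserX_mmon
    mulm1n.
  rewrite mcoefM_mmon mcoefX.
  have -> : biseries F m = F (m ord0) (m ord_max) by [].
  have -> : (U_(ord0) <= m)%MM = (0 < m ord0)%N.
    apply/mnm_lepP/idP => [/(_ ord0)|m0 i]; first by rewrite mnm1E eqxx.
    by rewrite mnm1E; case: eqP => [<-|].
  case: posnP => [m0|m0].
    rewrite m0 fgl_0v addr0; congr ((_ : bool)%:R); apply/eqP/eqP => [m1|->].
      by rewrite [m]mnm_ord2 m0 m1 mulm0n add0m mulm1n.
    by rewrite mnm1E eqxx.
  have -> : (m == U_(ord_max)%MM) = false.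
    by apply: contraTF m0 => /eqP->; rewrite mnm1E.
  rewrite add0r; have -> : G (m - U_(ord0))%MM =
    F ((m - U_(ord0))%MM ord0).+1 ((m - U_(ord0))%MM ord_max) by [].
  by rewrite !mnmBE !mnm1E /= subn0 subn1 prednK.
by rewrite fgl_substE // E rmorphD rmorphM /= !msubstX //.
Qed.

Variable chi : nat -> L.
Hypothesis hchi : is_formal_inverse F chi.
Local Notation t := (var_t L).

(** As [2](t) +_F \bar t = t, this is [fgl_factor] for the pair [2](t), \bar t. *)
Lemma double_factor : exists2 u : mseries 1 L, u 0%MM = 1 &
  t - mser_comp chi t = fgl_add F t t * u.
Proof.
have t0 : t 0%MM = 0 by rewrite mserX0.
have tb0 : mser_comp chi t 0%MM = 0 by rewrite mser_comp0 (formal_inverse0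
  hchi).
have tt0 : fgl_subst F t t 0%MM = 0 by rewrite fgl_subst0 fgl_u0.
have [u u0 E] := fgl_factor tt0 tb0.
exists u => //; rewrite /fgl_add; apply/eqP; rewrite subr_eq addrC -E;
  apply/eqP.
rewrite fgl_subst_assoc //; have [_ H] := hchi.
by rewrite [X in fgl_subst F t X](H : fgl_subst F t (mser_comp chi t) = 0)
  fgl_subst_u0.
Qed.
End Formal.

(** Allows the cancellation of [2](t), whose leading coefficient 2 is regular but not assumed
    invertible. *)
Lemma lead_regular n (R : comNzRingType) (f g : mseries n R) m c :
  (forall x : R, c * x = 0 -> x = 0) -> lead f m c -> f * g = 0 -> g = 0.
Proof.
move=> c_reg [fm f0] fg; apply: mseriesP => k.
have [d] := ubnP (weight k); elim: d k => // d IHd k lt_k.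
apply: c_reg; have := congr1 (fun h => mscoef h (m + k)%MM) fg.
rewrite /= (@mcoefM_D1 _ _ _ _ m k) ?fm // => a b E ne.
have [le_a|lt_a] := leqP (weight a) (weight m); first by rewrite f0 // mul0r.
rewrite IHd ?mulr0 //; have := congr1 (@weight n) E; rewrite !weightD; lia.
Qed.

Lemma mon1_eq a b : (mon1 a == mon1 b) = (a == b).
Proof.
apply/eqP/eqP => [/(congr1 mdeg)|->] //.
by rewrite !mdegMn mdeg1 !mul1n.
Qed.

Section PhatModTwo.
Variables (L : comNzRingType) (F : fgl L) (chi : nat -> L).
Hypothesis hchi : is_formal_inverse F chi.
Hypothesis two_reg : forall c : L, c *+ 2 = 0 -> c = 0.
Variable phat_ : nat -> symfun L.
Hypothesis hphat_ : is_phat F chi phat_.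
Variable m : nat.

Local Notation R := {mpoly L[m]}.
Local Notation t := (var_t L).
Local Notation lift := (@lift_series L 1 m).

HB.instance Definition _ := GRing.RMorphism.copy (@lift_series L 1 m)
  (@mser_map 1 L R (@mpolyC m L)).

Let T2 := lift (fgl_add F t t).

Let T2_0 : T2 (mon1 0) = 0.
Proof. by rewrite mcoef_map mulm0n /fgl_add fgl_subst0 fgl_u0 mpolyC0. Qed.

Let T2_1 : T2 (mon1 1) = 2%:R.
Proof.
have [E _] := lead_double F (ord0 : 'I_1).
by rewrite mcoef_map mulm1n E -mpolyC_nat.
Qed.

Let mon1_lift f a : ltdeg2 1 (lift f (mon1 a)).
Proof. by rewrite mcoef_map; apply: ltdeg2C. Qed.

Let geom (y : R) := mser_geom (lift t * mserC 1 y).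

Let geomE y k : geom y (mon1 k) = y ^+ k.
Proof.
have CX i : mserC 1 y ^+ i = mserC 1 (y ^+ i) by rewrite rmorphXn.
rewrite /geom /mser_geom mcoef_comp mdegMn mdeg1 mul1n.
rewrite (bigD1 ord_max) //= big1 => [|i ne].
  rewrite mul1r addr0 exprMn CX mcoefMC /var_t lift_X mserX_mmon mcoef_mmon
    eqxx.
  by rewrite mul1r.
rewrite mul1r exprMn CX mcoefMC /var_t lift_X mserX_mmon mcoef_mmon mon1_eq.
by rewrite eq_sym -[_ == k]/(i == ord_max) (negPf ne) mul0r.
Qed.

(** Write (1 - \bar t y) / (1 - t y) as 1 + (t - \bar t) y / (1 - t y) and apply [double_factor];
    the unit u there only adds terms of lower degree in y. *)
Lemma Delta_factor (j : 'I_m) : exists2 z : mseries 1 R,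
  (1 - lift (mser_comp chi t) * mserC 1 'X_j) * geom 'X_j = 1 + T2 * z &
  forall b, ltdeg2 b.+1 (z (mon1 b) - 'X_j ^+ b.+1).
Proof.
have [u u0 E] := double_factor hchi.
exists (lift u * (mserC 1 'X_j * geom 'X_j)).
  have gE : (1 - lift t * mserC 1 'X_j) * geom 'X_j = 1.
    by apply: mser_geomP; rewrite mcoefMC mcoef_map mserX0 mpolyC0 mul0r.
  rewrite mulrA /T2 -rmorphM -E rmorphB /= -[X in _ = X + _]gE mulrA -mulrDl.
  by congr (_ * _); rewrite mulrBl addrA subrK.
move=> b; have -> : u = 1 + (u - 1) by rewrite addrC subrK.
rewrite rmorphD rmorph1 mulrDl mul1r mcoefD mcoefCM geomE -exprS addrAC subrr
  add0r.
apply: mcoefM_ltdeg2 => a c Eac; rewrite mcoefCM geomE -exprS.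
case: a Eac => [|a] Eac.
  rewrite mulm0n mcoef_map mcoefD mcoefN u0 mcoef1 eqxx subrr mpolyC0 mul0r.
  exact: ltdeg20.
apply: (@ltdeg2W _ _ (1 + c.+1)); first by rewrite -Eac; lia.
by apply: ltdeg2M; [exact: mon1_lift | exact: ltdeg2X].
Qed.

(** In (1 + T2 z)(1 + T2 H) the cross term T2 z H is negligible. The linear coefficient of T2 is 2;
    and modulo 2 the coefficient of t^c in z H has degree at most c + 2 in y, so a shift by t^2 or
    more leaves degree at most b at t^b. *)
Lemma Delta_expand : exists2 H : mseries 1 R, Delta chi m t = 1 + T2 * H &
  forall b, ltdeg2 b.+1 (H (mon1 b) - \sum_j 'X_j ^+ b.+1).
Proof.
rewrite /Delta; elim: (index_enum _) => [|j r [H EH degH]].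
  exists 0; first by rewrite big_nil mulr0 addr0.
  by move=> b; rewrite big_nil mcoef0 subr0; apply: ltdeg20.
have [z Ez degz] := Delta_factor j.
have up (h : mseries 1 R) (p : nat -> R) : (forall b, ltdeg2 b.+1 (h (mon1 b) -
  p b)) ->
    (forall b, ltdeg2 b.+2 (p b)) -> forall b, ltdeg2 b.+2 (h (mon1 b)).
  move=> H1 H2 b; rewrite -[h (mon1 b)](subrK (p b)); apply: ltdeg2D;
    last exact: H2.
  exact: ltdeg2W (H1 b).
have degz' : forall b, ltdeg2 b.+2 (z (mon1 b)).
  by apply: up degz _ => b; apply: ltdeg2X.
have degH' : forall b, ltdeg2 b.+2 (H (mon1 b)).
  by apply: up degH _ => b; apply: ltdeg2_sum => i _; apply: ltdeg2X.
have degzH b : ltdeg2 b.+3 ((z * H) (mon1 b)).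
  apply: mcoefM_ltdeg2 => c d Ecd; apply: (@ltdeg2W _ _ (c.+2 + d.+1)).
    by rewrite -Ecd; lia.
  by apply: ltdeg2M.
exists (z + H + T2 * (z * H)).
  rewrite big_cons EH; move: Ez; rewrite /geom => ->.
  by ring.
move=> b; rewrite big_cons !mcoefD.
have -> : z (mon1 b) + H (mon1 b) + (T2 * (z * H)) (mon1 b)
    - ('X_j ^+ b.+1 + \sum_(i <- r) 'X_i ^+ b.+1) =
  (z (mon1 b) - 'X_j ^+ b.+1) + (H (mon1 b) - \sum_(i <- r) 'X_i ^+ b.+1) +
  (T2 * (z * H)) (mon1 b) by rewrite opprD addrAC; congr (_ + _);
    rewrite addrACA.
apply: ltdeg2D; first exact: ltdeg2D.
apply: mcoefM_ltdeg2 => -[|[|a]] c Eac.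
- by rewrite T2_0 mul0r; apply: ltdeg20.
- by rewrite T2_1 mulr_natl; apply: ltdeg2_mul2.
apply: (@ltdeg2W _ _ (1 + c.+2)); first by rewrite -Eac; lia.
by apply: ltdeg2M; [exact: mon1_lift | exact: degzH].
Qed.

Lemma phat_mod_two k : ltdeg2 k.+1 (phat_ k.+1 m - \sum_j 'X_j ^+ k.+1).
Proof.
have [H EH degH] := Delta_expand.
have E : 1 + T2 * H = 1 + T2 * mser_comp (fun k => phat_ k.+1 m) (lift t).
  by rewrite -EH hphat_.
have {E}EH2 : T2 * (H - mser_comp (fun k => phat_ k.+1 m) (lift t)) = 0.
  by rewrite mulrBr (addrI _ E) subrr.
have reg2 (x : R) : 2%:R * x = 0 -> x = 0.
  rewrite mulr_natl => x2; apply/mpolyP => v; rewrite mcoeff0; apply: two_reg.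
  by rewrite -mcoeffMn x2 mcoeff0.
have leadT : lead T2 U_(ord0)%MM 2%:R.
  have [_ l0] := lead_double F (ord0 : 'I_1).
  split=> [|m' ne le]; first by have := T2_1; rewrite mulm1n.
  by rewrite mcoef_map l0 // mpolyC0.
have /eqP := lead_regular reg2 leadT EH2; rewrite subr_eq0 => /eqP HE.
have := degH k; rewrite {1}HE /var_t lift_X mser_comp_X.
by rewrite mulmnE mnm1E eqxx mul1n eqxx.
Qed.
End PhatModTwo.

(** * Coefficients of products of power sums *)

Section PowerSums.
Variable R : comNzRingType.

Definition psum_prod m (mu : seq nat) : {mpoly R[m]} :=
  \prod_(k <- mu) \sum_(j < m) 'X_j ^+ k.

(** The coefficient counts the distributions of the parts of mu over the variables with prescribed
    sums. *)
Lemma mcoeff_psum_prod m mu v : (psum_prod m mu)@_v =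
  \sum_(f : {ffun 'I_(size mu) -> 'I_m})
     ((\sum_i U_(f i) *+ nth 0%N mu i)%MM == v)%:R.
Proof.
rewrite /psum_prod (big_nth 0%N) big_mkord bigA_distr_bigA raddf_sum.
apply: eq_bigr => f _ /=; rewrite -mcoeffX; congr (_@__).
rewrite (big_morph (fun a => 'X_[a] : {mpoly R[m]}) (id1 := 1) (op1 := *%R)) //.
- by apply: eq_bigr => i _; rewrite mpolyXn.
- by move=> a b; rewrite mpolyXD.
- exact: mpolyX0.
Qed.

Lemma strict_uniq (l : strict_partition) : uniq (val l).
Proof.
have /andP[srt _] := valP l; apply: sorted_uniq srt.
  by move=> a b c; rewrite /gtn /= => H1 H2; apply: ltn_trans H2 H1.
by move=> a; rewrite /gtn /= ltnn.
Qed.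

Lemma strict_eq (l l' : strict_partition) : val l =i val l' -> l = l'.
Proof.
move=> E; apply/val_inj.
have /andP[s1 _] := valP l; have /andP[s2 _] := valP l'.
apply: (sorted_eq _ _ s1 s2).
- by move=> a b c; rewrite /gtn /= => H1 H2; apply: ltn_trans H2 H1.
- by move=> a b /andP[]; rewrite /gtn /= => H1 H2; have := ltn_trans H1 H2;
  rewrite ltnn.
by apply: uniq_perm; rewrite ?strict_uniq.
Qed.

Variables mu nu : strict_partition.
Let m := size (val nu).

Let fiber (f : {ffun 'I_(size (val mu)) -> 'I_m}) j :
  (\sum_i U_(f i) *+ nth 0%N (val mu) i)%MM j =
  (\sum_(i | f i == j) nth 0%N (val mu) i)%N.
Proof.
rewrite mnm_sumE [RHS]big_mkcond; apply: eq_bigr => i _.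
by rewrite mulmnE mnm1E; case: eqP => _; rewrite ?mul1n.
Qed.

Let fiber_surj (f : {ffun 'I_(size (val mu)) -> 'I_m}) j :
  (\sum_i U_(f i) *+ nth 0%N (val mu) i)%MM = exps m (val nu) ->
  exists i, f i = j.
Proof.
move=> E; have [/existsP[i /eqP fi]|] := boolP [exists i, f i == j].
  by exists i.
rewrite negb_exists => /forallP nf; exfalso.
have := fiber f j; rewrite E mnmE big_pred0 => [E0|i]; last first.
  by apply/negP => /eqP fi; have := nf i; rewrite fi eqxx.
by have := nth_strict_gt0 (valP nu) (ltn_ord j); rewrite E0.
Qed.

Lemma psum_prod_small : (size (val mu) < m)%N ->
  (psum_prod m (val mu))@_(exps m (val nu)) = 0.
Proof.
move=> lt_m; rewrite mcoeff_psum_prod big1 // => f _; case: eqP => // E.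
have := leq_image_card f predT; rewrite card_ord.
have -> : #|image f predT| = m.
  rewrite -[RHS]card_ord; apply: eq_card => j; rewrite !inE.
  by have [i <-] := fiber_surj j E; apply/imageP; exists i.
by rewrite leqNgt lt_m.
Qed.

Let fiber_inj (f : {ffun 'I_(size (val mu)) -> 'I_m}) : size (val mu) = m ->
    (\sum_i U_(f i) *+ nth 0%N (val mu) i)%MM = exps m (val nu) ->
  forall i, nth 0%N (val nu) (f i) = nth 0%N (val mu) i.
Proof.
move=> Em E i; have inj_f : injective f.
  apply/injectiveP/card_uniqP; rewrite size_codom card_ord.
  apply: etrans (esym Em); apply: etrans (card_ord m); apply: eq_card => j.
  rewrite [RHS]inE.
  by have [i' <-] := fiber_surj j E; apply/codomP; exists i'.
have := fiber f (f i); rewrite E mnmE => ->.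
by rewrite (big_pred1 i) // => i'; rewrite (inj_eq inj_f).
Qed.

Lemma psum_prod_eq : size (val mu) = m -> mu != nu ->
  (psum_prod m (val mu))@_(exps m (val nu)) = 0.
Proof.
move=> Em /eqP ne; rewrite mcoeff_psum_prod big1 // => f _; case: eqP => // E.
case: ne; apply: strict_eq.
have nuE := fiber_inj Em E.
have sub : {subset val mu <= val nu}.
  move=> x /(nthP 0%N)[i lt_i <-]; rewrite -[i]/(val (Ordinal lt_i)) -nuE.
  by rewrite mem_nth ?ltn_ord.
have [] := uniq_min_size (strict_uniq mu) sub; first by rewrite Em.
by [].
Qed.

(** The parts being distinct, only the identity distribution counts. Repeated parts would produce
    factorials, possibly even; this is where strictness matters modulo 2. *)
Lemma psum_prod_diag : mu = nu ->
  (psum_prod m (val mu))@_(exps m (val nu)) = 1.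
Proof.
move=> Emn; have Em : size (val mu) = m by rewrite Emn.
have nthE i : nth 0%N (val nu) i = nth 0%N (val mu) i by rewrite Emn.
pose f0 : {ffun 'I_(size (val mu)) -> 'I_m} := [ffun i => cast_ord Em i].
rewrite mcoeff_psum_prod (bigD1 f0) //= [X in _ + X = _]big1 ?addr0 => [|f ne].
  have -> : (\sum_i U_(f0 i) *+ nth 0%N (val mu) i)%MM = exps m (val nu).
    apply/mnmP => j; rewrite fiber mnmE nthE.
    by rewrite (big_pred1 (cast_ord (esym Em) j)) // => i;
      rewrite ffunE /= -!val_eqE.
  by rewrite eqxx.
case: eqP => // E; case/eqP: ne; apply/ffunP => i; rewrite ffunE.
apply: val_inj => /=; apply/eqP.
have lt_i : (i < m)%N by rewrite -Em ltn_ord.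
rewrite -(nth_uniq 0%N (ltn_ord (f i)) lt_i (strict_uniq nu)).
by rewrite (fiber_inj Em E) nthE.
Qed.
End PowerSums.

(** * Products of phat: evenness of coefficients in relations modulo 2 *)

Section Saturation.
Variables (L : comNzRingType) (F : fgl L) (chi : nat -> L).
Hypothesis hchi : is_formal_inverse F chi.
Hypothesis two_reg : forall c : L, c *+ 2 = 0 -> c = 0.
Variable phat_ : nat -> symfun L.
Hypothesis hphat_ : is_phat F chi phat_.

Definition pprod (q : nat -> symfun L) (l : strict_partition) : symfun L :=
  \prod_(k <- val l) q k.

Lemma pprod_mod_two m (l : seq nat) : 0%N \notin l ->
  ltdeg2 (sumn l) (symfun_ev m (\prod_(k <- l) phat_ k) - psum_prod L m l) /\
  ltdeg2 (sumn l).+1 (psum_prod L m l).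
Proof.
elim: l => [_|k l IHl].
  rewrite /psum_prod !big_nil rmorph1 subrr; split; first exact: ltdeg20.
  by rewrite -mpolyC1; apply: ltdeg2C.
rewrite inE negb_or => /andP[k0 /IHl[H1 H2]].
rewrite /psum_prod !big_cons -/(psum_prod L m l) rmorphM /=.
case: k k0 => // k _; set f := symfun_ev m _; set g := symfun_ev m _;
  set p := \sum_(_ < _) _.
have H3 : ltdeg2 k.+1 (f - p) by apply: (phat_mod_two hchi two_reg hphat_).
have H4 : ltdeg2 k.+2 p by apply: ltdeg2_sum => j _; apply: ltdeg2X.
split; last by rewrite /= -[_.+1]addSn; apply: ltdeg2M.
rewrite (_ : f * g - p * psum_prod L m l =
  (f - p) * g + (g - psum_prod L m l) * p); last by ring.
apply: ltdeg2D; last by rewrite addnC; apply: ltdeg2M.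
apply: ltdeg2M => //; rewrite -[g](subrK (psum_prod L m l)).
by apply: ltdeg2D => //; apply: ltdeg2W H1.
Qed.

(* As size l <= sumn l, this orders by sumn, then by size. *)
Definition drank (l : strict_partition) := (sumn (val l) ^ 2 + size (val l))%N.

Lemma size_le_sumn (l : strict_partition) : (size (val l) <= sumn (val l))%N.
Proof.
have /andP[_] := valP l; elim: (val l) => //= k s IHs.
by rewrite inE negb_or => /andP[k0 /IHs]; lia.
Qed.

(** If mu has the smaller sum, its degree modulo 2 is too small; for equal sums, mu has at most as
    many parts as nu and its product of power sums has no such term. *)
Lemma pprod_coef (mu nu : strict_partition) : mu != nu -> (drank mu <= drank
  nu)%N ->
  even (symfun_ev (size (val nu)) (pprod phat_ mu))@_(exps _ (val nu)).
Proof.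
move=> ne le_d; have /andP[_ mu0] := valP mu.
have [H1 H2] := pprod_mod_two (size (val nu)) mu0.
have deg_nu : mdeg (exps (size (val nu)) (val nu)) = sumn (val nu).
  rewrite mdegE sumnE (big_nth 0%N) big_mkord; apply: eq_bigr => i _.
  by rewrite mnmE.
have le_s : (sumn (val mu) <= sumn (val nu))%N.
  have := size_le_sumn mu; have := size_le_sumn nu; move: le_d; rewrite /drank.
  by nia.
have H1' : even (symfun_ev (size (val nu)) (pprod phat_ mu) -
    psum_prod L (size (val nu)) (val mu))@_(exps _ (val nu)).
  by apply: H1; rewrite deg_nu.
rewrite -[symfun_ev _ _](subrK (psum_prod L (size (val nu)) (val mu))) mcoeffD.
apply: evenD => //; have [Es|ne_s] := eqVneq (sumn (val mu)) (sumn (val nu)).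
  have le_z : (size (val mu) <= size (val nu))%N by move: le_d;
    rewrite /drank Es; lia.
  move: le_z; rewrite leq_eqVlt => /predU1P[Ez|lt_z].
    by rewrite psum_prod_eq //; apply: even0.
  by rewrite psum_prod_small //; apply: even0.
by apply: H2; rewrite deg_nu ltn_neqAle ne_s.
Qed.

Lemma pprod_coef_diag (nu : strict_partition) :
  even ((symfun_ev (size (val nu)) (pprod phat_ nu))@_(exps _ (val nu)) - 1).
Proof.
have /andP[_ nu0] := valP nu.
have [H1 _] := pprod_mod_two (size (val nu)) nu0.
have deg_nu : mdeg (exps (size (val nu)) (val nu)) = sumn (val nu).
  rewrite mdegE sumnE (big_nth 0%N) big_mkord; apply: eq_bigr => i _.
  by rewrite mnmE.
rewrite -(psum_prod_diag L (erefl nu)) -mcoeffB.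
by apply: H1; rewrite deg_nu.
Qed.

(** Descending induction on [drank]. At the exponents of nu, other terms of at most its rank are
    even, those of larger rank have even coefficients already, and nu itself gives c_nu up to an
    even amount. General g yields saturation, g = 0 the halving of linear relations. *)
Lemma pprod_even (s : seq strict_partition) (c : strict_partition -> L)
    (g : symfun L) : uniq s ->
  \sum_(l <- s) c l *: pprod phat_ l = g *+ 2 -> forall l, l \in s -> even (c
    l).
Proof.
move=> u_s E.
have [B leB] : exists B, forall l, l \in s -> (drank l <= B)%N.
  exists (\sum_(l <- s) drank l)%N => l l_s; rewrite (big_rem l) //=.
  exact: leq_addr.
suff H d : forall l, l \in s -> (B - drank l < d)%N -> even (c l).
  by move=> l l_s; apply: (H (B - drank l).+1).
elim: d => // d IHd nu nu_s lt_d; set v := exps (size (val nu)) (val nu).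
have := congr1 (fun h : symfun L => (symfun_ev (size (val nu)) h)@_v) E.
have E2 : symfun_ev (size (val nu)) (g *+ 2) = symfun_ev (size (val nu)) g *+ 2
  by rewrite raddfMn.
rewrite /= E2 mcoeffMn raddf_sum raddf_sum (bigD1_seq nu) //= symfun_evZ
  mcoeffZ => Ev.
have ev_rest : even (\sum_(l <- s | l != nu) (symfun_ev (size (val nu)) (c l *:
  pprod phat_ l))@_v).
  rewrite big_seq_cond; apply: even_sum => l /andP[l_s ne].
  rewrite symfun_evZ mcoeffZ; have [le_d|lt_l] := leqP (drank l) (drank nu).
    by apply/evenMr/pprod_coef.
  apply/evenMl/IHd => //.
  by have := leB _ l_s; have := leB _ nu_s; lia.
have -> : c nu = (c nu * (symfun_ev (size (val nu)) (pprod phat_ nu))@_v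
    + \sum_(l <- s | l != nu) (symfun_ev (size (val nu)) (c l *: pprod phat_
      l))@_v)
  - \sum_(l <- s | l != nu) (symfun_ev (size (val nu)) (c l *: pprod phat_
    l))@_v
  - c nu * ((symfun_ev (size (val nu)) (pprod phat_ nu))@_v - 1) by ring.
rewrite Ev; apply: evenD; first apply: evenD.
- by exists (symfun_ev (size (val nu)) g)@_v.
- exact: evenN.
- by apply/evenN/evenMr/pprod_coef_diag.
Qed.
End Saturation.

(** * Triangular families *)

Section LSpan.
Variables (R : comNzRingType) (V : lmodType R).

(** An inductive span over the indices in A gives closure properties by induction; [lspan_uniq]
    recovers a sum over distinct indices. *)
Inductive lspan (I : Type) (A : I -> Prop) (v : I -> V) : V -> Prop :=
| Lspan0 : lspan A v 0
| LspanD c i f : A i -> lspan A v f -> lspan A v (c *: v i + f).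

Section Closure.
Variables (I : Type) (A : I -> Prop) (v : I -> V).

Lemma lspan_gen i : A i -> lspan A v (v i).
Proof. by move=> Ai; rewrite -[v i]scale1r -[_ *: _]addr0;
  do 2?constructor. Qed.

Lemma lspan_add f g : lspan A v f -> lspan A v g -> lspan A v (f + g).
Proof.
move=> + Sg; elim=> [|c i {}f Ai _ IHf]; first by rewrite add0r.
by rewrite -addrA; constructor.
Qed.

Lemma lspan_scale c f : lspan A v f -> lspan A v (c *: f).
Proof.
elim=> [|d i {}f Ai _ IHf]; first by rewrite scaler0; constructor.
by rewrite scalerDr scalerA; constructor.
Qed.

Lemma lspan_opp f : lspan A v f -> lspan A v (- f).
Proof. by rewrite -scaleN1r; apply: lspan_scale. Qed.

Lemma lspan_sub f g : lspan A v f -> lspan A v g -> lspan A v (f - g).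
Proof. by move=> Sf Sg; apply/lspan_add/lspan_opp. Qed.

Lemma lspan_sum J (r : seq J) (P : pred J) (F : J -> V) :
  (forall j, P j -> lspan A v (F j)) -> lspan A v (\sum_(j <- r | P j) F j).
Proof. by move=> H; elim/big_ind: _ => //;
  [constructor | apply: lspan_add]. Qed.

Lemma lspan_sum_seq (J : eqType) (r : seq J) (F : J -> V) :
  (forall j, j \in r -> lspan A v (F j)) -> lspan A v (\sum_(j <- r) F j).
Proof. by move=> H; rewrite big_seq; apply: lspan_sum. Qed.
End Closure.

Lemma lspan_trans (I J : Type) (A : I -> Prop) (B : J -> Prop) v w f :
  (forall i, A i -> lspan B w (v i)) -> lspan A v f -> lspan B w f.
Proof.
move=> H; elim=> [|c i g Ai _ IHg]; first by constructor.
by apply: lspan_add IHg; apply/lspan_scale/H.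
Qed.

Lemma lspanW (I : Type) (A B : I -> Prop) (v : I -> V) f :
  (forall i, A i -> B i) -> lspan A v f -> lspan B v f.
Proof. by move=> H; apply: lspan_trans => i Ai; apply/lspan_gen/H. Qed.

Section EqIndex.
Variable I : eqType.
Implicit Types (A : I -> Prop) (v w : I -> V).

Lemma lspan_uniq A v f : lspan A v f -> exists s c,
  [/\ uniq s, forall i, i \in s -> A i & f = \sum_(i <- s) c i *: v i].
Proof.
elim=> [|d i g Ai _ [s [c [u_s As ->]]]].
  by exists [::], (fun=> 0); rewrite big_nil.
have [i_s|i_s] := boolP (i \in s).
  exists s, (fun j => if j == i then d + c i else c j); split=> //.
  rewrite !(bigD1_seq i) //= eqxx scalerDl addrA; congr (_ + _).
  by apply: eq_bigr => j /negPf->.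
exists (i :: s), (fun j => if j == i then d else c j); split=> /=.
- by rewrite i_s.
- by move=> j; rewrite inE => /orP[/eqP->|j_s] //; apply: As.
rewrite big_cons eqxx; congr (_ + _); rewrite !big_seq; apply: eq_bigr => j j_s.
by case: eqP j_s i_s => // -> ->.
Qed.

Lemma lspan_lin_span v f : lspan (fun=> True) v f <-> lin_span v f.
Proof.
split=> [/lspan_uniq[s [c [_ _ E]]]|[s [c ->]]]; first by exists s, c.
by apply: lspan_sum => i _; apply/lspan_scale/lspan_gen.
Qed.

Lemma indep_coef v s s' c c' : lin_indep v -> uniq s -> uniq s' ->
    \sum_(i <- s) c i *: v i = \sum_(i <- s') c' i *: v i ->
  forall i, (if i \in s then c i else 0) = (if i \in s' then c' i else 0).
Proof.
move=> ind u_s u_s' E i; set d := fun i => if i \in s then c i else 0.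
set d' := fun i => if i \in s' then c' i else 0.
set B := undup (s ++ s').
have extend r e : uniq r -> {subset r <= B} ->
    \sum_(i <- B) (if i \in r then e i else 0) *: v i = \sum_(i <- r) e i *: v
      i.
  move=> u_r sub; rewrite (bigID (mem r)) /= [X in _ + X]big1 ?addr0 => [|j
    /negPf->];
    last by rewrite scale0r.
  rewrite -big_filter (perm_big r) /=.
    by rewrite !big_seq; apply: eq_bigr => j ->.
  apply: uniq_perm; rewrite ?filter_uniq ?undup_uniq // => j.
  by rewrite mem_filter; case: (boolP (j \in r)) => //= /sub.
have E' : \sum_(i <- B) (d i - d' i) *: v i = 0.
  under eq_bigr do rewrite scalerBl.
  rewrite big_split sumrN /= !extend ?E ?subrr // => j jr;
    by rewrite mem_undup mem_cat jr ?orbT.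
have [i_B|] := boolP (i \in B).
  by apply/eqP; rewrite -subr_eq0; apply/eqP/(ind _ _ (undup_uniq _) E').
by rewrite mem_undup mem_cat negb_or => /andP[/negPf-> /negPf->].
Qed.

Variable rk : I -> nat.
Local Notation below i := (fun j => (rk j < rk i)%N).

(** Coefficients of larger rank vanish by descending induction, so the sum of the c_j d_j v_j lies
    in the span of the v_k of rank below that of i, and c_i d_i = 0. Since [below] is strict, the
    matrix is diagonal within each rank and [rk] may have ties. *)
Lemma triangular_indep v w (d : I -> R) : lin_indep v ->
    (forall i x, x * d i = 0 -> x = 0) ->
    (forall i, lspan (below i) v (w i - d i *: v i)) ->
  lin_indep w.
Proof.
move=> ind d_reg vw s c u_s E.
have [B leB] : exists B, forall i, i \in s -> (rk i <= B)%N.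
  exists (\sum_(i <- s) rk i)%N => i i_s; rewrite (big_rem i) //=.
  exact: leq_addr.
suff H e : forall i, i \in s -> (B - rk i < e)%N -> c i = 0.
  by move=> i i_s; apply: (H (B - rk i).+1).
elim: e => // e IHe i i_s lt_e.
have Sd : lspan (below i) v (\sum_(j <- s) (c j * d j) *: v j).
  have -> : \sum_(j <- s) (c j * d j) *: v j =
      - \sum_(j <- s) c j *: (w j - d j *: v j).
    under [in RHS]eq_bigr do rewrite scalerBr scalerA.
    by rewrite big_split /= E add0r sumrN opprK.
  apply/lspan_opp/lspan_sum_seq => j j_s;
    have [le_j|lt_j] := leqP (rk j) (rk i).
    by apply/lspan_scale/(lspanW _ (vw j)) => k /leq_trans; apply.
  rewrite IHe ?scale0r //; first by constructor.
  by have := leB _ j_s; have := leB _ i_s; lia.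
have [s' [c' [u_s' lt_s' E']]] := lspan_uniq Sd.
have := indep_coef ind u_s u_s' E' i; rewrite i_s;
  case: ifP => [/lt_s'|_ /d_reg //].
by rewrite ltnn.
Qed.

(** The inverse of a unitriangular matrix is unitriangular, by induction on the rank. *)
Lemma triangular_swap v w :
    (forall i, lspan (below i) w (v i - w i)) ->
  forall i, lspan (below i) v (w i - v i).
Proof.
move=> vw i; have [n] := ubnP (rk i); elim: n i => // n IHn i lt_i.
rewrite -opprB; apply: lspan_opp; apply: lspan_trans (vw i) => j lt_j.
rewrite -[w j](subrK (v j)); apply: lspan_add; last exact: lspan_gen.
apply: lspanW (IHn j _) => [k /ltn_trans|]; first exact.
by apply: leq_trans lt_j _.
Qed.

Lemma triangular_span v w i :
  (forall i, lspan (below i) v (w i - v i)) -> lspan (fun=> True) v (w i).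
Proof.
move=> vw; rewrite -[w i](subrK (v i)); apply: lspan_add; last exact: lspan_gen.
exact: lspanW (vw i).
Qed.

End EqIndex.
End LSpan.

(** * Subalgebras as spans of products of generators *)

Section GenBy.
Variables (L : comNzRingType) (g : nat -> symfun L).

Definition gprod (s : seq nat) : symfun L := \prod_(k <- s) g k.

Lemma gen_by_gprod s : 0%N \notin s -> gen_by g (gprod s).
Proof.
move=> s0 S [S1 SZ SM] Sg; rewrite /gprod big_seq.
elim/big_ind: _ => // k k_s; apply: Sg; exists k => //.
by rewrite lt0n; apply: contraNneq s0 => <-.
Qed.

Lemma gen_by_lspan f : gen_by g f -> lspan (fun s => 0%N \notin s) gprod f.
Proof.
pose S : {pred symfun L} := fun f => `[< lspan (fun s => 0%N \notin s) gprod f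
  >].
move=> /(_ S) H; apply/asboolP; apply: H.
  split=> [|c f1 f2 /asboolP S1 /asboolP S2|f1 f2 /asboolP S1 /asboolP S2].
  - apply/asboolP; have -> : 1 = gprod [::] by rewrite /gprod big_nil.
    exact: lspan_gen.
  - by apply/asboolP; apply: lspan_add S2; apply: lspan_scale.
  - apply/asboolP; elim: S1 => [|c s h s0 _ IHh]; first by rewrite mul0r;
    constructor.
    rewrite mulrDl; apply: lspan_add IHh; rewrite -scalerAl; apply: lspan_scale.
    elim: S2 => [|d s' h' s0' _ IHh']; first by rewrite mulr0; constructor.
    rewrite mulrDr; apply: lspan_add IHh'; rewrite -scalerAr;
      apply: lspan_scale.
    rewrite /gprod -big_cat; apply: (lspan_gen gprod (i := s ++ s')).
    by rewrite mem_cat negb_or s0.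
move=> _ [k k_gt0 ->]; apply/asboolP.
have -> : g k = gprod [:: k] by rewrite /gprod big_seq1.
by apply: lspan_gen; rewrite inE eq_sym -lt0n.
Qed.

Lemma basis_of_gen_by (w : strict_partition -> symfun L) :
    lin_indep w ->
    (forall s, 0%N \notin s -> lspan (fun=> True) w (gprod s)) ->
    (forall l, lspan (fun=> True) (fun l : strict_partition => gprod (val l))
      (w l)) ->
  is_basis_of w (gen_by g).
Proof.
move=> ind Hg Hw; split=> // f; split=> [/gen_by_lspan Sf|/lspan_lin_span Sf].
  by apply/lspan_lin_span; apply: lspan_trans Sf.
move=> S [S1 SZ SM] Sg; have S0 : 0 \in S.
  by have := SZ (-1) 1 1 S1 S1; rewrite scaleN1r addNr.
have Sspan I (A : I -> Prop) (v : I -> symfun L) h :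
    (forall i, A i -> v i \in S) -> lspan A v h -> h \in S.
  by move=> Sv; elim=> // c i h' Ai _ Sh'; apply: SZ => //; apply: Sv.
apply: (Sspan _ _ _ _ _ Sf) => l _; apply: (Sspan _ _ _ _ _ (Hw l)) => l' _.
by apply: gen_by_gprod => //; have /andP[] := valP l'.
Qed.
End GenBy.

(** * The dual bases *)

Lemma mcoefM_mon1 (R : comNzRingType) (f g : mseries 1 R) k :
  (f * g) (mon1 k) = \sum_(a < k.+1) f (mon1 a) * g (mon1 (k - a)).
Proof.
pose f' : mseries 1 R := \sum_(a < k.+1) mserC 1 (f (mon1 a)) * mmon R (mon1 a).
have Ef : eqdeg k.+1 f f'.
  move=> m; rewrite [m]mnm_ord1; move: (mdeg m) => d;
    rewrite mdegMn mdeg1 mul1n => lt_d.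
  rewrite mcoef_sum (bigD1 (Ordinal lt_d)) //= mcoefCM mcoef_mmon eqxx mulr1.
  rewrite big1 ?addr0 // => a ne; rewrite mcoefCM mcoef_mmon mon1_eq.
  by rewrite eq_sym -[_ == d]/(a == Ordinal lt_d) (negPf ne) mulr0.
have Eg : eqdeg k.+1 g g by [].
rewrite (eqdegM Ef Eg); last by rewrite mdegMn mdeg1 mul1n.
rewrite mulr_suml mcoef_sum; apply: eq_bigr => a _.
rewrite -mulrA mcoefCM [mmon _ _ * g]mulrC mcoefM_mmon; congr (_ * _).
have le_a : (a <= k)%N by rewrite -ltnS.
have -> : mon1 k = (mon1 (k - a) + mon1 a)%MM by apply/mnmP => i;
  rewrite mnmDE !mulmnE -mulnDr subnK.
by rewrite lem_addl addmK.
Qed.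

Section Main.
Variables (L : comNzRingType) (F : fgl L) (chi : nat -> L).
Hypotheses (hL : is_lazard F) (hchi : is_formal_inverse F chi).
Variables (phat_ qhat_ : nat -> symfun L).
Hypotheses (hphat_ : is_phat F chi phat_) (hqhat_ : is_qhat chi qhat_).

Let two_reg (c : L) : c *+ 2 = 0 -> c = 0.
Proof. exact: (lazard_torsion_free hL). Qed.

Lemma symfun_two_reg (f : symfun L) : f *+ 2 = 0 -> f = 0.
Proof.
move=> f2; apply: symfunP => m; apply/mpolyP => v.
rewrite (_ : (0 : symfun L) m = 0) // mcoeff0; apply: two_reg.
have -> : (f m)@_v *+ 2 = (symfun_ev m (f *+ 2))@_v by rewrite raddfMn mcoeffMn.
by rewrite f2 raddf0.
Qed.

Lemma qhat_Delta_coef m k : qhat_ k m = Delta_coef chi m k.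
Proof.
rewrite /Delta_coef (hqhat_ m) /var_t lift_X mser_comp_X.
by rewrite mulmnE mnm1E eqxx mul1n eqxx.
Qed.

Local Notation pv := (fun l : strict_partition => gprod phat_ (val l)).
Local Notation below N := (fun l : strict_partition => (spart_weight l < N)%N).
Local Notation S N := (lspan (below N) pv).

Lemma pspan_sat2 N f : S N (f *+ 2) -> S N f.
Proof.
move=> /lspan_uniq[s [c [u_s ltN E]]].
have c_even : forall l, exists b, l \in s -> c l = b *+ 2.
  move=> l; have [l_s|] := boolP (l \in s); last by exists 0.
  have [b Eb] := pprod_even hchi two_reg hphat_ u_s (esym E) l_s.
  by exists b.
have [b Eb] := choice c_even.
suff -> : f = \sum_(l <- s) b l *: pv l.
  by apply: lspan_sum_seq => l l_s; apply/lspan_scale/lspan_gen/ltN.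
apply/eqP; rewrite -subr_eq0; apply/eqP/symfun_two_reg.
rewrite mulrnBl E -sumrMnl -sumrB big_seq big1 // => l l_s.
by rewrite Eb // -scalerMnl subrr.
Qed.

Lemma pspan_sat N f k : S N (2%:R ^+ k *: f) -> S N f.
Proof.
elim: k f => [|k IHk] f; first by rewrite scale1r.
rewrite exprS -scalerA scaler_nat => /pspan_sat2; exact: IHk.
Qed.

(** The coefficients of a linear relation are even and their halves form a relation again, so each
    coefficient is divisible by all powers of 2. *)
Lemma pv_indep : lin_indep pv.
Proof.
move=> s c u_s E l l_s; apply: (lazard_separated hL) => k.
suff [d [Ed _]] : exists d, (forall l, l \in s -> c l = d l *+ 2 ^ k) /\
    \sum_(l <- s) d l *: pv l = 0.
  by exists (d l); apply: Ed.
elim: k => [|k [d [Ed Sd]]]; first by exists c; split=> // l' _.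
have d_even : forall l, exists b, l \in s -> d l = b *+ 2.
  move=> l'; have [l_s'|] := boolP (l' \in s); last by exists 0.
  have Sd2 : \sum_(l <- s) d l *: pv l = 0 *+ 2 by rewrite Sd mul0rn.
  have [b Eb] := pprod_even hchi two_reg hphat_ u_s Sd2 l_s'.
  by exists b.
have [b Eb] := choice d_even.
exists b; split=> [l' l_s'|]; first by rewrite Ed // Eb // expnS mulrnA.
apply: symfun_two_reg; rewrite -sumrMnl -[RHS]Sd !big_seq.
by apply: eq_bigr => l' l_s'; rewrite scalerMnl -Eb.
Qed.

(* [2](t) *)
Local Notation e2 a := (fgl_add F (var_t L) (var_t L) (mon1 a)).

(** The coefficient of phat_b in qhat_k, read off from 1 + [2](t) sum_b phat_b t^(b-1), with phat_0
    taken to be 1 as in [phat1]. The case b = k + 1 drops out since [2](t) has no constant term, and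
    b = k > 0 gives 2. *)
Definition qcoef k b : L :=
  if k is 0 then (b == 0%N)%:R else if (0 < b <= k)%N then e2 (k.+1 - b)%N else
    0.

Lemma qcoef_gt k b : (k < b)%N -> qcoef k b = 0.
Proof.
case: k => [|k] lt_b; first by case: b lt_b.
by rewrite /qcoef [(b <= _)%N]leqNgt lt_b andbF.
Qed.

Definition phat1 k : symfun L := if k is 0 then 1 else phat_ k.

Lemma e2_0 : e2 0 = 0.
Proof. by rewrite mulm0n /fgl_add fgl_subst0 fgl_u0. Qed.

Lemma e2_1 : e2 1 = 2%:R.
Proof. by have [E _] := lead_double F (ord0 : 'I_1); rewrite mulm1n E. Qed.

(** A bound K common to all factors lets a product of these sums be distributed over functions into
    ['I_K.+1]. *)
Lemma qhat_expand K k : (k <= K)%N ->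
  qhat_ k = \sum_(b < K.+1) qcoef k b *: phat1 b.
Proof.
move=> le_k; have -> : \sum_(b < K.+1) qcoef k b *: phat1 b =
    \sum_(b < k.+1) qcoef k b *: phat1 b.
  rewrite [RHS](big_ord_widen K.+1 (fun b => qcoef k b *: phat1 b)) //
    [RHS]big_mkcond.
  apply: eq_bigr => b _; case: ltnP => // lt_b.
  by rewrite qcoef_gt ?scale0r.
apply: symfunP => m; rewrite qhat_Delta_coef symfun_evE raddf_sum /=.
under [RHS]eq_bigr do rewrite symfun_evZ.
rewrite /Delta_coef (hphat_ m) mcoefD mcoef1 mcoefM_mon1.
have PE c : mser_comp (fun k => phat_ k.+1 m) (lift_series m (var_t L)) (mon1
  c) =
    symfun_ev m (phat_ c.+1).
  by rewrite /var_t lift_X mser_comp_X mulmnE mnm1E eqxx mul1n eqxx.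
have TE a : lift_series m (fgl_add F (var_t L) (var_t L)) (mon1 a) = (e2 a)%:MP.
  by rewrite mcoef_map.
rewrite (eq_bigr (fun a : 'I_k.+1 => (e2 a)%:MP * symfun_ev m (phat_ (k -
  a).+1))) => [|a _];
  last by rewrite TE PE.
case: k {le_k} => [|k].
  by rewrite !big_ord1 e2_0 mulm0n eqxx mpolyC0 mul0r addr0 scale1r rmorph1.
have -> : (mon1 k.+1 == 0%MM) = false.
  by apply/eqP => /(congr1 mdeg); rewrite mdegMn mdeg1 mdeg0 mul1n.
rewrite add0r !(big_ord_recl k.+1) e2_0 mpolyC0 mul0r scale0r !add0r.
rewrite [RHS](reindex_inj rev_ord_inj); apply: eq_bigr => a _.
have lt_a := ltn_ord a; rewrite mul_mpolyC lift0 /= /bump /= !add1n subSS.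
rewrite (_ : (k - a < k.+1)%N); last by lia.
by rewrite (_ : (k.+2 - (k - a).+1 = a.+1)%N); last by lia.
Qed.

Definition vprod n (a : 'X_{1..n}) : symfun L := \prod_(i < n) phat1 (a i).
Definition nsupp n (a : 'X_{1..n}) := #|[pred i | a i != 0%N]|.

(** Distributing the product yields exponents b with b_i <= a_i for all i, so b = a or b has smaller
    weight. Each nonzero a_i contributes one diagonal 2, and qhat_0 = 1 none. *)
Lemma qprod_expand n (a : 'X_{1..n}) :
  lspan (fun b : 'X_{1..n} => (weight b < weight a)%N) (@vprod n)
    (\prod_(i < n) qhat_ (a i) - 2%:R ^+ nsupp a *: vprod a).
Proof.
pose K := (\sum_i a i)%N.
have le_K (i : 'I_n) : (a i <= K)%N by rewrite /K (bigD1 i) //= leq_addr.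
rewrite (eq_bigr _ (fun i _ => qhat_expand (le_K i))) bigA_distr_bigA /=.
pose mf (f : {ffun 'I_n -> 'I_K.+1}) : 'X_{1..n} := [multinom (f i : nat) | i <
  n].
have E (f : {ffun 'I_n -> 'I_K.+1}) :
    \prod_i (qcoef (a i) (f i) *: phat1 (f i)) =
    (\prod_i qcoef (a i) (f i)) *: vprod (mf f).
  rewrite scaler_prod /vprod; congr (_ *: _).
  by apply: eq_bigr => i _; rewrite mnmE.
pose f0 : {ffun 'I_n -> 'I_K.+1} := [ffun i => inord (a i)].
have f0E i : f0 i = a i :> nat by rewrite ffunE inordK // ltnS.
rewrite (bigD1 f0) //= E.
have -> : vprod (mf f0) = vprod a.
  by apply: eq_bigr => i _; rewrite mnmE f0E.
have -> : \prod_i qcoef (a i) (f0 i) = 2%:R ^+ nsupp a.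
  rewrite /nsupp -prodr_const [RHS]big_mkcond; apply: eq_bigr => i _.
  rewrite f0E inE; case: (a i) => [|k] //=.
  by rewrite leqnn subSnn e2_1.
rewrite addrAC subrr add0r; apply: lspan_sum => f ne; rewrite E.
have [le_f|] := boolP [forall i, (f i <= a i)%N]; last first.
  rewrite negb_forall => /existsP[i]; rewrite -ltnNge => lt_i.
  by rewrite (bigD1 i) //= qcoef_gt // mul0r scale0r; constructor.
apply/lspan_scale/lspan_gen; move/forallP: le_f => le_f.
have [i ne_i] : exists i, f i != a i :> nat.
  apply/existsP; apply: contraNT ne => /existsPn H; apply/eqP/ffunP => i.
  by apply: val_inj; rewrite /= f0E; apply/eqP; rewrite -[_ == _]negbK;
    apply: H.
rewrite /weight (bigD1 i) //= [X in (_ < X)%N](bigD1 i) //=.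
apply: (@leq_ltn_trans (i.+1 * mf f i + \sum_(j < n | j != i) j.+1 * a j)%N).
  by rewrite leq_add2l leq_sum // => j _; rewrite leq_mul2l mnmE le_f.
by rewrite ltn_add2r ltn_pmul2l // mnmE ltn_neqAle ne_i le_f.
Qed.

Lemma gprod_vprod (g : nat -> symfun L) (s : seq nat) :
  gprod g s = \prod_(i < size s) g (exps (size s) s i).
Proof.
rewrite /gprod (big_nth 0%N) big_mkord; apply: eq_bigr => i _.
by rewrite mnmE.
Qed.

Lemma vprod_pos (s : seq nat) : 0%N \notin s ->
  vprod (exps (size s) s) = gprod phat_ s.
Proof.
move=> s0; rewrite gprod_vprod; apply: eq_bigr => i _; rewrite mnmE.
have : nth 0%N s i != 0%N by apply: contraNneq s0 => <-; apply: mem_nth.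
by case: (nth 0%N s i).
Qed.

Lemma strict_pos (l : strict_partition) : 0%N \notin val l.
Proof. by have /andP[] := valP l. Qed.

Lemma nsupp_strict (l : strict_partition) :
  nsupp (exps (size (val l)) (val l)) = size (val l).
Proof.
rewrite /nsupp -[RHS]card_ord; apply: eq_card => i; rewrite !inE mnmE.
by rewrite -lt0n (nth_strict_gt0 (valP l)).
Qed.

Section DualP.
Variables (Q : strict_partition -> forall n, mseries n L).
Variable phat : strict_partition -> symfun L.
Hypotheses (hQ : is_universal_Q F chi Q) (hphat : Cauchy_identity chi Q phat).

Let Q_big (l : strict_partition) n : (n < size (val l))%N -> Q l n = 0.
Proof. by move=> lt_n; have := hQ l n; rewrite /is_PQ lt_n. Qed.

Let Q_lead (l : strict_partition) n : (size (val l) <= n)%N ->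
  lead (Q l n) (exps n (val l)) (2%:R ^+ size (val l)).
Proof. exact: (lead_Q hchi (lazard_torsion_free hL) hQ). Qed.

Let Cauchy n (a : 'X_{1..n}) : \prod_(i < n) qhat_ (a i) =
  \sum_(l <- spart_enum (weight a)) Q l n a *: phat l.
Proof.
apply: (Cauchy_coef hphat) => [m k|l lt_l]; first exact: qhat_Delta_coef.
exact: (expansion_small (kappa := fun k => 2%:R ^+ k) Q_big Q_lead).
Qed.

(** The two claims feed each other: comparing phat_l with the product for l requires straightening
    the products of smaller weight with repeated indices, and straightening requires the phat_l of
    at most the same weight. *)
Lemma phat_triangular N :
  (forall l, (spart_weight l < N)%N -> S (spart_weight l) (phat l - pv l)) /\
  (forall n (a : 'X_{1..n}), (weight a < N)%N -> S (weight a).+1 (vprod a)).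
Proof.
elim: N => [|N [IH1 IH2]]; first by split.
have phatS l : (spart_weight l < N)%N -> S (spart_weight l).+1 (phat l).
  move=> lt_l; rewrite -[phat l](subrK (pv l)); apply: lspan_add.
    by apply: lspanW (IH1 l lt_l) => l' /ltnW.
  by apply: (lspan_gen pv (i := l)).
have diff n (a : 'X_{1..n}) : (weight a <= N)%N ->
    S (weight a) (\prod_(i < n) qhat_ (a i) - 2%:R ^+ nsupp a *: vprod a).
  move=> le_a; apply: lspan_trans (qprod_expand a) => b lt_b.
  apply: lspanW (IH2 n b (leq_trans lt_b le_a)) => l lt_l.
  exact: leq_trans lt_l lt_b.
have P1 l : (spart_weight l < N.+1)%N -> S (spart_weight l) (phat l - pv l).
  rewrite ltnS => le_l; pose a := exps (size (val l)) (val l).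
  apply: (@pspan_sat _ _ (size (val l))).
  (* The same prod_i qhat_(l_i) is 2^r phat_l plus lower phat by the Cauchy identity, and 2^r prod_i
     phat_(l_i) plus lower products by [qprod_expand]. *)
  have := diff _ a le_l; rewrite nsupp_strict vprod_pos ?strict_pos // Cauchy.
  have l_in : l \in spart_enum (weight a) by apply: mem_spart_enum.
  rewrite (bigD1_seq l) ?undup_uniq //=.
  have [-> _] := Q_lead (leqnn (size (val l))).
  set r := \sum_(l' <- _ | _) _ => Sd.
  have Sr : S (spart_weight l) r.
    apply: lspan_sum => l' ne; have [le'|lt'] := leqP (spart_weight l)
      (spart_weight l').
      rewrite (expansion_exps (kappa := fun k => 2%:R ^+ k) Q_big Q_lead ne
        le') scale0r.
      by constructor.
    apply/lspan_scale/(lspanW _ (phatS l' _)) => [l2|].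
      by rewrite ltnS => /leq_ltn_trans; apply.
    exact: leq_trans lt' le_l.
  rewrite scalerBr -(addrK r (_ *: phat l)) addrAC.
  exact: lspan_sub.
split=> // n a; rewrite ltnS => le_a.
(* Now a is arbitrary: 2^(nsupp a) times its product is prod_i qhat_(a_i) minus lower terms, and the
   Cauchy identity expands prod_i qhat_(a_i) in phat_l of weight at most that of a. *)
apply: (@pspan_sat _ _ (nsupp a)).
rewrite -[_ *: vprod a](subKr (\prod_(i < n) qhat_ (a i))).
apply: lspan_sub; last by apply: lspanW (diff n a le_a) => l /ltnW.
rewrite Cauchy; apply: lspan_sum => l _;
  have [lt_l|le_l] := ltnP (weight a) (spart_weight l).
  rewrite (expansion_small (kappa := fun k => 2%:R ^+ k) Q_big Q_lead lt_l)
    scale0r.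
  by constructor.
apply: lspan_scale; rewrite -[phat l](subrK (pv l)); apply: lspan_add.
  apply: lspanW (P1 l _) => [l2 lt2|]; last by rewrite ltnS (leq_trans le_l).
  by rewrite ltnS ltnW // (leq_trans lt2).
by apply: (lspan_gen pv (i := l)).
Qed.

Lemma phat_basis : lin_indep phat /\ is_basis_of phat (gen_by phat_).
Proof.
have tri l : lspan (below (spart_weight l)) pv (phat l - pv l).
  by have [H _] := phat_triangular (spart_weight l).+1; apply: H.
have ind : lin_indep phat.
  apply: (triangular_indep (d := fun=> 1) pv_indep) => [l x|l].
    by rewrite mulr1.
  by rewrite scale1r; apply: tri.
split=> //; apply: basis_of_gen_by => // [s s0|l];
  last exact: (triangular_span l tri).
rewrite -vprod_pos //; set a := exps _ _.
have [_ H] := phat_triangular (weight a).+1.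
apply: lspan_trans (H _ a (ltnSn _)) => l _.
exact: (triangular_span (v := phat) (w := pv) l (triangular_swap tri)).
Qed.

(** Triangular with diagonal 2^r over the independent products of phat; the lower terms are
    straightened by [phat_triangular]. *)
Lemma qprod_indep : lin_indep (fun l : strict_partition => gprod qhat_ (val l)).
Proof.
apply: (triangular_indep (rk := spart_weight) (d := fun l => 2%:R ^+ size (val
  l)) pv_indep).
  move=> l x; rewrite -natrX mulr_natr.
  by apply: (lazard_torsion_free hL); rewrite expn_gt0.
move=> l; pose a := exps (size (val l)) (val l).
have := qprod_expand a; rewrite nsupp_strict vprod_pos ?strict_pos //
  -gprod_vprod.
apply: lspan_trans => b lt_b.
have [_ H] := phat_triangular (weight b).+1.
apply: lspanW (H _ b (ltnSn _)) => l' lt_l'.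
exact: leq_trans lt_l' lt_b.
Qed.
End DualP.

Section DualQ.
Variables (P : strict_partition -> forall n, mseries n L).
Variable qhat : strict_partition -> symfun L.
Hypotheses (hP : is_universal_P F chi P) (hqhat : Cauchy_identity chi P qhat).
Hypothesis qprod_ind : lin_indep (fun l : strict_partition => gprod qhat_ (val
  l)).
Local Notation qv := (fun l : strict_partition => gprod qhat_ (val l)).

Let P_big (l : strict_partition) n : (n < size (val l))%N -> P l n = 0.
Proof. by move=> lt_n; have := hP l n; rewrite /is_PQ lt_n. Qed.

Let P_lead (l : strict_partition) n : (size (val l) <= n)%N ->
  lead (P l n) (exps n (val l)) 1.
Proof. exact: (lead_P hchi (lazard_torsion_free hL) hP). Qed.

Let Cauchy n (a : 'X_{1..n}) : \prod_(i < n) qhat_ (a i) =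
  \sum_(l <- spart_enum (weight a)) P l n a *: qhat l.
Proof.
apply: (Cauchy_coef hqhat) => [m k|l lt_l]; first exact: qhat_Delta_coef.
exact: (expansion_small (kappa := fun=> 1) P_big P_lead).
Qed.

(** As P has leading coefficient 1, the Cauchy identity is unitriangular over L at once and needs no
    saturation. It expands every product of the qhat_k directly in the dual functions. *)
Lemma qhat_basis : lin_indep qhat /\ is_basis_of qhat (gen_by qhat_).
Proof.
have tri l : lspan (below (spart_weight l)) qhat (qv l - qhat l).
  rewrite gprod_vprod Cauchy; set a := exps _ _.
  have l_in : l \in spart_enum (weight a) by apply: mem_spart_enum.
  rewrite (bigD1_seq l) ?undup_uniq //=.
  have [-> _] := P_lead (leqnn (size (val l))).
  rewrite scale1r addrAC subrr add0r; apply: lspan_sum => l' ne.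
  have [le'|lt'] := leqP (spart_weight l) (spart_weight l').
    rewrite (expansion_exps (kappa := fun=> 1) P_big P_lead ne le') scale0r.
    by constructor.
  by apply/lspan_scale/(lspan_gen qhat (i := l')).
have tri' := triangular_swap tri.
have ind : lin_indep qhat.
  apply: (triangular_indep (rk := spart_weight) (d := fun=> 1) qprod_ind) => [l
    x|l].
    by rewrite mulr1.
  by rewrite scale1r; apply: tri'.
split=> //; apply: basis_of_gen_by => // [s s0|l];
  last exact: (triangular_span l tri').
rewrite gprod_vprod Cauchy; apply: lspan_sum => l _.
by apply/lspan_scale/lspan_gen.
Qed.
End DualQ.
End Main.

Theorem theorem5p6 (L : comNzRingType) (F : fgl L) (chi : nat -> L)
    (hL : is_lazard F) (hchi : is_formal_inverse F chi)
    (P Q : strict_partition -> forall n : nat, mseries n L)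
    (hP : is_universal_P F chi P) (hQ : is_universal_Q F chi Q)
    (phat_ qhat_ : nat -> symfun L)
    (hphat_ : is_phat F chi phat_) (hqhat_ : is_qhat chi qhat_)
    (phat qhat : strict_partition -> symfun L)
    (hphat : Cauchy_identity chi Q phat) (hqhat : Cauchy_identity chi P qhat) :
  (lin_indep phat /\ is_basis_of phat (gen_by phat_)) /\
  (lin_indep qhat /\ is_basis_of qhat (gen_by qhat_)).
Proof.
split; first exact: (phat_basis hL hchi hphat_ hqhat_ hQ hphat).
apply: (qhat_basis hL hchi hqhat_ hP hqhat).
exact: (qprod_indep hL hchi hphat_ hqhat_ hQ hphat).
Qed.
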